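(* Let $\sigma\leq 1$. All smooth solitary waves of the system below (for $\vec u=(u,\eta)$) are stable in $X=H^1(\mathbb{R})\times L^2(\mathbb{R})$ in the orbital sense defined below.
   Context: Consider, for a constant $A>0$ and a real parameter $\sigma$, the system $u_t-u_{txx}-Au_x+3uu_x-\sigma(2u_xu_{xx}+uu_{xxx})+(1+\eta)\eta_x=0$, $\eta_t+((1+\eta)u)_x=0$, with $u,\eta\to0$ as $|x|\to\infty$ (here $\eta=\rho-1$). Let $X=H^1(\mathbb{R})\times L^2(\mathbb{R})$. With $p(x)=\frac12 e^{-|x|}$, a function $\vec u=(u,\eta)\in C([0,T);X)$ is a solution on $[0,T)$ if it satisfies $u_t+\sigma uu_x+\partial_x p\ast\big(-Au+\frac{3-\sigma}{2}u^2+\frac{\sigma}{2}u_x^2+\frac12(1+\eta)^2\big)=0$, $\eta_t+((1+\eta)u)_x=0$ in the distribution sense and the functionals $E(\vec u)=\frac12\int(u^2+u_x^2+\eta^2)\,dx$ and $F(\vec u)=\frac12\int(u^3+\sigma uu_x^2+2u\eta+u\eta^2-Au^2)\,dx$ are conserved. A solitary wave is a nontrivial traveling-wave solution $\vec\varphi_c(t,x)=(\varphi_c(x-ct),\eta_c(x-ct))\in H^1(\mathbb{R})\times H^1(\mathbb{R})$, $c\in\mathbb{R}$, with $\varphi_c,\eta_c$ vanishing at infinity; smooth solitary waves exist only for $c>A_1$ or $c<A_2$, where $A_{1,2}=\frac{-A\pm\sqrt{A^2+4}}{2}$. For $\epsilon>0$ let $U_\epsilon=\{\vec u\in X:\ \inf_{s\in\mathbb{R}}\|\vec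 u-\vec\varphi_c(\cdot-s)\|_X<\epsilon\}$. The solitary wave $\vec\varphi_c$ is called stable in $X$ if for every $\epsilon>0$ there is $\delta>0$ such that for any $\vec u_0\in U_\delta$, if $\vec u\in C([0,T);X)$, $0<T\leq\infty$, is a solution with $\vec u(0)=\vec u_0$, then $\vec u(t)\in U_\epsilon$ for all $t\in[0,T)$. *)

(* Defs.v *)
From HB Require Import structures.
From mathcomp Require Import all_boot all_order all_algebra.
From mathcomp Require Import all_classical all_reals all_analysis.
Set Implicit Arguments. Unset Strict Implicit. Unset Printing Implicit Defensive.
Import Order.TTheory GRing.Theory Num.Theory.
Import numFieldNormedType.Exports.
Local Open Scope classical_set_scope.
Local Open Scope ring_scope.

Section Defs.
Variable R : realType.

Definition leb := (@lebesgue_measure R).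
Definition intR (f : R -> R) : R := Rintegral leb setT f.

Definition L2 (f : R -> R) : Prop :=
  measurable_fun setT f /\ leb.-integrable setT (fun x => ((f x) ^+ 2)%:E).

Definition smooth1 (f : R -> R) : Prop :=
  forall (n : nat) (x : R), derivable (derive1n n f) x 1.

Definition test1 (f : R -> R) : Prop :=
  smooth1 f /\ exists M : R, forall x, M < `|x| -> f x = 0.

Definition weak_deriv (f g : R -> R) : Prop :=
  forall phi, test1 phi ->
    intR (fun x => f x * derive1 phi x) = - intR (fun x => g x * phi x).

Definition H1 (f : R -> R) : Prop :=
  L2 f /\ exists g, L2 g /\ weak_deriv f g.

Definition inX (v : (R -> R) * (R -> R)) : Prop := H1 v.1 /\ L2 v.2.

Definition distX_lt (v w : (R -> R) * (R -> R)) (e : R) : Prop :=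
  exists g, L2 g /\ weak_deriv (fun x => v.1 x - w.1 x) g /\
    intR (fun x => (v.1 x - w.1 x) ^+ 2 + (g x) ^+ 2 + (v.2 x - w.2 x) ^+ 2)
      < e ^+ 2.

Definition pt (f : R -> R -> R) : R -> R -> R :=
  fun t x => derive1 (fun s => f s x) t.
Definition px (f : R -> R -> R) : R -> R -> R :=
  fun t x => derive1 (f t) x.
Definition dpart (ds : seq bool) (f : R -> R -> R) : R -> R -> R :=
  foldr (fun (b : bool) g => if b then pt g else px g) f ds.
Definition smooth2 (f : R -> R -> R) : Prop :=
  forall ds : seq bool,
    continuous (fun p : R * R => dpart ds f p.1 p.2) /\
    forall t x, derivable (fun s => dpart ds f s x) t 1 /\
                derivable (fun y => dpart ds f t y) x 1.

Definition test2 (T : \bar R) (f : R -> R -> R) : Prop :=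
  smooth2 f /\ exists a b M : R, [/\ 0 < a, a < b, (b%:E < T)%E &
    forall t x, t < a \/ b < t \/ M < `|x| -> f t x = 0].

Definition pker (x : R) : R := expR (- `|x|) / 2.
Definition conv_p (g : R -> R) : R -> R :=
  fun x => intR (fun y => pker (x - y) * g y).

(* conserved functionals, with ux a (weak) derivative of u *)
Definition Efun (u ux eta : R -> R) : R :=
  intR (fun x => (u x) ^+ 2 + (ux x) ^+ 2 + (eta x) ^+ 2) / 2.
Definition Ffun (A sigma : R) (u ux eta : R -> R) : R :=
  intR (fun x => (u x) ^+ 3 + sigma * u x * (ux x) ^+ 2 + 2 * u x * eta x
                 + u x * (eta x) ^+ 2 - A * (u x) ^+ 2) / 2.

Definition in_time (T : \bar R) (t : R) : Prop := 0 <= t /\ (t%:E < T)%E.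

Definition is_solution (A sigma : R) (T : \bar R) (u eta : R -> R -> R) : Prop :=
  exists ux : R -> R -> R,
  [/\
      forall t, in_time T t -> L2 (u t) /\ L2 (ux t) /\ weak_deriv (u t) (ux t)
                               /\ L2 (eta t),
      forall t0, in_time T t0 -> forall e, 0 < e -> exists2 d, 0 < d &
        forall t, in_time T t -> `|t - t0| < d ->
          distX_lt (u t, eta t) (u t0, eta t0) e,
      forall phi, test2 T phi ->
        intR (fun t => intR (fun x =>
          - u t x * pt phi t x + sigma * u t x * ux t x * phi t x
          - conv_p (fun y => - A * u t y + (3 - sigma) / 2 * (u t y) ^+ 2
                             + sigma / 2 * (ux t y) ^+ 2
                             + (1 + eta t y) ^+ 2 / 2) x * px phi t x)) = 0,
      forall phi, test2 T phi ->
        intR (fun t => intR (fun x =>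
          - eta t x * pt phi t x - (1 + eta t x) * u t x * px phi t x)) = 0
    &
      forall t, in_time T t ->
        Efun (u t) (ux t) (eta t) = Efun (u 0) (ux 0) (eta 0) /\
        Ffun A sigma (u t) (ux t) (eta t) = Ffun A sigma (u 0) (ux 0) (eta 0)].

Definition solitary_wave (A sigma c : R) (phi etac : R -> R) : Prop :=
  [/\ H1 phi /\ H1 etac,
      [/\ phi x @[x --> +oo] --> 0, phi x @[x --> -oo] --> 0,
         etac x @[x --> +oo] --> 0 & etac x @[x --> -oo] --> 0],
      (exists x, phi x != 0 \/ etac x != 0) &
      is_solution A sigma +oo%E (fun t x => phi (x - c * t))
                                (fun t x => etac (x - c * t))].

Definition U_nbhd (phi etac : R -> R) (e : R) (v : (R -> R) * (R -> R)) : Prop :=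
  inX v /\ exists s : R, distX_lt v (fun x => phi (x - s), fun x => etac (x - s)) e.

Definition stable (A sigma : R) (phi etac : R -> R) : Prop :=
  forall e, 0 < e -> exists2 d, 0 < d &
    forall (T : \bar R) (u eta : R -> R -> R), (0 < T)%E ->
      U_nbhd phi etac d (u 0, eta 0) ->
      is_solution A sigma T u eta ->
      forall t, in_time T t -> U_nbhd phi etac e (u t, eta t).

End Defs.

(* Main.v *)
(* [E] and [F] are conserved, and completing the square in the density gives, for every [k],
     2 (k E - F) = \int (k - sigma u) u_x ^ 2 + u ^ 2 W(k - u) + (k - u) (eta - u / (k - u)) ^ 2
   with [W(y) = y + A - 1 / y].  Testing the weak equations on [a(t) b(x - c t)] yields
     eta = phi / (c - phi),   (c - sigma phi) phi' ^ 2 = phi ^ 2 W(c - phi),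
   so for [c > 0] the wave is positive with a single crest at the level [c - crit], where
   [crit] is the positive zero of [W].  The case [c < 0] follows by changing the signs of
   [u], [c] and [A], which preserves [E] and reverses [F]; [c = 0] does not occur.
   A perturbation [u] is compared with the speed [k] whose wave has the crest level of [u].
   Then [k E - F] exceeds
     2 \int_0^{max u} s sqrt (W(k - s) (k - sigma s)) ds
   by the integrals of two squares.  This quantity is strictly convex in the shift [k - c],
   and its value and slope at [c] are given by the action and the energy of the wave.  Hence
   if [E] and [F] are close to those of the wave, then the crest levels are close and [u]
   nearly satisfies the first-order profile equations.  A comparison of travel times along
   the two profiles gives a one-sided pointwise bound, which the closeness of the norms turns
   into closeness in H^1 x L^2.  A continuity argument in time concludes. *)

Require Import Defs.
From HB Require Import structures.
From mathcomp Require Import all_boot all_order all_algebra.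
From mathcomp Require Import all_classical all_reals all_analysis.
From mathcomp Require Import measurable_realfun ring lra.
Set Implicit Arguments. Unset Strict Implicit. Unset Printing Implicit Defensive.
Import Order.TTheory GRing.Theory Num.Theory.
Import numFieldNormedType.Exports.
Local Open Scope classical_set_scope.
Local Open Scope ring_scope.

(** Only two scalars are conserved, so closeness must be read off integrals of exact squares.
    Completing them at the fixed speed [c] fails for a perturbation whose crest exceeds [c - crit],
    since [W (c - u)] is negative there. Tuning the speed to the crest keeps the square roots real,
    at the price of an unknown shift [h]. The shift is controlled because at equal distance [k - s]
    the factor [sqrt W] is common to all speeds, and what remains, [t sqrt ((1 - sigma) t + y)], is
    convex in [t]; this is the main use of [sigma <= 1]. The second obstacle is the crest itself.
    The slope function vanishes there like a square root, so the first-order equation has several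
    solutions: a function may rest at the crest level for any length of time and still satisfy it.
    Hence no two-sided comparison with [phi] can come from that equation. Resting only makes [u]
    larger than [phi], so a lower bound survives; the energy, whose part [u ^ 2 + (u / (c - u)) ^ 2]
    grows with positive [u], then excludes the excess. *)

Local Notation mu := (@lebesgue_measure _).
Local Notation Ig D f := (mu.-integrable D (EFin \o (f : _ -> _))).

(** * Integrals over the line *)

Section Integration.
Variable R : realType.
Implicit Types (D : set R) (f g h : R -> R).

Lemma Ig_measurable D f : Ig D f -> measurable_fun D f.
Proof. by move=> /integrableP[/measurable_EFinP]. Qed.

Lemma IgD D f g : measurable D -> Ig D f -> Ig D g -> Ig D (fun x => f x + g x).
Proof.
move=> mD hf hg; rewrite (_ : EFin \o _ = ((EFin \o f) \+ (EFin \o g))%E) //.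
exact: integrableD.
Qed.

Lemma IgN D f : measurable D -> Ig D f -> Ig D (fun x => - f x).
Proof. by move=> mD hf; apply: (@eq_integrable _ _ _ mu D mD _ _ _ (integrableN hf)). Qed.

Lemma IgB D f g : measurable D -> Ig D f -> Ig D g -> Ig D (fun x => f x - g x).
Proof. by move=> mD hf hg; apply: IgD => //; exact: IgN. Qed.

Lemma IgZ D f k : measurable D -> Ig D f -> Ig D (fun x => k * f x).
Proof. move=> mD hf; rewrite (_ : EFin \o _ = (fun x => k%:E * (EFin \o f) x)%E) //.
exact: integrableZl. Qed.

Lemma Ig_le D f g : measurable D -> measurable_fun D f -> Ig D g ->
  (forall x, D x -> `|f x| <= g x) -> Ig D f.
Proof.
move=> mD mf ig fg; apply: le_integrable ig => //; first exact/measurable_EFinP.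
by move=> x Dx /=; rewrite lee_fin (le_trans (fg _ Dx))// ler_norm.
Qed.

Lemma Ig_norm D f : measurable D -> Ig D f -> Ig D (fun x => `|f x|).
Proof.
move=> mD hf; have mf := Ig_measurable hf.
apply: (@le_integrable _ _ _ mu D mD _ _ _ _ hf).
  exact/measurable_EFinP/measurableT_comp.
by move=> x _ /=; rewrite lee_fin normr_id.
Qed.

Lemma IgS D E f : measurable D -> measurable E -> D `<=` E -> Ig E f -> Ig D f.
Proof. by move=> mD mE DE; exact: integrableS. Qed.

Lemma Ig_T D f : measurable D -> Ig setT f -> Ig D f.
Proof. by move=> mD; apply: IgS. Qed.

Lemma Ig_mulb D f g M : measurable D -> measurable_fun D f ->
  (forall x, D x -> `|f x| <= M) -> Ig D g -> Ig D (fun x => f x * g x).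
Proof.
move=> mD mf fM ig; apply: (Ig_le (g := fun x => M * `|g x|)) => //.
- by apply: measurable_funM => //; exact: Ig_measurable ig.
- by apply: IgZ => //; exact: Ig_norm.
- by move=> x Dx; rewrite normrM ler_wpM2r// fM.
Qed.

Lemma continuous_Ig f (a b : R) : continuous f -> Ig `[a, b] f.
Proof.
move=> cf; apply: continuous_compact_integrable; first exact: segment_compact.
exact: continuous_subspaceT.
Qed.

Lemma Ig_cst (a b k : R) : Ig `[a, b] (fun=> k).
Proof. by apply: continuous_Ig => x; exact: cvg_cst. Qed.

Lemma int_add f (a b c : R) : a <= b -> b <= c -> Ig `[a, c] f ->
  \int[mu]_(x in `[a, c]) f x =
  \int[mu]_(x in `[a, b]) f x + \int[mu]_(x in `[b, c]) f x.
Proof.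
move=> ab bc iF; have := @Rintegral_itvB R f (BLeft a) (BRight c) b iF.
rewrite !bnd_simp => /(_ ab bc); rewrite Rintegral_itv_obnd_cbnd; first by lra.
apply: IgS iF => //; apply: subset_itvr; by rewrite bnd_simp.
Qed.

Lemma int_le_norm D f : measurable D -> Ig D f ->
  `|\int[mu]_(x in D) f x| <= \int[mu]_(x in D) `|f x|.
Proof. by move=> mD iF; exact: le_normr_Rintegral. Qed.

Lemma int_cst (a b k : R) : a <= b -> \int[mu]_(x in `[a, b]) k = k * (b - a).
Proof.
move=> ab; rewrite Rintegral_cst//= lebesgue_measure_itv/= lte_fin.
case: ltP => // ba.
by have -> : b = a by [apply/eqP; rewrite eq_le ab ba]; rewrite subrr.
Qed.

Lemma intD D f g : measurable D -> Ig D f -> Ig D g ->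
  \int[mu]_(x in D) (f x + g x) = \int[mu]_(x in D) f x + \int[mu]_(x in D) g x.
Proof. by move=> *; exact: RintegralD. Qed.

Lemma intB D f g : measurable D -> Ig D f -> Ig D g ->
  \int[mu]_(x in D) (f x - g x) = \int[mu]_(x in D) f x - \int[mu]_(x in D) g x.
Proof. by move=> *; exact: RintegralB. Qed.

Lemma intZ D f k : measurable D -> Ig D f ->
  \int[mu]_(x in D) (k * f x) = k * \int[mu]_(x in D) f x.
Proof. by move=> *; exact: RintegralZl. Qed.

Lemma intN D f : measurable D -> Ig D f ->
  \int[mu]_(x in D) (- f x) = - \int[mu]_(x in D) f x.
Proof.
move=> mD iF; rewrite -mulN1r -intZ//; congr Rintegral; apply/funext => x.
by rewrite mulN1r.
Qed.

Lemma int_mono D f g : measurable D -> Ig D f -> Ig D g ->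
  (forall x, D x -> f x <= g x) ->
  \int[mu]_(x in D) f x <= \int[mu]_(x in D) g x.
Proof. by move=> *; exact: le_Rintegral. Qed.

Lemma eq_int D f g : (forall x, D x -> f x = g x) ->
  \int[mu]_(x in D) f x = \int[mu]_(x in D) g x.
Proof. by move=> fg; apply: eq_Rintegral => x /set_mem; exact: fg. Qed.

Lemma int_ge0 D f : (forall x, D x -> 0 <= f x) -> 0 <= \int[mu]_(x in D) f x.
Proof. by move=> f0; apply: Rintegral_ge0. Qed.

Lemma int_subset D E f : measurable D -> measurable E -> D `<=` E -> Ig E f ->
  (forall x, E x -> 0 <= f x) ->
  \int[mu]_(x in D) f x <= \int[mu]_(x in E) f x.
Proof.
move=> mD mE DE iF f0; have iD : Ig D f := IgS mD mE DE iF.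
rewrite /Rintegral fine_le//.
- exact: integrable_fin_num.
- exact: integrable_fin_num.
- apply: ge0_subset_integral => //; first exact: measurable_int iF.
Qed.

Lemma ae_imp (P Q : R -> Prop) : {ae (@lebesgue_measure R), forall x, P x} ->
  (forall x, P x -> Q x) -> {ae (@lebesgue_measure R), forall x, Q x}.
Proof.
move=> hP PQ; apply: filterS hP => //.
exact: (ae_filter_ringOfSetsType (@lebesgue_measure R)).
Qed.

Lemma ae_int D f g : measurable D -> measurable_fun D f -> measurable_fun D g ->
  {ae mu, forall x, f x = g x} ->
  \int[mu]_(x in D) f x = \int[mu]_(x in D) g x.
Proof.
move=> mD mf mg fg; congr fine; apply: ae_eq_integral => //.
- exact/measurable_EFinP.
- exact/measurable_EFinP.
- by apply: (ae_imp fg) => x -> _.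
Qed.

Lemma ae_Ig D f g : measurable D -> measurable_fun D g ->
  {ae mu, forall x, f x = g x} -> Ig D f -> Ig D g.
Proof.
move=> mD mg fg /integrableP[mf iF]; apply/integrableP; split.
  exact/measurable_EFinP.
rewrite (@ae_eq_integral _ _ _ mu D (fun x => `|(EFin \o f) x|)%E)//.
- by apply: measurableT_comp => //; exact/measurable_EFinP.
- exact: measurableT_comp.
- by apply: (ae_imp fg) => x /= -> _.
Qed.

End Integration.

(** * Calculus of pointwise derivatives *)

Section PointwiseDerivatives.
Variable R : realType.
Implicit Types (f g : R -> R) (x : R).

Lemma der_eq f g x a b : (forall y, f y = g y) -> a = b ->
  is_derive x 1 f a -> is_derive x 1 g b.
Proof. by move=> /funext -> ->. Qed.

Lemma der_cst (k x : R) : is_derive x 1 (fun=> k) 0.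
Proof. exact: is_derive_cst. Qed.

Lemma der_id x : is_derive x 1 (fun y : R => y) 1.
Proof. exact: is_derive_id. Qed.

Lemma derD f g x a b : is_derive x 1 f a -> is_derive x 1 g b ->
  is_derive x 1 (fun y => f y + g y) (a + b).
Proof. by move=> hf hg; apply: is_deriveD. Qed.

Lemma derN f x a : is_derive x 1 f a -> is_derive x 1 (fun y => - f y) (- a).
Proof. by move=> hf; apply: is_deriveN. Qed.

Lemma derB f g x a b : is_derive x 1 f a -> is_derive x 1 g b ->
  is_derive x 1 (fun y => f y - g y) (a - b).
Proof. by move=> hf hg; apply: derD => //; exact: derN. Qed.

Lemma derM f g x a b : is_derive x 1 f a -> is_derive x 1 g b ->
  is_derive x 1 (fun y => f y * g y) (a * g x + f x * b).
Proof.
move=> hf hg; apply: is_derive_eq (is_deriveM hf hg) _.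
by rewrite /GRing.scale /=; ring.
Qed.

Lemma derZ (k : R) f x a : is_derive x 1 f a ->
  is_derive x 1 (fun y => k * f y) (k * a).
Proof.
by move=> hf; apply: is_derive_eq (derM (der_cst k x) hf) _; ring.
Qed.

Lemma der_comp f g x a b : is_derive (g x) 1 f a -> is_derive x 1 g b ->
  is_derive x 1 (fun y => f (g y)) (a * b).
Proof. by move=> hf hg; exact: is_derive1_comp. Qed.

Lemma derX n f x a : is_derive x 1 f a ->
  is_derive x 1 (fun y => f y ^+ n) (n%:R * f x ^+ n.-1 * a).
Proof.
move=> hf; elim: n => [|n IH].
  by apply: der_eq (der_cst 1 x) => [y|]; rewrite ?expr0// !mul0r.
apply: der_eq (derM hf IH) => [y|]; first by rewrite exprS.
case: n {IH} => [|n]; first by rewrite /= !expr0; ring.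
by rewrite /= -!natr1 exprS; ring.
Qed.

Lemma derV f x a : f x != 0 -> is_derive x 1 f a ->
  is_derive x 1 (fun y => (f y)^-1) (- a / f x ^+ 2).
Proof.
move=> fx hf; apply: is_derive_eq (is_deriveV fx hf) _.
by rewrite /GRing.scale /=; field.
Qed.

Lemma der_continuous f x a : is_derive x 1 f a -> {for x, continuous f}.
Proof.
by move=> df; apply/differentiable_continuous/derivable1_diffP; case: df.
Qed.

Lemma der_derivable f x a : is_derive x 1 f a -> derivable f x 1.
Proof. by case. Qed.

Lemma der_derive1 f x a : is_derive x 1 f a -> derive1 f x = a.
Proof. by move=> df; rewrite derive1E; case: df. Qed.

Lemma derivable_der f x : derivable f x 1 -> is_derive x 1 f (derive1 f x).
Proof. by move=> df; split=> //; rewrite derive1E. Qed.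

End PointwiseDerivatives.

(** * Absolutely continuous functions given with their densities *)

Section AbsolutelyContinuous.
Variable R : realType.
Implicit Types (f g h U V : R -> R).

(** At the supremum of the points up to which [P] holds throughout, the left condition gives [P] and
    the right one pushes beyond. It serves twice: to glue local estimates in the chain rule, and to
    run the continuity argument in time. *)
Lemma real_induction (a b : R) (P : R -> Prop) : a <= b -> P a ->
  (forall x, a <= x < b -> P x ->
     exists2 d, 0 < d & forall z, x < z < x + d -> z <= b -> P z) ->
  (forall x, a < x <= b -> (forall y, a <= y < x -> P y) -> P x) -> P b.
Proof.
move=> ab Pa Pr Pl.
pose S := [set x | a <= x <= b /\ forall y, a <= y <= x -> P y].
have Sa : S a.
  split; first by rewrite lexx.
  by move=> y /andP[ay ya]; have -> : y = a by apply/eqP; rewrite eq_le ay ya.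
have supS : has_sup S.
  by split; [exists a|exists b => x [/andP[]]].
have as_ : a <= sup S by apply: sup_upper_bound.
have sb : sup S <= b by apply: sup_le_ub; [exists a|move=> x [/andP[]]].
have Plt y : a <= y < sup S -> P y.
  move=> /andP[ay ys]; have [x Sx yx] := sup_gt (ex_intro _ a Sa) ys.
  by case: Sx => _; apply; rewrite ay ltW.
have Ps : P (sup S).
  move: as_; rewrite le_eqVlt => /orP[/eqP <- //|as_].
  by apply: Pl => //; rewrite as_.
move: sb; rewrite le_eqVlt => /orP[/eqP <- //|sb].
have [d d0 Pd] := Pr (sup S) (introT andP (conj as_ sb)) Ps.
pose z := Num.min b (sup S + d / 2).
suff : z <= sup S.
  by rewrite /z ge_min => /orP[]; [move: sb; lra|move: d0; lra].
apply: sup_upper_bound => //; split.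
  rewrite /z ge_min lexx /= le_min ab /=; move: as_ d0; lra.
move=> y /andP[ay]; rewrite /z le_min => /andP[yb yd].
have [ys|ys] := ltP y (sup S); first by apply: Plt; rewrite ay.
move: ys; rewrite le_eqVlt => /orP[/eqP <- //|ys].
by apply: Pd => //; rewrite ys /=; move: yd d0; lra.
Qed.

Definition locint g := forall a b, Ig `[a, b] g.

Definition AC U g := locint g /\
  forall a b, a <= b -> U b - U a = \int[mu]_(x in `[a, b]) g x.

Lemma locint_cont g : continuous g -> locint g.
Proof. by move=> cg a b; exact: continuous_Ig. Qed.

Lemma locint_Ig g : Ig setT g -> locint g.
Proof. by move=> ig a b; exact: Ig_T. Qed.

Lemma AC_continuous U g : AC U g -> continuous U.
Proof.
move=> [ig Ug] x.
have xx : x - 1 < x + 1 by lra.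
have := parameterized_integral_continuous (ltW xx) (ig (x - 1) (x + 1)).
move/(continuous_within_itvP _ xx) => [+ _ _].
have xin : x \in `](x - 1), (x + 1)[ by rewrite in_itv /=; lra.
move=> /(_ x xin) cx.
have eqU y : x - 1 <= y ->
    U y = U (x - 1) + parameterized_integral mu (x - 1) y g.
  by move=> xy; rewrite /parameterized_integral -Ug//; ring.
have cx' : (fun y => U (x - 1) + parameterized_integral mu (x - 1) y g) y
    @[y --> x] --> U x.
  by rewrite (eqU x); [apply: cvgD => //; exact: cvg_cst|lra].
apply: cvg_trans cx'; apply: near_eq_cvg; near=> y.
rewrite -eqU//; near: y; apply/nbhs_ballP; exists 1 => //= y.
by rewrite /ball /= ltr_norml; lra.
Unshelve. all: by end_near. Qed.

Lemma AC_eq U g V h : (forall x, U x = V x) -> (forall x, g x = h x) ->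
  AC U g -> AC V h.
Proof. by move=> /funext -> /funext ->. Qed.

Lemma AC_D U g V h : AC U g -> AC V h -> AC (fun x => U x + V x) (fun x => g x + h x).
Proof.
move=> [ig Ug] [ih Vh]; split; first by move=> a b; exact: IgD.
by move=> a b ab; rewrite intD// -Ug// -Vh//; ring.
Qed.

Lemma AC_Z U g k : AC U g -> AC (fun x => k * U x) (fun x => k * g x).
Proof.
move=> [ig Ug]; split; first by move=> a b; exact: IgZ.
by move=> a b ab; rewrite intZ// -Ug//; ring.
Qed.

Lemma AC_B U g V h : AC U g -> AC V h -> AC (fun x => U x - V x) (fun x => g x - h x).
Proof.
move=> hU hV; apply: AC_eq (AC_D hU (AC_Z (-1) hV)) => x; ring.
Qed.

Lemma AC_C1 U g : (forall x : R, is_derive x 1 U (g x)) -> continuous g -> AC U g.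
Proof.
move=> dU cg; split; first exact: locint_cont.
have cU : continuous U.
  by move=> x; apply/differentiable_continuous/derivable1_diffP; case: (dU x).
move=> a b; rewrite le_eqVlt => /orP[/eqP ->|ab].
  by rewrite set_itv1 Rintegral_set1 subrr.
rewrite /Rintegral (@continuous_FTC2 _ _ U)//.
- exact: continuous_subspaceT.
- split=> [x _|//|//]; first by case: (dU x).
  + by apply: cvg_at_right_filter; exact: cU.
  + by apply: cvg_at_left_filter; exact: cU.
- by move=> x _; rewrite derive1E; case: (dU x).
Qed.

(* Local Lipschitz-type control by [eps * \int |g|] propagates from points to
   intervals; it is checked with the mean value theorem. *)
Lemma AC_comp U g (Phi phi : R -> R) :
  (forall x : R, is_derive x 1 Phi (phi x)) -> continuous phi ->
  AC U g -> AC (fun x => Phi (U x)) (fun x => phi (U x) * g x).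
Proof.
move=> dPhi cphi hU; have cU := AC_continuous hU; case: hU => ig Ug.
have cphiU : continuous (fun x => phi (U x)).
  by move=> x; apply: continuous_comp; [exact: cU|exact: cphi].
have ilg : locint (fun x => phi (U x) * g x).
  move=> a b.
  have [c _ cM] := @EVT_max R (fun x => `|phi (U x)|) a (Num.max a b)
     (ltac:(by rewrite le_max lexx)) (continuous_subspaceT (fun x => cvg_norm (cphiU x))).
  apply: (Ig_mulb (M := `|phi (U c)|)) => //.
    by apply: measurable_funTS; exact: continuous_measurable_fun.
  move=> x; rewrite /= in_itv /= => /andP[ax xb]; apply: cM.
  by rewrite in_itv /= ax /= le_max xb orbT.
split=> // a b ab.
have loc eps x : 0 < eps -> exists2 d, 0 < d & forall y z,
    x - d < y -> y <= z -> z < x + d ->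
    `|Phi (U z) - Phi (U y) - \int[mu]_(s in `[y, z]) (phi (U s) * g s)|
    <= eps * \int[mu]_(s in `[y, z]) `|g s|.
  move=> e0.
  have [eta eta0 Heta] : exists2 eta, 0 < eta &
      forall v, `|U x - v| < eta -> `|phi (U x) - phi v| < eps / 2.
    have /cvgrPdist_lt/(_ (eps / 2)) := cphi (U x).
    move=> /(_ (ltac:(lra))) /nbhs_ballP[eta /= eta0 H].
    by exists eta => // v; exact: H.
  have [d d0 Hd] : exists2 d, 0 < d &
      forall s, `|x - s| < d -> `|U x - U s| < eta.
    have /cvgrPdist_lt/(_ eta eta0) := cU x.
    move=> /nbhs_ballP[d /= d0 H].
    by exists d => // v; exact: H.
  exists d => // y z xy yz zx.
  have Hs s : y <= s <= z -> `|U x - U s| < eta.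
    by move=> /andP[ys sz]; apply: Hd; rewrite ltr_norml; lra.
  have [xi Hxi ->] : exists2 xi, `|U x - xi| < eta &
      Phi (U z) - Phi (U y) = phi xi * (U z - U y).
    have Hy := Hs y (ltac:(lra)); have Hz := Hs z (ltac:(lra)).
    move: Hy Hz; rewrite !ltr_norml => Hy Hz.
    have cPhi : continuous Phi.
      by move=> v; apply/differentiable_continuous/derivable1_diffP; case: (dPhi v).
    have [yz'|zy'] := leP (U y) (U z).
      have [xi + ->] := @MVT_segment R Phi phi _ _ yz' (fun x _ => dPhi x)
        (continuous_subspaceT cPhi).
      by rewrite in_itv /= => Hxi; exists xi => //; rewrite ltr_norml; lra.
    have [xi + E] := @MVT_segment R Phi phi _ _ (ltW zy') (fun x _ => dPhi x)
      (continuous_subspaceT cPhi).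
    rewrite in_itv /= => Hxi; exists xi; first by rewrite ltr_norml; lra.
    by rewrite -opprB E; ring.
  rewrite Ug// -intZ// -intB//; last exact: IgZ.
  apply: le_trans (int_le_norm _ _) _ => //; first by apply: IgB => //; exact: IgZ.
  rewrite -intZ//; last exact: Ig_norm.
  apply: int_mono => //.
  - by apply: Ig_norm => //; apply: IgB => //; exact: IgZ.
  - by apply: IgZ => //; exact: Ig_norm.
  move=> s; rewrite /= in_itv /= => sI.
  rewrite -mulrBl normrM ler_wpM2r//.
  have := Heta _ Hxi; have := Heta _ (Hs s sI).
  by rewrite ler_norml !ltr_norml; lra.
apply/eqP; rewrite -subr_eq0 -normr_le0; apply/ler_addgt0Pr => e e0; rewrite add0r.
pose G := \int[mu]_(s in `[a, b]) `|g s|.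
have G0 : 0 <= G by apply: int_ge0.
pose eps := e / (G + 1).
have eps0 : 0 < eps by rewrite divr_gt0//; lra.
suff : `|Phi (U b) - Phi (U a) - \int[mu]_(s in `[a, b]) (phi (U s) * g s)|
    <= eps * G.
  move=> /le_trans; apply; rewrite /eps mulrAC ler_pdivrMr; last lra.
  by rewrite ler_wpM2l//; lra.
pose P x := `|Phi (U x) - Phi (U a) - \int[mu]_(s in `[a, x]) (phi (U s) * g s)|
    <= eps * \int[mu]_(s in `[a, x]) `|g s|.
have step x y : a <= x -> x <= y -> P x ->
    `|Phi (U y) - Phi (U x) - \int[mu]_(s in `[x, y]) (phi (U s) * g s)|
    <= eps * \int[mu]_(s in `[x, y]) `|g s| -> P y.
  move=> ax xy; rewrite /P (int_add ax xy)// (int_add (f := fun s => `|g s|) ax xy); last exact: Ig_norm.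
  by rewrite !ler_norml mulrDr; lra.
rewrite -/(P b); apply: (@real_induction a b P ab).
- by rewrite /P !set_itv1 !Rintegral_set1; rewrite subrr subrr normr0 mulr0.
- move=> x /andP[ax xb] Px; have [d d0 Hd] := loc eps x eps0.
  exists d => // z /andP[xz zd] zb.
  by apply: (step x) => //; [exact: ltW|apply: Hd => //; [lra|exact: ltW]].
- move=> x /andP[ax xb] Px; have [d d0 Hd] := loc eps x eps0.
  pose y := Num.max a (x - d / 2).
  have ay : a <= y by rewrite le_max lexx.
  have yx : y < x by rewrite gt_max ax /=; lra.
  apply: (step y) => //; first exact: ltW.
    by apply: Px; rewrite ay yx.
  apply: Hd => //; [|exact: ltW|lra].
  by rewrite lt_max; apply/orP; right; lra.
Qed.

Lemma AC_sqr U g : AC U g -> AC (fun x => U x ^+ 2) (fun x => 2 * U x * g x).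
Proof.
move=> hU; have := @AC_comp _ _ (fun x => x ^+ 2) (fun x => 2 * x) _ _ hU.
apply.
  by move=> x; apply: is_derive_eq (derX 2 (der_id x)) _; rewrite expr1; ring.
by move=> x; apply: cvgM => //; exact: cvg_cst.
Qed.

(** Polarisation, [4 U V = (U + V) ^ 2 - (U - V) ^ 2], reduces products to the chain rule for
    squares. *)
Lemma AC_M U g V h : AC U g -> AC V h ->
  AC (fun x => U x * V x) (fun x => g x * V x + U x * h x).
Proof.
move=> hU hV.
apply: AC_eq (AC_Z (1 / 4) (AC_B (AC_sqr (AC_D hU hV)) (AC_sqr (AC_B hU hV)))) => x.
  by field.
by field.
Qed.

End AbsolutelyContinuous.

(** * Integrals over intervals and over the line, translation invariance *)

Section WholeLine.
Variable R : realType.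
Implicit Types (f g h : R -> R).

Definition L1 (f : R -> R) : Prop := Ig [set: R] f.
Definition iv (a b : R) (f : R -> R) : R := \int[mu]_(x in `[a, b]) f x.

Lemma measurable_addr (a : R) : measurable_fun [set: R] (fun x : R => x + a).
Proof. by apply: measurable_funD => //; exact: measurable_cst. Qed.

Lemma lebesgue_measure_shift (a : R) (A : set R) : measurable A ->
  pushforward mu ((fun x => x + a) : _ -> measurableTypeR R) A = mu A.
Proof.
move=> mA; apply/esym/lebesgue_measure_unique => //=; first exact: measurable_addr.
move=> ma _ [[u v]] _ <-; rewrite /pushforward /=.
rewrite (_ : _ @^-1` _ = `]u - a, v - a]%classic).
  rewrite !lebesgue_measure_itv /= !lte_fin ltrD2r -!EFinD.
  by case: ifP => // _; congr EFin; lra.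
by apply/seteqP; split=> x /=; rewrite !in_itv /= ltrBlDr lerBrDr.
Qed.

Lemma integral_shift (f : R -> \bar R) (a : R) : measurable_fun [set: R] f ->
  (forall x, 0 <= f x)%E ->
  (\int[mu]_(x in [set: R]) f ((x : R) + a)%R = \int[mu]_(x in [set: R]) f x)%E.
Proof.
move=> mf f0.
have ma := measurable_addr a.
rewrite -[LHS](@ge0_integral_pushforward _ _ _ _ R
  ((fun x => x + a) : measurableTypeR R -> measurableTypeR R) ma mu setT f)//.
apply: eq_measure_integral => A mA _; exact: lebesgue_measure_shift.
Qed.

Lemma measurable_shift f (a : R) :
  measurable_fun [set: R] f -> measurable_fun [set: R] (fun x : R => f (x + a)).
Proof. by move=> mf; apply: measurableT_comp => //; exact: measurable_addr. Qed.

(** The positive and negative parts are translated separately, which covers every measurable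
    function, in particular the densities of [E] and [F]. *)
Lemma int_shift f (a : R) : measurable_fun [set: R] f ->
  intR (fun x => f (x + a)) = intR f.
Proof.
move=> mf; congr fine; rewrite integralE [RHS]integralE; congr (_ - _)%E.
- rewrite -[RHS](@integral_shift _ a) //; first by apply: eq_integral => x _; rewrite ?funeposE ?funenegE.
  by apply: measurable_funepos; exact/measurable_EFinP.
- rewrite -[RHS](@integral_shift _ a) //; first by apply: eq_integral => x _; rewrite ?funeposE ?funenegE.
  by apply: measurable_funeneg; exact/measurable_EFinP.
Qed.

Lemma L1_measurable f : L1 f -> measurable_fun [set: R] f.
Proof. exact: Ig_measurable. Qed.

Lemma L1_shift f (a : R) : L1 f -> L1 (fun x => f (x + a)).
Proof.
move=> /integrableP[mf iF]; apply/integrableP; split.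
  by apply/measurable_EFinP; apply: measurable_shift; move/measurable_EFinP: mf.
rewrite (@integral_shift (fun x => `|(f x)%:E|%E) a)//.
exact: measurableT_comp.
Qed.

Lemma L1D f g : L1 f -> L1 g -> L1 (fun x => f x + g x).
Proof. by move=> *; exact: IgD. Qed.
Lemma L1B f g : L1 f -> L1 g -> L1 (fun x => f x - g x).
Proof. by move=> *; exact: IgB. Qed.

Lemma L1Z f k : L1 f -> L1 (fun x => k * f x).
Proof. by move=> *; exact: IgZ. Qed.
Lemma L1_norm f : L1 f -> L1 (fun x => `|f x|).
Proof. by move=> *; exact: Ig_norm. Qed.
Lemma L1_le f g : measurable_fun [set: R] f -> L1 g ->
  (forall x, `|f x| <= g x) -> L1 f.
Proof. by move=> mf ig fg; exact: (Ig_le _ mf ig). Qed.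
Lemma eq_L1 f g : (forall x, f x = g x) -> L1 f -> L1 g.
Proof. by move=> /funext ->. Qed.
Lemma L1_mulb f g M : measurable_fun [set: R] f -> (forall x, `|f x| <= M) ->
  L1 g -> L1 (fun x => f x * g x).
Proof. by move=> mf fM; apply: Ig_mulb. Qed.

Lemma intR_D f g : L1 f -> L1 g -> intR (fun x => f x + g x) = intR f + intR g.
Proof. by move=> *; exact: intD. Qed.
Lemma intR_B f g : L1 f -> L1 g -> intR (fun x => f x - g x) = intR f - intR g.
Proof. by move=> *; exact: intB. Qed.
Lemma intR_Z f k : L1 f -> intR (fun x => k * f x) = k * intR f.
Proof. by move=> *; exact: intZ. Qed.
Lemma intR_N f : L1 f -> intR (fun x => - f x) = - intR f.
Proof. by move=> *; exact: intN. Qed.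
Lemma intR_mono f g : L1 f -> L1 g -> (forall x, f x <= g x) -> intR f <= intR g.
Proof. by move=> *; exact: int_mono. Qed.
Lemma eq_intR f g : (forall x, f x = g x) -> intR f = intR g.
Proof. by move=> /funext ->. Qed.
Lemma intR_ge0 f : (forall x, 0 <= f x) -> 0 <= intR f.
Proof. by move=> f0; exact: int_ge0. Qed.
Lemma intR_le_norm f : L1 f -> `|intR f| <= intR (fun x => `|f x|).
Proof. by move=> *; exact: int_le_norm. Qed.
Lemma intR_0 : intR (fun _ : R => 0) = 0.
Proof. by rewrite /intR /Rintegral integral0. Qed.

Lemma ae_intR f g : measurable_fun [set: R] f -> measurable_fun [set: R] g ->
  {ae (@lebesgue_measure R), forall x, f x = g x} -> intR f = intR g.
Proof. by move=> *; exact: ae_int. Qed.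
Lemma ae_L1 f g : measurable_fun [set: R] g ->
  {ae (@lebesgue_measure R), forall x, f x = g x} -> L1 f -> L1 g.
Proof. by move=> *; exact: (ae_Ig (f := f)). Qed.

Lemma L1_locint f : L1 f -> locint f.
Proof. exact: locint_Ig. Qed.

Lemma locintD f g : locint f -> locint g -> locint (fun x => f x + g x).
Proof. by move=> hf hg a b; exact: IgD. Qed.
Lemma locintB f g : locint f -> locint g -> locint (fun x => f x - g x).
Proof. by move=> hf hg a b; exact: IgB. Qed.
Lemma locintZ f k : locint f -> locint (fun x => k * f x).
Proof. by move=> hf a b; exact: IgZ. Qed.
Lemma locint_norm f : locint f -> locint (fun x => `|f x|).
Proof. by move=> hf a b; exact: Ig_norm. Qed.
Lemma locint_le f g : measurable_fun [set: R] f -> locint g ->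
  (forall x, `|f x| <= g x) -> locint f.
Proof.
move=> mf hg fg a b; apply: (Ig_le _ _ (hg a b)) => //.
exact: measurable_funTS.
Qed.
Lemma eq_locint f g : (forall x, f x = g x) -> locint f -> locint g.
Proof. by move=> /funext ->. Qed.

Lemma locintM f g : continuous f -> locint g -> locint (fun x => f x * g x).
Proof.
move=> cf ig a b.
have [c _ cM] := @EVT_max R (fun x => `|f x|) a (Num.max a b)
   (ltac:(by rewrite le_max lexx)) (continuous_subspaceT (fun x => cvg_norm (cf x))).
apply: (Ig_mulb (M := `|f c|)) => //.
  by apply: measurable_funTS; exact: continuous_measurable_fun.
move=> x; rewrite /= in_itv /= => /andP[ax xb]; apply: cM.
by rewrite in_itv /= ax /= le_max xb orbT.
Qed.

Lemma ivD a b f g : locint f -> locint g ->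
  iv a b (fun x => f x + g x) = iv a b f + iv a b g.
Proof. by move=> *; exact: intD. Qed.
Lemma ivB a b f g : locint f -> locint g ->
  iv a b (fun x => f x - g x) = iv a b f - iv a b g.
Proof. by move=> *; exact: intB. Qed.
Lemma ivZ a b f k : locint f -> iv a b (fun x => k * f x) = k * iv a b f.
Proof. by move=> *; exact: intZ. Qed.
Lemma iv_mono a b f g : locint f -> locint g ->
  (forall x, a <= x <= b -> f x <= g x) -> iv a b f <= iv a b g.
Proof.
move=> iF ig fg; apply: int_mono => // x; rewrite /= in_itv /=; exact: fg.
Qed.
Lemma eq_iv a b f g : (forall x, a <= x <= b -> f x = g x) -> iv a b f = iv a b g.
Proof. by move=> fg; apply: eq_int => x; rewrite /= in_itv /=; exact: fg. Qed.
Lemma iv_ge0 a b f : (forall x, a <= x <= b -> 0 <= f x) -> 0 <= iv a b f.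
Proof. by move=> f0; apply: int_ge0 => x; rewrite /= in_itv /=; exact: f0. Qed.
Lemma iv_le_norm a b f : locint f -> `|iv a b f| <= iv a b (fun x => `|f x|).
Proof. by move=> iF; exact: int_le_norm. Qed.
Lemma iv_cst (a b k : R) : a <= b -> iv a b (fun=> k) = k * (b - a).
Proof. exact: int_cst. Qed.
Lemma iv_add a b c f : a <= b -> b <= c -> locint f ->
  iv a c f = iv a b f + iv b c f.
Proof. by move=> ab bc iF; exact: int_add. Qed.
Lemma ivxx a f : iv a a f = 0.
Proof. by rewrite /iv set_itv1 Rintegral_set1. Qed.
Lemma iv_sub a b c d f : c <= a -> b <= d -> locint f ->
  (forall x, 0 <= f x) -> iv a b f <= iv c d f.
Proof.
move=> ca bd iF f0; apply: int_subset => //.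
by apply: subset_itvScc; rewrite bnd_simp.
Qed.
Lemma iv_le_intR a b f : L1 f -> (forall x, 0 <= f x) -> iv a b f <= intR f.
Proof. by move=> iF f0; apply: int_subset. Qed.

Lemma AC_iv U g a b : AC U g -> a <= b -> U b - U a = iv a b g.
Proof. by move=> [_]; exact. Qed.
Lemma AC_locint U g : AC U g -> locint g.
Proof. by case. Qed.
Lemma AC_intro U g : locint g ->
  (forall a b, a <= b -> U b - U a = iv a b g) -> AC U g.
Proof. by []. Qed.

Lemma indicE0 (D : set R) (f : R -> R) : f \_ D = (fun x => \1_D x * f x).
Proof.
apply/funext => x; rewrite patchE indicE; case: (x \in D); first by rewrite mul1r.
by rewrite mul0r.
Qed.

Lemma L1_indic (a b : R) f : L1 (fun x => \1_(`[a, b]%classic) x * f x) <->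
  Ig `[a, b] f.
Proof.
have H := @integrable_mkcond _ _ R mu `[a, b]%classic (EFin \o f) (measurable_itv _).
rewrite H (_ : (EFin \o f) \_ _ = EFin \o (f \_ `[a, b]%classic)).
  by rewrite indicE0.
exact: restrict_EFin.
Qed.

Lemma int_indic (a b : R) f : intR (fun x => \1_(`[a, b]%classic) x * f x) = iv a b f.
Proof. by rewrite /iv Rintegral_mkcond indicE0. Qed.

Lemma L1_1itv (a b : R) : L1 (\1_(`[a, b]%classic) : R -> R).
Proof.
apply: eq_L1 (proj2 (L1_indic a b (fun=> 1)) _) => [x|]; first by rewrite mulr1.
exact: Ig_cst.
Qed.

Lemma int_1itv (a b : R) : a <= b -> intR (\1_(`[a, b]%classic) : R -> R) = b - a.
Proof.
move=> ab; rewrite -[RHS]mul1r -(iv_cst 1 ab) -int_indic.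
by apply: eq_intR => x; rewrite mulr1.
Qed.

Lemma indic_shift (a b t x : R) :
  \1_(`[a + t, b + t]%classic) (x + t) = \1_(`[a, b]%classic) x :> R.
Proof.
by rewrite !indicE; congr (nat_of_bool _)%:R; apply/idP/idP;
  rewrite !inE /= !in_itv /= !lerD2r.
Qed.

Lemma iv_shift f (a b t : R) : locint f ->
  iv a b (fun x => f (x + t)) = iv (a + t) (b + t) f.
Proof.
move=> /(_ (a + t) (b + t)) /L1_indic iF; rewrite -[LHS]int_indic -[RHS]int_indic.
rewrite -[RHS](int_shift t); last exact: L1_measurable iF.
by apply: eq_intR => x; rewrite indic_shift.
Qed.

Lemma locint_shift f (t : R) : locint f -> locint (fun x => f (x + t)).
Proof.
move=> iF a b; apply/L1_indic.
have /L1_indic /(L1_shift t) := iF (a + t) (b + t).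
by apply: eq_L1 => x; rewrite indic_shift.
Qed.

Lemma AC_shift U g (t : R) : AC U g -> AC (fun x : R => U (x + t)) (fun x => g (x + t)).
Proof.
move=> [ig Ug]; apply: AC_intro; first exact: locint_shift.
by move=> a b ab; rewrite iv_shift// /iv -Ug// lerD2r.
Qed.

(** Dominated convergence along the intervals with integer end points, followed by monotonicity in
    [r], available because [h] is nonnegative. *)
Lemma tail_int h (e : R) : L1 h -> (forall x, 0 <= h x) -> 0 < e ->
  exists2 r0 : R, 0 < r0 & forall r, r0 <= r -> intR h - iv (- r) r h < e.
Proof.
move=> ih h0 e0.
pose f_ (n : nat) x := (\1_(`[- n%:R, n%:R]%classic) x * h x)%:E.
have mh : measurable_fun [set: R] h by exact: L1_measurable ih.
have iI n : L1 (fun x => \1_(`[- n%:R, n%:R]%classic) x * h x).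
  by apply/L1_indic; exact: L1_locint.
have mf n : measurable_fun [set: R] (f_ n).
  by apply/measurable_EFinP; exact: L1_measurable (iI n).
have mh' : measurable_fun [set: R] (EFin \o h) by exact/measurable_EFinP.
have c1 : {ae (@lebesgue_measure R), forall x, [set: R] x ->
    f_ ^~ x @ \oo --> (EFin \o h) x}.
  apply: aeW => x _; apply: cvg_near_cst.
  exists (Num.bound `|x|) => // n /= xn; congr EFin.
  rewrite indicE mem_set ?mul1r //= in_itv /= -ler_norml.
  by rewrite ltW// (lt_le_trans (archi_boundP _))// ler_nat.
have c2 : {ae (@lebesgue_measure R), forall x, forall n, [set: R] x ->
    (`|f_ n x| <= (EFin \o h) x)%E}.
  apply: aeW => x n _; rewrite lee_fin normrM ger0_norm// ger0_norm//.
  by rewrite indicE ler_piMl// lern1 leq_b1.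
have [_ _ cvi] := @dominated_convergence _ _ R (@lebesgue_measure R) [set: R] measurableT _ _ _ mf mh' c1 ih c2.
have fin n : (\int[mu]_x f_ n x)%E = (iv (- n%:R) n%:R h)%:E.
  by rewrite -int_indic /intR /Rintegral fineK//; exact: integrable_fin_num (iI n).
move: cvi; rewrite (_ : (fun _ => _) = (fun n => (iv (- n%:R) n%:R h)%:E)); last first.
  by apply/funext => n; rewrite -fin.
rewrite (_ : integral _ _ _ = (intR h)%:E); last first.
  by rewrite /intR /Rintegral fineK//; exact: integrable_fin_num.
move/fine_cvgP => [_ /cvgrPdist_lt /(_ e e0)] [N _ HN].
exists (N%:R + 1); first by rewrite ltr_wpDl.
move=> r Nr; apply: le_lt_trans (HN N (leqnn N)) => /=.
apply: le_trans (ler_norm _); rewrite lerB//; apply: iv_sub => //; last exact: L1_locint.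
  by lra.
by lra.
Qed.

Lemma int_limit f (e : R) : L1 f -> 0 < e ->
  exists2 r0 : R, 0 < r0 & forall r, r0 <= r -> `|intR f - iv (- r) r f| < e.
Proof.
move=> iF e0.
have [r0 r00 H] := tail_int (L1_norm iF) (fun x => normr_ge0 (f x)) e0.
exists r0 => // r rr0; apply: le_lt_trans (H r rr0).
have iI g : L1 g -> L1 (fun x => \1_(`[- r, r]%classic) x * g x).
  by move=> ig; apply/L1_indic; exact: L1_locint.
rewrite -(int_indic _ _ f) -(int_indic _ _ (fun x => `|f x|)).
have i1 := iI _ iF; have i2 := iI _ (L1_norm iF).
rewrite -intR_B// -intR_B//; last exact: L1_norm.
apply: le_trans (intR_le_norm _) _; first exact: L1B.
apply: intR_mono.
- by apply: L1_norm; exact: L1B.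
- by apply: L1B => //; exact: L1_norm.
move=> x; rewrite indicE; case: (x \in _) => /=.
  by rewrite !mul1r !subrr normr0.
by rewrite !mul0r !subr0.
Qed.

End WholeLine.

(** * Smooth functions *)

Section SmoothFunctions.
Variable R : realType.
Implicit Types (f g h : R -> R).

(** A coinduction principle: [smooth1] speaks of iterated derivatives, and exhibiting a class stable
    under one derivation replaces a formula for the [n]-th derivative. *)
Lemma smooth1_class (P : (R -> R) -> Prop) :
  (forall f, P f -> (forall x, derivable f x 1) /\ P (derive1 f)) ->
  forall f, P f -> smooth1 f.
Proof.
move=> HP f Pf.
have Pn n : P (derive1n n f).
  by elim: n => [//|n IH]; rewrite derive1nS; case: (HP _ IH).
by move=> n x; case: (HP _ (Pn n)).
Qed.

Lemma smooth1_der f x : smooth1 f -> is_derive x (1 : R) f (derive1 f x).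
Proof. by move=> sf; apply: derivable_der; exact: (sf 0%N x). Qed.

Lemma derive1_fun f g : (forall x : R, is_derive x 1 f (g x)) -> derive1 f = g.
Proof. by move=> D; apply/funext => x; exact: der_derive1 (D x). Qed.

Lemma eq_smooth1 f g : (forall x, f x = g x) -> smooth1 f -> smooth1 g.
Proof. by move=> /funext ->. Qed.

Lemma smooth1_derive1 f : smooth1 f -> smooth1 (derive1 f).
Proof. by move=> sf n x; rewrite -derive1Sn; exact: sf. Qed.

Lemma smooth1_continuous f : smooth1 f -> continuous f.
Proof. by move=> sf x; exact: der_continuous (smooth1_der x sf). Qed.

Lemma smooth1_AC f : smooth1 f -> AC f (derive1 f).
Proof.
move=> sf; apply: AC_C1; first by move=> x; exact: smooth1_der.
exact/smooth1_continuous/smooth1_derive1.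
Qed.

(** Products alone are not stable under derivation; their finite sums are, by the Leibniz rule. This
    closure is the class given to [smooth1_class]. *)
Inductive sums_of_products : (R -> R) -> Prop :=
| sop_mul f g : smooth1 f -> smooth1 g -> sums_of_products (fun x => f x * g x)
| sop_add f g : sums_of_products f -> sums_of_products g ->
    sums_of_products (fun x => f x + g x).

Lemma sop_smooth f : sums_of_products f -> smooth1 f.
Proof.
move: f; apply: smooth1_class => f; elim=> {f} [f g sf sg|f g _ [df Pf] _ [dg Pg]].
  have D x := derM (smooth1_der x sf) (smooth1_der x sg).
  split=> [x|]; first exact: der_derivable (D x).
  rewrite (derive1_fun D).
  exact: sop_add (sop_mul (smooth1_derive1 sf) sg) (sop_mul sf (smooth1_derive1 sg)).
have D x := derD (derivable_der (df x)) (derivable_der (dg x)).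
split=> [x|]; first exact: der_derivable (D x).
by rewrite (derive1_fun D); exact: sop_add Pf Pg.
Qed.

Lemma smooth1M f g : smooth1 f -> smooth1 g -> smooth1 (fun x => f x * g x).
Proof. by move=> sf sg; exact: sop_smooth (sop_mul sf sg). Qed.

Lemma smooth1_cst (k : R) : smooth1 (fun=> k).
Proof.
apply: (@smooth1_class (fun f => exists k, f = fun=> k)); last by exists k.
move=> _ [{}k ->]; split=> [x|]; first exact: der_derivable (der_cst k x).
by exists 0; exact: derive1_fun (fun x => der_cst k x).
Qed.

Arguments smooth1_cst : clear implicits.

Lemma smooth1D f g : smooth1 f -> smooth1 g -> smooth1 (fun x => f x + g x).
Proof.
(* Sums are known to be smooth only as sums of products, hence the factors [1]. *)
move=> sf sg; apply: (@eq_smooth1 (fun x => 1 * f x + 1 * g x)).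
  by move=> x; rewrite !mul1r.
have s1 := smooth1_cst (1 : R).
exact: sop_smooth (sop_add (sop_mul s1 sf) (sop_mul s1 sg)).
Qed.

Lemma smooth1Z f (k : R) : smooth1 f -> smooth1 (fun x => k * f x).
Proof. by move=> sf; exact: smooth1M (smooth1_cst k) sf. Qed.

Lemma smooth1N f : smooth1 f -> smooth1 (fun x => - f x).
Proof.
move=> sf; apply: (@eq_smooth1 (fun x => -1 * f x)); last exact: smooth1Z.
by move=> x; rewrite mulN1r.
Qed.

Lemma smooth1B f g : smooth1 f -> smooth1 g -> smooth1 (fun x => f x - g x).
Proof. by move=> sf sg; exact: smooth1D sf (smooth1N sg). Qed.

Lemma der_affine (a b x : R) : is_derive x 1 (fun y : R => a * y + b) a.
Proof.
by apply: is_derive_eq (derD (derZ a (der_id x)) (der_cst b x)) _; ring.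
Qed.

Lemma smooth1_affine f (a b : R) : smooth1 f -> smooth1 (fun x => f (a * x + b)).
Proof.
move=> sf; apply: (@smooth1_class (fun g => exists k f, smooth1 f /\
    g = fun x => k * f (a * x + b))); last first.
  by exists 1, f; split=> //; apply/funext => x; rewrite mul1r.
move=> _ [k [{sf}f [sf ->]]].
have D x := derZ k (@der_comp _ f (fun y => a * y + b) x _ _
  (smooth1_der (a * x + b) sf) (der_affine a b x)).
split=> [x|]; first exact: der_derivable (D x).
exists (k * a), (derive1 f); split; first exact: smooth1_derive1.
by rewrite (derive1_fun D); apply/funext => x; ring.
Qed.

Arguments smooth1_affine : clear implicits.

Lemma smooth1_shift f (b : R) : smooth1 f -> smooth1 (fun x => f (x + b)).
Proof.
move=> sf; apply: (eq_smooth1 _ (smooth1_affine _ 1 b sf)) => x.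
by rewrite mul1r.
Qed.

Lemma derive1_shift f (b x : R) : smooth1 f ->
  derive1 (fun x => f (x + b)) x = derive1 f (x + b).
Proof.
move=> sf; apply: der_derive1; rewrite -[derive1 f _]mulr1.
exact: (@der_comp _ f (fun y => y + b) x _ _ (smooth1_der (x + b) sf)
  (der_eq (fun y => congr1 (fun z => z + b) (mul1r y)) erefl (der_affine 1 b x))).
Qed.

Lemma smooth1_primitive f g : (forall x : R, is_derive x 1 g (f x)) ->
  smooth1 f -> smooth1 g.
Proof.
move=> dg sf.
have E : derive1 g = f by apply/funext => x; rewrite (der_derive1 (dg x)).
move=> [|n] x; first exact: der_derivable (dg x).
by rewrite derive1Sn E; exact: sf.
Qed.

(** The difference quotient is at most [C * |t|]. This settles the origin for the flat functions,
    the point where their two pieces are glued. *)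
Lemma der0_quadratic f (x C : R) : (forall t : R, `|f (x + t) - f x| <= C * t ^+ 2) ->
  is_derive x 1 f 0.
Proof.
move=> H.
have C0 : 0 <= C by have := H 1; rewrite expr1n mulr1; apply: le_trans.
have cv : h^-1 *: ((f \o shift x) (h *: 1) - f x) @[h --> 0^'] --> (0 : R).
  apply/cvgrPdist_lt => e e0; near=> h.
  have h0 : h != 0 by near: h; exact: nbhs_dnbhs_neq.
  rewrite sub0r normrN /GRing.scale /= mulr1 normrM normfV addrC.
  rewrite (addrC h x).
  rewrite ltr_pdivrMl ?normr_gt0// [- _ + _]addrC; apply: (le_lt_trans (H h)).
  rewrite -(real_normK (num_real h)) expr2 mulrA [X in _ < X]mulrC ltr_pM2r ?normr_gt0//.
  have hb : `|h| < e / (C + 1).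
    by near: h; apply: dnbhs0_lt; rewrite divr_gt0//; lra.
  move: hb; rewrite ltr_pdivlMr; last lra.
  have := normr_ge0 h; nra.
have dv : derivable f x 1 by apply/cvg_ex; exists 0.
by split=> //; apply: cvg_lim => //; exact: cv.
Unshelve. all: by end_near. Qed.

Lemma der_horner (p : {poly R}) (x : R) : is_derive x 1 (horner p) p^`().[x].
Proof.
elim/poly_ind: p => [|p c IH].
  by apply: der_eq (der_cst 0 x) => [y|]; rewrite ?deriv0 horner0.
apply: der_eq (derD (derM IH (der_id x)) (der_cst c x)) => [y|].
  by rewrite !hornerE.
by rewrite derivD derivM derivX derivC !hornerE; ring.
Qed.

Lemma pow_exp_bound (n : nat) (y : R) : 0 <= y -> y ^+ n * expR (- y) <= (n`!)%:R.
Proof.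
move=> y0; case: n => [|n].
  by rewrite expr0 mul1r fact0 -[X in _ <= X]expR0 ler_expR oppr_le0.
have := expR_ge1Dxn n y0.
rewrite expRN ler_pdivrMr ?expR_gt0// => H.
have f0 : 0 < (n.+1)`!%:R :> R by rewrite ltr0n fact_gt0.
have : y ^+ n.+1 / (n.+1)`!%:R <= expR y by lra.
by rewrite ler_pdivrMr// mulrC.
Qed.

(** Termwise, from [y ^ i exp (- y) <= i!], which is one term of the exponential series. *)
Lemma horner_exp_bound (p : {poly R}) :
  exists C : R, forall y, 0 <= y -> `|p.[y]| * expR (- y) <= C.
Proof.
exists (\sum_(i < size p) `|p`_i| * (i`!)%:R) => y y0.
rewrite horner_coef; apply: le_trans (ler_wpM2r (expR_ge0 _) (ler_norm_sum _ _ _)) _.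
rewrite mulr_suml; apply: ler_sum => i _.
rewrite normrM -mulrA ler_wpM2l// normrX (ger0_norm y0); exact: pow_exp_bound.
Qed.

(* The functions [p (1/x) exp (-1/x)], extended by [0], are stable under derivation. *)
Definition flat (p : {poly R}) (x : R) : R :=
  if 0 < x then p.[x^-1] * expR (- x^-1) else 0.

Lemma der_flat (p : {poly R}) (x : R) : is_derive x 1 (flat p) (flat ('X^2 * (p - p^`())) x).
Proof.
rewrite {2}/flat; case: ltgtP => [x0|x0|<-].
- apply: (@near_eq_is_derive R R R (fun x => p.[x^-1] * expR (- x^-1))).
    near=> y; rewrite /flat ifT//; near: y; exact: lt_nbhsr.
  have nx : x != 0 by rewrite gt_eqF.
  have dV := derV nx (der_id x).
  apply: is_derive_eq (derM (der_comp (der_horner p _) dV)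
    (der_comp (is_derive_expR _) (derN dV))) _.
  by rewrite hornerM hornerXn hornerD hornerN; field.
- apply: near_eq_is_derive (der_cst 0 x).
  near=> y; rewrite /flat ifF//; apply/negbTE; rewrite -leNgt ltW//.
  by near: y; exact: lt_nbhsl.
(* The extra factor ['X^2], evaluated at [1 / h], turns boundedness into the quadratic bound
   [C * h ^ 2]. *)
- have [C HC] := horner_exp_bound ('X^2 * p).
  apply: (@der0_quadratic _ _ C) => h; rewrite add0r /flat ltxx subr0.
  have C0 : 0 <= C by have := HC 0 (lexx _); apply: le_trans; rewrite mulr_ge0 ?expR_ge0.
  case: ifPn => [h0|_]; last by rewrite normr0 mulr_ge0 ?sqr_ge0.
  have hV : 0 <= h^-1 by rewrite invr_ge0 ltW.
  have := HC _ hV; rewrite hornerM hornerXn normrM normrX (ger0_norm hV) normrM.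
  rewrite (ger0_norm (expR_ge0 _)) exprVn -mulrA ler_pdivrMl ?exprn_gt0//.
  by rewrite [_ * C]mulrC.
Unshelve. all: by end_near. Qed.

Lemma flat_smooth (p : {poly R}) : smooth1 (flat p).
Proof.
apply: (@smooth1_class (fun f => exists p, f = flat p)); last by exists p.
move=> _ [{}p ->]; split=> [x|]; first exact: der_derivable (der_flat p x).
exists ('X^2 * (p - p^`())); apply/funext => x; exact: der_derive1 (der_flat p x).
Qed.

Arguments flat_smooth : clear implicits.

Definition bump0 (x : R) : R := flat 1 x * flat 1 (1 - x).

Lemma bump0_smooth : smooth1 bump0.
Proof.
apply: smooth1M; first exact: flat_smooth.
apply: (eq_smooth1 _ (smooth1_affine _ (-1) 1 (flat_smooth 1))) => x.
by congr flat; ring.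
Qed.

Lemma flat1_ge0 x : 0 <= flat 1 x.
Proof. by rewrite /flat; case: ifP => // _; rewrite hornerE mul1r expR_ge0. Qed.

Lemma bump0_ge0 x : 0 <= bump0 x.
Proof. by rewrite mulr_ge0 ?flat1_ge0. Qed.

Lemma bump0_out x : x <= 0 \/ 1 <= x -> bump0 x = 0.
Proof.
rewrite /bump0 /flat; case=> H; first by rewrite ltNge H mul0r.
by rewrite [X in _ * X]ifF ?mulr0//; apply/negbTE; rewrite -leNgt; lra.
Qed.

Lemma bump0_gt0 x : 0 < x < 1 -> 0 < bump0 x.
Proof.
move=> /andP[x0 x1]; rewrite /bump0 /flat x0 ifT; last lra.
by rewrite !hornerE !mulr_gt0 ?expR_gt0.
Qed.

End SmoothFunctions.

(** * Test functions and weak derivatives *)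

Section WeakDerivatives.
Variable R : realType.
Implicit Types (f g h psi : R -> R) (x : R).

Lemma dct (f_ : nat -> R -> R) f g : (forall n, measurable_fun [set: R] (f_ n)) ->
  (forall x, f_ ^~ x @ \oo --> f x) -> (forall n x, `|f_ n x| <= g x) -> L1 g ->
  L1 f /\ (fun n => intR (f_ n)) @ \oo --> intR f.
Proof.
move=> mf cf fg ig.
have mfn n : measurable_fun [set: R] (EFin \o f_ n) by exact/measurable_EFinP.
have c1 : {ae (@lebesgue_measure R), forall x, [set: R] x ->
    (fun n => (EFin \o f_ n) x) @ \oo --> (EFin \o f) x}.
  by apply: aeW => x _; apply: cvg_EFin; [exact: nearW|exact: cf].
have c2 : {ae (@lebesgue_measure R), forall x, forall n, [set: R] x ->
    (`|(EFin \o f_ n) x| <= (EFin \o g) x)%E}.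
  by apply: aeW => x n _; rewrite lee_fin.
have mlim : measurable_fun [set: R] (EFin \o f).
  apply/measurable_EFinP.
  by apply: (measurable_fun_cvg mf) => x _; exact: cf.
have [if_ _ cvi] := @dominated_convergence _ _ R (@lebesgue_measure R) [set: R]
  measurableT _ _ _ mfn mlim c1 ig c2.
have ifn n : L1 (f_ n) by apply: (L1_le (mf n) ig) => x.
split=> //.
move: cvi; rewrite (_ : (fun _ => _) = (fun n => (intR (f_ n))%:E)); last first.
  by apply/funext => n; rewrite /intR /Rintegral fineK//; exact: integrable_fin_num (ifn n).
rewrite (_ : integral _ _ _ = (intR f)%:E); last first.
  by rewrite /intR /Rintegral fineK//; exact: integrable_fin_num.
by move/fine_cvgP => [].
Qed.

Lemma FTC1c f a x : continuous f -> a < x -> is_derive x 1 (fun y => iv a y f) (f x).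
Proof.
move=> cf ax.
have xx : x < x + 1 by lra.
have [d e] := @continuous_FTC1_closed R f a x (x + 1) xx
  (@continuous_Ig R f a (x + 1) cf) ax (cf x).
by rewrite -e; apply: derivable_der.
Qed.

Lemma AC_exists g : locint g -> exists F, AC F g.
Proof.
move=> ig; exists (fun x => if 0 <= x then iv 0 x g else - iv x 0 g).
apply: AC_intro => // a b ab; case: ifPn => b0; case: ifPn => a0.
- by rewrite (iv_add a0 ab ig); ring.
- by rewrite -ltNge in a0; rewrite (iv_add (ltW a0) b0 ig); ring.
- by move: b0; rewrite -ltNge => b0; move: a0 ab b0; lra.
- by rewrite -ltNge in b0; rewrite (iv_add ab (ltW b0) ig); ring.
Qed.

Lemma AC_addc F g k : AC F g -> AC (fun x => F x + k) g.
Proof. by move=> [ig Fg]; split=> // a b ab; rewrite -Fg//; ring. Qed.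

Lemma test1_AC psi : test1 psi -> AC psi (derive1 psi).
Proof. by case=> sp _; exact: smooth1_AC. Qed.

Lemma supp_derive1 psi (M : R) : (forall x, M < `|x| -> psi x = 0) ->
  forall x, M < `|x| -> derive1 psi x = 0.
Proof.
move=> H x xM; apply: der_derive1.
apply: near_eq_is_derive (der_cst 0 x).
have : \forall y \near x, M < `|y|.
  have cn : continuous (fun y : R => `|y|) by move=> y; exact: norm_continuous.
  have := cn x; move/cvgrPdist_lt => /(_ (`|x| - M)).
  rewrite subr_gt0 => /(_ xM); apply: filterS => y.
  by rewrite ltr_norml; lra.
by apply: filterS => y /H.
Qed.

Lemma test1_derive1 psi : test1 psi -> test1 (derive1 psi).
Proof.
case=> sp [M HM]; split; first exact: smooth1_derive1.
by exists M; exact: supp_derive1.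
Qed.

Lemma test1D f g : test1 f -> test1 g -> test1 (fun x => f x + g x).
Proof.
case=> sf [M HM] [sg [N HN]]; split; first exact: smooth1D.
by exists (Num.max M N) => x; rewrite gt_max => /andP[/HM -> /HN ->]; rewrite addr0.
Qed.

Lemma test1Z k f : test1 f -> test1 (fun x => k * f x).
Proof.
case=> sf [M HM]; split; first exact: smooth1Z.
by exists M => x /HM ->; rewrite mulr0.
Qed.

Lemma test1_shift f a : test1 f -> test1 (fun x => f (x + a)).
Proof.
case=> sf [M HM]; split; first exact: smooth1_shift.
exists (M + `|a|) => x Mx; apply: HM.
have := ler_normB (x + a) a; rewrite addrK; lra.
Qed.

Lemma supp_indic f M : (forall x, M < `|x| -> f x = 0) ->
  forall x, \1_(`[- M, M]%classic) x * f x = f x.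
Proof.
move=> H x; rewrite indicE; case: (boolP (x \in _)) => [_|xM].
  by rewrite mul1r.
rewrite mul0r H// ltNge ler_norml.
by apply: contra xM => xM; rewrite inE /= in_itv.
Qed.

Lemma L1_supp f M : locint f -> (forall x, M < `|x| -> f x = 0) -> L1 f.
Proof.
move=> lf H; apply: (eq_L1 (supp_indic H)).
by apply/L1_indic; exact: lf.
Qed.

Lemma intR_supp f M : (forall x, M < `|x| -> f x = 0) -> intR f = iv (- M) M f.
Proof. by move=> H; rewrite -int_indic; apply: eq_intR => x; rewrite supp_indic. Qed.

Lemma L1_test f psi : locint f -> test1 psi -> L1 (fun x => f x * psi x).
Proof.
move=> lf [sp [M HM]]; apply: (@L1_supp _ M) => [|x /HM ->]; last exact: mulr0.
by apply: eq_locint (locintM (smooth1_continuous sp) lf) => x; rewrite mulrC.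
Qed.

Lemma AC_parts F g psi : AC F g -> test1 psi ->
  intR (fun x => F x * derive1 psi x) = - intR (fun x => g x * psi x).
Proof.
move=> Fg tp; have [sp [M0 HM0]] := tp.
pose M := Num.max 0 M0 + 1.
have HM x : M <= `|x| -> psi x = 0.
  move=> Mx; apply: HM0; apply: lt_le_trans Mx.
  have : M0 <= Num.max 0 M0 by rewrite le_max lexx orbT.
  by rewrite /M; lra.
have M1 : 0 <= M by rewrite /M addr_ge0// le_max lexx.
have lF : locint F by apply: locint_cont; exact: AC_continuous Fg.
have i1 := L1_test lF (test1_derive1 tp).
have i2 := L1_test (AC_locint Fg) tp.
apply/eqP; rewrite -addr_eq0 -intR_D//.
have P := AC_M Fg (test1_AC tp).
rewrite (@intR_supp _ M); last first.
  move=> x /ltW xM; rewrite HM// (@supp_derive1 _ M0) ?mulr0 ?addr0//.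
  apply: lt_le_trans xM.
  have : M0 <= Num.max 0 M0 by rewrite le_max lexx orbT.
  by rewrite /M; lra.
have MM : - M <= M by lra.
have p1 : psi M = 0 by apply: HM; rewrite ger0_norm.
have p2 : psi (- M) = 0 by apply: HM; rewrite normrN ger0_norm.
have := AC_iv P MM; rewrite p1 p2 !mulr0 subrr => E.
by apply/eqP; rewrite [RHS]E; apply: eq_iv => x _; ring.
Qed.

Lemma bump0_mass : 0 < intR (@bump0 R).
Proof.
have cb : continuous (@bump0 R) by exact/smooth1_continuous/bump0_smooth.
have [c cI cm] := @EVT_min R (@bump0 R) (1/4) (3/4) (ltac:(lra)) (continuous_subspaceT cb).
have c0 : 0 < bump0 c by apply: bump0_gt0; move: cI; rewrite in_itv /=; lra.
have ib : L1 (@bump0 R).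
  apply: (@L1_supp _ 1); first exact: locint_cont.
  move=> x; rewrite ltNge ler_norml => H; apply: bump0_out.
  by have [?|?] := leP x 0; [left|right; lra].
apply: lt_le_trans (iv_le_intR (1/4) (3/4) ib (@bump0_ge0 R)).
apply: (@lt_le_trans _ _ (iv (1/4) (3/4) (fun=> bump0 c))).
  by rewrite iv_cst; [nra|lra].
apply: iv_mono; [exact: locint_cont (fun x => cvg_cst _)|exact: locint_cont|].
by move=> x xI; apply: cm; rewrite in_itv.
Qed.

Definition bump (x : R) : R := (intR (@bump0 R))^-1 * bump0 x.

Lemma bump_smooth : smooth1 bump.
Proof. exact/smooth1Z/bump0_smooth. Qed.

Lemma bump_ge0 x : 0 <= bump x.
Proof. by rewrite mulr_ge0 ?bump0_ge0// invr_ge0 ltW// bump0_mass. Qed.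

Lemma bump_out x : x <= 0 \/ 1 <= x -> bump x = 0.
Proof. by rewrite /bump => /bump0_out ->; rewrite mulr0. Qed.

Lemma bump_test : test1 bump.
Proof.
split; first exact: bump_smooth.
exists 1 => x; rewrite ltNge ler_norml => H; apply: bump_out.
by have [?|?] := leP x 0; [left|right; lra].
Qed.

Lemma test1_L1 psi : test1 psi -> L1 psi.
Proof.
move=> tp; apply: (eq_L1 _ (@L1_test (fun=> 1) psi _ tp)) => [x|].
  by rewrite mul1r.
by apply: locint_cont => x; exact: cvg_cst.
Qed.

Lemma bump_mass : intR bump = 1.
Proof.
have n0 : intR (@bump0 R) != 0 by rewrite gt_eqF// bump0_mass.
rewrite intR_Z ?mulVf//.
apply: (eq_L1 _ (L1Z (intR (@bump0 R)) (test1_L1 bump_test))) => x.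
by rewrite /bump mulrA divff// mul1r.
Qed.

(** The fundamental theorem applies only to the right of the base point; starting strictly to the
    left of the support makes it cover the whole support. Further left the primitive is locally [0],
    an integral with reversed bounds being [0] here. *)
Lemma primitive_supp psi (M : R) : continuous psi ->
  (forall x, x <= - M -> psi x = 0) ->
  forall x, is_derive x 1 (fun y => iv (- M - 1) y psi) (psi x).
Proof.
move=> cp H x; have [xM|xM] := ltP (- M - 1) x; first exact: FTC1c.
rewrite H; last lra.
apply: near_eq_is_derive (der_cst 0 x).
have : \forall y \near x, y < - M by apply: lt_nbhsl; lra.
apply: filterS => y yM.
have [yM1|yM1] := leP (- M - 1) y.
  rewrite (@eq_iv _ _ _ _ (fun=> 0)) ?iv_cst ?mul0r// => z /andP[_ zy].
  by apply: H; lra.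
by rewrite /iv set_itv_ge ?Rintegral_set0// bnd_simp -ltNge.
Qed.

(** Vanishing mean is what makes the primitive return to [0] on the right of the support. This is
    the fact behind the du Bois-Reymond lemma. *)
Lemma test1_primitive psi : test1 psi -> intR psi = 0 ->
  exists2 G, test1 G & derive1 G = psi.
Proof.
move=> tp; have [sp [M0 HM0]] := tp => int0.
pose M := `|M0| + 1.
have M0M : M0 < M by rewrite /M; have := ler_norm M0; lra.
have M1 : 0 < M by rewrite /M; have := normr_ge0 M0; lra.
have HM x : M <= `|x| -> psi x = 0 by move=> ?; apply: HM0; lra.
have cp := smooth1_continuous sp.
have D := primitive_supp cp (M := M) (fun x xM => HM x (ltac:(rewrite ler0_norm; lra))).
exists (fun y => iv (- M - 1) y psi); last exact: derive1_fun D.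
split; first exact: smooth1_primitive D sp.
exists (M + 1) => x xM.
have lp : locint psi by exact: locint_cont.
have [x0|x0] := ltP x 0.
  rewrite /iv set_itv_ge ?Rintegral_set0// bnd_simp -ltNge.
  by move: xM; rewrite ltr0_norm//; lra.
rewrite ger0_norm// in xM.
rewrite -int0 (@intR_supp _ x) => [|y xy]; last by apply: HM; lra.
rewrite (@iv_add _ (- x) (- M - 1) x psi)//; [|lra|lra].
rewrite (@eq_iv _ (- x) _ psi (fun=> 0)) ?iv_cst ?mul0r ?add0r//; first lra.
by move=> y yI; apply: HM; rewrite ler0_norm; lra.
Qed.

(** A smooth transition from [0] to [1] across [[0, 1]]; the base point [- 0 - 1] is that of
    [primitive_supp] for [M = 0]. *)
Definition step (x : R) : R := iv (- 0 - 1) x bump.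

Lemma step_der x : is_derive x 1 step (bump x).
Proof.
apply: primitive_supp => [|y]; first exact/smooth1_continuous/bump_smooth.
by rewrite oppr0 => y0; apply: bump_out; left.
Qed.

Lemma step_smooth : smooth1 step.
Proof. exact: smooth1_primitive step_der bump_smooth. Qed.

Lemma step_l x : x <= 0 -> step x = 0.
Proof.
move=> x0; rewrite /step; have [xM|xM] := leP (- 0 - 1) x.
  rewrite (@eq_iv _ _ _ _ (fun=> 0)) ?iv_cst ?mul0r// => z /andP[_ zx].
  by apply: bump_out; left; lra.
by rewrite /iv set_itv_ge ?Rintegral_set0// bnd_simp -ltNge.
Qed.

Lemma locint_bump : locint bump.
Proof. by apply/locint_cont/smooth1_continuous/bump_smooth. Qed.

Lemma step_r x : 1 <= x -> step x = 1.
Proof.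
move=> x1; have x0 : - x <= - 0 - 1 by lra.
rewrite -bump_mass (@intR_supp bump x); last first.
  move=> y; rewrite ltNge ler_norml => H; apply: bump_out.
  by have [?|?] := leP y 0; [left|right; lra].
rewrite (@iv_add _ (- x) (- 0 - 1) x bump)//; [|lra|exact: locint_bump].
rewrite (@eq_iv _ (- x) _ bump (fun=> 0)) ?iv_cst ?mul0r ?add0r//.
by move=> y yI; apply: bump_out; left; lra.
Qed.

Lemma step_01 x : 0 <= step x <= 1.
Proof.
rewrite iv_ge0 /=; last by move=> *; exact: bump_ge0.
rewrite -bump_mass; apply: iv_le_intR; [exact: test1_L1 bump_test|exact: bump_ge0].
Qed.

(** Equal to [1] on [[a, b]] and to [0] outside [[a - 1/n, b + 1/n]]. The ramps lie outside the
    interval, so the limit is the indicator of the closed interval at every point, end points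
    included. *)
Definition hat (a b : R) (n : nat) (x : R) : R :=
  step (n%:R * x + (1 - n%:R * a)) - step (n%:R * x + - (n%:R * b)).

Lemma hat_out a b n x : a <= b -> (0 < n)%N -> x < a - 1 \/ b + 1 < x ->
  hat a b n x = 0.
Proof.
move=> ab n0 H; rewrite /hat.
have n0' : 0 < n%:R :> R by rewrite ltr0n.
have n1 : 1 <= n%:R :> R by rewrite ler1n.
case: H => H.
  have e1 : n%:R * x + (1 - n%:R * a) <= 0.
    have : n%:R * (x - a) <= n%:R * -1 by rewrite ler_pM2l//; lra.
    by lra.
  have e2 : n%:R * x + - (n%:R * b) <= 0.
    have : 0 <= n%:R * (b - x) by rewrite mulr_ge0//; lra.
    by lra.
  by rewrite (step_l e1) (step_l e2) subr0.
have e1 : 1 <= n%:R * x + (1 - n%:R * a).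
  have : 0 <= n%:R * (x - a) by rewrite mulr_ge0//; lra.
  by lra.
have e2 : 1 <= n%:R * x + - (n%:R * b).
  have : n%:R * 1 <= n%:R * (x - b) by rewrite ler_pM2l//; lra.
  by lra.
by rewrite (step_r e1) (step_r e2) subrr.
Qed.

Lemma hat_test a b n : a <= b -> (0 < n)%N -> test1 (hat a b n).
Proof.
move=> ab n0; split.
  have s1 := @smooth1_affine R step n%:R (1 - n%:R * a) step_smooth.
  have s2 := @smooth1_affine R step n%:R (- (n%:R * b)) step_smooth.
  exact: (smooth1B s1 s2).
exists (`|a| + `|b| + 1) => x H; apply: hat_out => //.
have ha := ler_norm b; have hb : - a <= `|a| by rewrite -normrN ler_norm.
have := normr_ge0 a; have := normr_ge0 b.
have [x0|x0] := ltP x 0; move: H.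
  by rewrite (ltr0_norm x0) => H ? ?; left; lra.
by rewrite (ger0_norm x0) => H ? ?; right; lra.
Qed.

Lemma hat_le a b n x : a <= b -> `|hat a b n.+1 x| <= \1_(`[a - 1, b + 1]%classic) x.
Proof.
move=> ab.
have [xI|xI] := boolP (x \in `[a - 1, b + 1]%classic).
  have /andP[h1 h2] := step_01 (n.+1%:R * x + (1 - n.+1%:R * a)).
  have /andP[h3 h4] := step_01 (n.+1%:R * x + - (n.+1%:R * b)).
  by rewrite indicE xI /hat ler_norml /=; lra.
rewrite hat_out ?normr0//.
move: xI; rewrite notin_setE /= in_itv /= => /negP; rewrite negb_and -!ltNge.
by move=> /orP[H|H]; [left|right].
Qed.

Lemma hat_cvg a b x : a <= b ->
  (fun n => hat a b n.+1 x) @ \oo --> (\1_(`[a, b]%classic) x : R).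
Proof.
move=> ab; have ev (d : R) : 0 < d -> \forall n \near \oo, 1 <= n.+1%:R * d.
  move=> d0; exists (Num.bound d^-1) => // n /= nb.
  rewrite -ler_pdivrMr// div1r; apply: ltW.
  have dV : 0 <= d^-1 by rewrite invr_ge0 ltW.
  apply: lt_le_trans (archi_boundP dV) _.
  by rewrite ler_nat (leq_trans nb).
apply: cvg_near_cst; rewrite indicE.
have [xI|xI] := boolP (x \in `[a, b]%classic).
  move: xI; rewrite inE /= in_itv /= => /andP[ax xb].
  apply: nearW => n; rewrite /hat.
  have n0 : 0 <= n.+1%:R :> R by rewrite ler0n.
  have e1 : 1 <= n.+1%:R * x + (1 - n.+1%:R * a).
    have : 0 <= n.+1%:R * (x - a) by rewrite mulr_ge0//; lra.
    by lra.
  have e2 : n.+1%:R * x + - (n.+1%:R * b) <= 0.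
    have : 0 <= n.+1%:R * (b - x) by rewrite mulr_ge0//; lra.
    by lra.
  by rewrite (step_r e1) (step_l e2) subr0.
move: xI; rewrite notin_setE /= in_itv /= => /negP; rewrite negb_and -!ltNge.
move=> /orP[H|H].
  have d0 : 0 < a - x by lra.
  apply: filterS (ev _ d0) => n hn; rewrite /hat.
  have n0 : 0 <= n.+1%:R :> R by rewrite ler0n.
  have e1 : n.+1%:R * x + (1 - n.+1%:R * a) <= 0 by lra.
  have e2 : n.+1%:R * x + - (n.+1%:R * b) <= 0.
    have : 0 <= n.+1%:R * (b - x) by rewrite mulr_ge0//; lra.
    by lra.
  by rewrite (step_l e1) (step_l e2) subr0.
have d0 : 0 < x - b by lra.
apply: filterS (ev _ d0) => n hn; rewrite /hat.
have n0 : 0 <= n.+1%:R :> R by rewrite ler0n.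
have e1 : 1 <= n.+1%:R * x + (1 - n.+1%:R * a).
  have : 0 <= n.+1%:R * (x - a) by rewrite mulr_ge0//; lra.
  by lra.
have e2 : 1 <= n.+1%:R * x + - (n.+1%:R * b) by lra.
by rewrite (step_r e1) (step_r e2) subrr.
Qed.

Lemma test_zero_iv h : measurable_fun [set: R] h -> locint h ->
  (forall psi, test1 psi -> intR (fun x => h x * psi x) = 0) ->
  forall a b, a <= b -> iv a b h = 0.
Proof.
move=> mh lh H a b ab.
pose f_ n x := h x * hat a b n.+1 x.
have mf n : measurable_fun [set: R] (f_ n).
  by apply: L1_measurable; apply: L1_test => //; exact: hat_test.
have c1 x : f_ ^~ x @ \oo --> h x * \1_(`[a, b]%classic) x.
  by apply: cvgM; [exact: cvg_cst|exact: hat_cvg].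
have c2 n x : `|f_ n x| <= `|\1_(`[a - 1, b + 1]%classic) x * h x|.
  rewrite /f_ !normrM mulrC ler_wpM2r//.
  by apply: le_trans (hat_le n x ab) (ler_norm _).
have c3 : L1 (fun x => `|\1_(`[a - 1, b + 1]%classic) x * h x|).
  by apply: L1_norm; apply/L1_indic; exact: lh.
have [_] := @dct f_ (fun x => h x * \1_(`[a, b]%classic) x) _ mf c1 c2 c3.
rewrite (_ : (fun n => intR (f_ n)) = (fun=> 0)); last first.
  by apply/funext => n; apply: H; exact: hat_test.
move=> /cvg_lim; rewrite lim_cst//; move=> /(_ (@Rhausdorff R)) E.
by rewrite -int_indic E; apply: eq_intR => x; rewrite mulrC.
Qed.

(** On each half-line starting at [- n] the primitive of [h] vanishes identically, while by Lebesgue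
    differentiation its derivative is [h] almost everywhere; the half-lines exhaust the line. *)
Lemma iv_zero_ae h : measurable_fun [set: R] h -> locint h ->
  (forall a b, a <= b -> iv a b h = 0) -> {ae (@lebesgue_measure R), forall x, h x = 0}.
Proof.
move=> mh lh H.
have lih : locally_integrable [set: R] h.
  split=> //; first exact: openT.
  move=> K _ cK; have [M [_ HM]] := compact_bounded cK.
  have := lh (- (M + 1)) (M + 1) => /integrableP[_]; apply: le_lt_trans.
  apply: ge0_subset_integral => //.
  - exact: compact_measurable.
  - by apply/measurable_EFinP; apply: measurableT_comp => //; exact: measurable_funTS.
  - by move=> x Kx; rewrite /= in_itv /= -ler_norml; apply: (HM (M + 1)); [lra|].
have := @ae_foralln _ _ _ (@lebesgue_measure R)
  (fun n x => - n%:R < x -> h x = 0) => HH.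
have {}HH : {ae (@lebesgue_measure R), forall x, forall n : nat, - n%:R < x -> h x = 0}.
  apply: HH => n.
  have := @FTC1 R h (BLeft (- n%:R)) (fun y => lh _ _) lih.
  move=> HF; apply: (ae_imp HF) => x Hx nx.
  have [|_ <-] := Hx; first by rewrite /= lte_fin.
  apply: der_derive1; rewrite (_ : (fun y => _) = (fun=> 0)); first exact: der_cst.
  apply/funext => y; have [ny|ny] := leP (- n%:R) y; first exact: (H _ _ ny).
  by rewrite set_itv_ge ?Rintegral_set0// bnd_simp -ltNge.
apply: (ae_imp HH) => x Hx; apply: (Hx (Num.bound `|x|)).
rewrite ltrNl; apply: le_lt_trans (archi_boundP (normr_ge0 x)).
by rewrite -normrN ler_norm.
Qed.

Lemma test_zero_ae h : measurable_fun [set: R] h -> locint h ->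
  (forall psi, test1 psi -> intR (fun x => h x * psi x) = 0) ->
  {ae (@lebesgue_measure R), forall x, h x = 0}.
Proof. by move=> mh lh H; apply: iv_zero_ae => //; exact: test_zero_iv. Qed.

(** A test function becomes the derivative of a test function once its mean is removed by a multiple
    of [bump], which has mass [1]. The constant is therefore the average of [h] against [bump]. *)
Lemma du_bois_reymond h : measurable_fun [set: R] h -> locint h ->
  (forall psi, test1 psi -> intR (fun x => h x * derive1 psi x) = 0) ->
  exists C, {ae (@lebesgue_measure R), forall x, h x = C}.
Proof.
move=> mh lh H; pose C := intR (fun x => h x * bump x); exists C.
have lc : locint (fun _ : R => C) by apply: locint_cont => x; exact: cvg_cst.
have : {ae (@lebesgue_measure R), forall x, h x - C = 0}.
  apply: test_zero_ae.
  - by apply: measurable_funB => //; exact: measurable_cst.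
  - exact: locintB.
  move=> psi tp.
  pose m := intR psi.
  have tq : test1 (fun x => psi x + - m * bump x) by apply: test1D => //; exact: test1Z bump_test.
  have [|G tG EG] := test1_primitive tq.
    rewrite intR_D; [|exact: test1_L1|exact/test1_L1/test1Z/bump_test].
    by rewrite intR_Z ?bump_mass ?mulr1 ?subrr//; exact: test1_L1 bump_test.
  have := H G tG; rewrite EG => E.
  have i1 := L1_test lh tp; have i2 := L1_test lh bump_test.
  have i3 := test1_L1 tp.
  rewrite (@eq_intR _ _ (fun x => h x * psi x - C * psi x)); last by move=> x; ring.
  rewrite intR_B//; last exact: L1Z.
  rewrite intR_Z// -/m.
  move: E; rewrite (@eq_intR _ _ (fun x => h x * psi x - m * (h x * bump x))); last first.
    by move=> x; ring.
  by rewrite intR_B//; [rewrite intR_Z// -/C mulrC|exact: L1Z].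
by move=> HH; apply: (ae_imp HH) => x /eqP; rewrite subr_eq0 => /eqP.
Qed.

End WeakDerivatives.

(** * Sobolev functions of one variable *)

Section Sobolev.
Variable R : realType.
Implicit Types (f g h U V psi : R -> R) (x : R).

Lemma L2_measurable f : L2 f -> measurable_fun [set: R] f.
Proof. by case. Qed.

Lemma L2_sqr f : L2 f -> L1 (fun x => f x ^+ 2).
Proof. by case. Qed.

Lemma L2M f g : L2 f -> L2 g -> L1 (fun x => f x * g x).
Proof.
move=> [mf if_] [mg ig].
apply: (L1_le (g := fun x => f x ^+ 2 + g x ^+ 2)).
- exact: measurable_funM.
- exact: L1D.
- by move=> x; rewrite ler_norml; nra.
Qed.

Lemma L2D f g : L2 f -> L2 g -> L2 (fun x => f x + g x).
Proof.
move=> hf hg; split.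
  by apply: measurable_funD; exact: L2_measurable.
apply: (eq_L1 _ (L1D (L1D (L2_sqr hf) (L2_sqr hg)) (L1Z 2 (L2M hf hg)))) => x.
by ring.
Qed.

Lemma L2Z k f : L2 f -> L2 (fun x => k * f x).
Proof.
move=> hf; split.
  by apply: measurable_funM; [exact: measurable_cst|exact: L2_measurable].
by apply: (eq_L1 _ (L1Z (k ^+ 2) (L2_sqr hf))) => x; ring.
Qed.

Lemma eq_L2 f g : (forall x, f x = g x) -> L2 f -> L2 g.
Proof. by move=> /funext ->. Qed.

Lemma L2N f : L2 f -> L2 (fun x => - f x).
Proof. by move=> hf; apply: (eq_L2 _ (L2Z (-1) hf)) => x; ring. Qed.

Lemma L2B f g : L2 f -> L2 g -> L2 (fun x => f x - g x).
Proof. by move=> hf hg; apply: L2D => //; exact: L2N. Qed.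

Lemma L2_le f g : measurable_fun [set: R] f -> L2 g ->
  (forall x, `|f x| <= `|g x|) -> L2 f.
Proof.
move=> mf hg fg; split=> //; apply: (L1_le _ (L2_sqr hg)).
  by apply: measurable_funX.
move=> x; rewrite normrX -(real_normK (num_real (g x))).
by rewrite lerXn2r ?nnegrE.
Qed.

Lemma L2_mulb f g M : measurable_fun [set: R] f -> (forall x, `|f x| <= M) ->
  L2 g -> L2 (fun x => f x * g x).
Proof.
move=> mf fM hg; apply: (L2_le _ (L2Z M hg)).
  by apply: measurable_funM => //; exact: L2_measurable.
move=> x; rewrite !normrM ler_wpM2r//; apply: le_trans (fM x) (ler_norm _).
Qed.

Lemma L2_shift f a : L2 f -> L2 (fun x => f (x + a)).
Proof.
by move=> hf; split; [by apply: measurable_shift; exact: L2_measurable|exact: L1_shift (L2_sqr hf)].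
Qed.

Lemma L2_ae f g : measurable_fun [set: R] g ->
  {ae (@lebesgue_measure R), forall x, f x = g x} -> L2 f -> L2 g.
Proof.
move=> mg fg hf; split=> //; apply: ae_L1 (L2_sqr hf); first exact: measurable_funX.
by apply: (ae_imp fg) => x ->.
Qed.

Lemma L2_locint f : L2 f -> locint f.
Proof.
move=> [mf if_]; apply: (locint_le (g := fun x => 1 + f x ^+ 2)) => //.
  apply: locintD; last exact: L1_locint.
  by apply: locint_cont => x; exact: cvg_cst.
by move=> x; rewrite ler_norml; nra.
Qed.

Lemma cauchy_schwarz f g : L2 f -> L2 g ->
  intR (fun x => f x * g x) ^+ 2 <=
  intR (fun x => f x ^+ 2) * intR (fun x => g x ^+ 2).
Proof.
move=> hf hg.
set A := intR (fun x => f x ^+ 2); set B := intR (fun x => g x ^+ 2).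
set C := intR (fun x => f x * g x).
have A0 : 0 <= A by apply: intR_ge0 => x; exact: sqr_ge0.
have B0 : 0 <= B by apply: intR_ge0 => x; exact: sqr_ge0.
have Q t : 0 <= A + t * (2 * C) + t ^+ 2 * B.
  have i1 := L2_sqr hf; have i2 := L2_sqr hg; have i3 := L2M hf hg.
  rewrite /A /B /C -(intR_Z 2)// -(intR_Z t); last exact: L1Z.
  rewrite -(intR_Z (t ^+ 2))// -intR_D//; last by apply: L1Z; exact: L1Z.
  rewrite -intR_D//; [|by apply: L1D => //; apply: L1Z; exact: L1Z|exact: L1Z].
  by apply: intR_ge0 => x; have := sqr_ge0 (f x + t * g x); lra.
have [B00|Bn0] := eqVneq B 0.
  have [C0|C0] := eqVneq C 0; first by rewrite C0 B00 expr0n mulr0.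
  (* For [B = 0] the polynomial in [t] is affine, and this choice of [t] would give it the value
     [-1]. *)
  have := Q (- (A + 1) / (2 * C)); rewrite B00 mulr0 addr0 divfK ?mulf_neq0 ?pnatr_eq0//.
  by lra.
have Bp : 0 < B by rewrite lt_neqAle eq_sym Bn0.
have := Q (- C / B).
have -> : A + - C / B * (2 * C) + (- C / B) ^+ 2 * B = (A * B - C ^+ 2) / B by field.
by rewrite pmulr_lge0 ?invr_gt0// subr_ge0.
Qed.

Lemma cauchy_schwarz_le f g (a b : R) : L2 f -> L2 g -> 0 <= a -> 0 <= b ->
  intR (fun x => f x ^+ 2) <= a ^+ 2 -> intR (fun x => g x ^+ 2) <= b ^+ 2 ->
  `|intR (fun x => f x * g x)| <= a * b.
Proof.
move=> hf hg a0 b0 fa gb; rewrite -ler_sqr ?nnegrE ?mulr_ge0//.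
rewrite real_normK ?num_real//; apply: le_trans (cauchy_schwarz hf hg) _.
rewrite exprMn; apply: ler_pM => //; apply: intR_ge0 => x; exact: sqr_ge0.
Qed.

Lemma weak_derivD f g f' g' : L2 f -> L2 g -> L2 f' -> L2 g' ->
  weak_deriv f f' -> weak_deriv g g' ->
  weak_deriv (fun x => f x + g x) (fun x => f' x + g' x).
Proof.
move=> hf hg hf' hg' wf wg psi tp.
have tp' := test1_derive1 tp.
have i h : L2 h -> L1 (fun x => h x * psi x) by move=> hh; apply: L1_test tp; exact: L2_locint.
have i' h : L2 h -> L1 (fun x => h x * derive1 psi x).
  by move=> hh; apply: L1_test tp'; exact: L2_locint.
rewrite (@eq_intR _ _ (fun x => f x * derive1 psi x + g x * derive1 psi x)); last first.
  by move=> x; ring.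
rewrite (@eq_intR _ (fun x => (f' x + g' x) * psi x) (fun x => f' x * psi x + g' x * psi x)); last first.
  by move=> x; ring.
by rewrite !intR_D; try solve [exact: i|exact: i']; rewrite wf// wg//; ring.
Qed.

Lemma weak_derivZ k f f' : L2 f -> L2 f' -> weak_deriv f f' ->
  weak_deriv (fun x => k * f x) (fun x => k * f' x).
Proof.
move=> hf hf' wf psi tp.
rewrite (@eq_intR _ _ (fun x => k * (f x * derive1 psi x))); last by move=> x; ring.
rewrite (@eq_intR _ (fun x => k * f' x * psi x) (fun x => k * (f' x * psi x))); last by move=> x; ring.
rewrite !intR_Z ?wf//; first by ring.
  by apply: L1_test tp; exact: L2_locint.
by apply: L1_test (test1_derive1 tp); exact: L2_locint.
Qed.

Lemma weak_derivB f g f' g' : L2 f -> L2 g -> L2 f' -> L2 g' ->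
  weak_deriv f f' -> weak_deriv g g' ->
  weak_deriv (fun x => f x - g x) (fun x => f' x - g' x).
Proof.
move=> hf hg hf' hg' wf wg.
have wgN := weak_derivZ (-1) hg hg' wg.
have := weak_derivD hf (L2Z (-1) hg) hf' (L2Z (-1) hg') wf wgN.
rewrite (_ : (fun x => f x + -1 * g x) = (fun x => f x - g x)); last first.
  by apply/funext => x; ring.
rewrite (_ : (fun x => f' x + -1 * g' x) = (fun x => f' x - g' x)) //.
by apply/funext => x; ring.
Qed.

Lemma weak_deriv_shift f f' a : L2 f -> L2 f' -> weak_deriv f f' ->
  weak_deriv (fun x => f (x + a)) (fun x => f' (x + a)).
Proof.
move=> hf hf' wf psi tp.
have tp' := test1_shift (- a) tp.
have := wf _ tp'.
have E x : derive1 (fun x => psi (x - a)) x = derive1 psi (x - a).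
  by apply: derive1_shift; case: tp.
have m1 := L1_measurable (L1_test (L2_locint hf) (test1_derive1 tp')).
have m2 := L1_measurable (L1_test (L2_locint hf') tp').
rewrite -(int_shift a m1) -(int_shift a m2).
rewrite (@eq_intR _ _ (fun x => f (x + a) * derive1 psi x)); last first.
  by move=> x; rewrite E addrK.
move=> ->; congr (- _).
by apply: eq_intR => x; rewrite addrK.
Qed.

Lemma AC_weak_deriv U g : AC U g -> weak_deriv U g.
Proof. by move=> Ug psi tp; exact: AC_parts. Qed.

Lemma weak_deriv_uniq f g1 g2 : L2 g1 -> L2 g2 -> weak_deriv f g1 -> weak_deriv f g2 ->
  {ae (@lebesgue_measure R), forall x, g1 x = g2 x}.
Proof.
move=> h1 h2 w1 w2.
have : {ae (@lebesgue_measure R), forall x, g1 x - g2 x = 0}.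
  have hB := L2B h1 h2.
  apply: test_zero_ae; [exact: L2_measurable|exact: L2_locint|].
  move=> psi tp.
  rewrite (@eq_intR _ _ (fun x => g1 x * psi x - g2 x * psi x)); last by move=> x; ring.
  rewrite intR_B; try by apply: L1_test tp; exact: L2_locint.
  by have := w1 _ tp; rewrite w2//; lra.
by move=> H; apply: (ae_imp H) => x /eqP; rewrite subr_eq0 => /eqP.
Qed.

(** The difference with a primitive of [g] has weak derivative [0], hence is almost everywhere
    constant. The continuous representative is what gives a perturbation a crest. *)
Lemma weak_deriv_AC f g : L2 f -> L2 g -> weak_deriv f g ->
  exists2 U, AC U g & {ae (@lebesgue_measure R), forall x, f x = U x}.
Proof.
move=> hf hg w; have [F FAC] := AC_exists (L2_locint hg).
have cF := AC_continuous FAC.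
have lF := locint_cont cF.
have [||psi tp|C HC] := @du_bois_reymond R (fun x => f x - F x).
- by apply: measurable_funB; [exact: L2_measurable|exact: continuous_measurable_fun].
- by apply: locintB => //; exact: L2_locint.
- have tp' := test1_derive1 tp.
  rewrite (@eq_intR _ _ (fun x => f x * derive1 psi x - F x * derive1 psi x)); last by move=> x; ring.
  rewrite intR_B; [|exact: L1_test (L2_locint hf) tp'|exact: L1_test tp'].
  by rewrite w// (AC_parts FAC tp) subrr.
exists (fun x => F x + C); first exact: AC_addc.
by apply: (ae_imp HC) => x; lra.
Qed.

Definition decay U := forall e, 0 < e -> exists2 r, 0 < r & forall x, r <= `|x| -> `|U x| < e.

Lemma decayD U V : decay U -> decay V -> decay (fun x => U x + V x).
Proof.
move=> hU hV e e0.
have e2 : 0 < e / 2 by lra.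
have [r r0 H] := hU _ e2; have [s s0 K] := hV _ e2.
exists (Num.max r s); first by rewrite lt_max r0.
move=> x; rewrite ge_max => /andP[/H h1 /K h2].
by apply: le_lt_trans (ler_normD _ _) _; lra.
Qed.

Lemma decay_le U V C : decay U -> (forall x, `|V x| <= C * `|U x|) -> decay V.
Proof.
move=> hU H e e0.
have C0 : 0 < `|C| + 1 by have := normr_ge0 C; lra.
have [r r0 K] := hU (e / (`|C| + 1)) (divr_gt0 e0 C0).
exists r => // x /K; rewrite ltr_pdivlMr// => Hx; apply: le_lt_trans (H x) _.
apply: le_lt_trans Hx; rewrite mulrC ler_wpM2l//.
by have := ler_norm C; lra.
Qed.

Lemma continuous_decay_bounded U : continuous U -> decay U -> exists2 C, 0 < C & forall x, `|U x| <= C.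
Proof.
move=> cU hU; have [r r0 H] := hU 1 ltr01.
have rr : - r <= r by lra.
have [c _ cM] := @EVT_max R (fun x => `|U x|) _ _ rr
   (continuous_subspaceT (fun x => cvg_norm (cU x))).
exists (`|U c| + 1); first by have := normr_ge0 (U c); lra.
move=> x; have [rx|xr] := leP r `|x|.
  by have := H _ rx; have := normr_ge0 (U c); lra.
suff : `|U x| <= `|U c| by lra.
by apply: cM; rewrite in_itv /= -ler_norml ltW.
Qed.

Lemma decay_max U y : continuous U -> decay U -> 0 < U y ->
  exists x0, forall x, U x <= U x0.
Proof.
move=> cU hU y0; have [r r0 H] := hU _ y0.
have yr : `|y| < r.
  by rewrite ltNge; apply/negP => /H; rewrite (ger0_norm (ltW y0)) ltxx.
have rr : - r <= r by lra.
have [c _ cM] := @EVT_max R U _ _ rr (continuous_subspaceT cU).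
exists c => x; have [rx|xr] := leP r `|x|.
  have : U y <= U c by apply: cM; rewrite in_itv /= -ler_norml ltW.
  by have := H _ rx; have := ler_norm (U x); lra.
by apply: cM; rewrite in_itv /= -ler_norml ltW.
Qed.

Lemma continuous_sqr U : continuous U -> continuous (fun x => U x ^+ 2).
Proof. by move=> cU x; apply: cvgM; exact: cU. Qed.

(** Start from a minimum point of [U ^ 2] on the unit interval, where the value is below the mean,
    and integrate [2 U g] from there. Keeping the bound local yields both the sup bound and the
    decay at infinity. *)
Lemma L2_AC_le U g x : AC U g -> L2 U -> L2 g ->
  U x ^+ 2 <= 2 * iv x (x + 1) (fun y => U y ^+ 2 + g y ^+ 2).
Proof.
move=> Ug hU hg.
have lU := L1_locint (L2_sqr hU); have lg := L1_locint (L2_sqr hg).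
have lUg : locint (fun y => U y ^+ 2 + g y ^+ 2) by exact: locintD.
set J := iv _ _ _.
have xx : x <= x + 1 by lra.
have cU := AC_continuous Ug.
have [c + cm] := @EVT_min R _ _ _ xx (continuous_subspaceT (continuous_sqr cU)).
rewrite in_itv /= => /andP[xc cx].
have Uc : U c ^+ 2 <= J.
  have -> : U c ^+ 2 = iv x (x + 1) (fun=> U c ^+ 2) by rewrite iv_cst//; ring.
  apply: iv_mono => //; first by apply: locint_cont => z; exact: cvg_cst.
  move=> z zI; have := cm z; rewrite in_itv /= zI => /(_ isT).
  by have := sqr_ge0 (g z); lra.
have S := AC_sqr Ug.
have E := AC_iv S xc.
have : `|iv x c (fun y => 2 * U y * g y)| <= J.
  apply: le_trans (iv_le_norm _ _ (AC_locint S)) _.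
  apply: le_trans (iv_sub (lexx x) cx (locint_norm (AC_locint S)) _) _ => //.
  apply: iv_mono => //; first exact: locint_norm (AC_locint S).
  by move=> z _; rewrite ler_norml; have := sqr_ge0 (U z - g z); have := sqr_ge0 (U z + g z); lra.
by rewrite -E ler_norml => /andP[h1 h2]; lra.
Qed.

Lemma sobolev_sup U g x : AC U g -> L2 U -> L2 g ->
  U x ^+ 2 <= 2 * intR (fun y => U y ^+ 2 + g y ^+ 2).
Proof.
move=> Ug hU hg; apply: le_trans (L2_AC_le x Ug hU hg) _.
rewrite ler_wpM2l//; apply: iv_le_intR; first by apply: L1D; exact: L2_sqr.
by move=> z; rewrite addr_ge0 ?sqr_ge0.
Qed.

Lemma sobolev_decay U g : AC U g -> L2 U -> L2 g -> decay U.
Proof.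
move=> Ug hU hg e e0.
pose h y := U y ^+ 2 + g y ^+ 2.
have ih : L1 h by apply: L1D; exact: L2_sqr.
have h0 y : 0 <= h y by rewrite addr_ge0 ?sqr_ge0.
have e2 : 0 < e ^+ 2 / 2 by rewrite divr_gt0 ?exprn_gt0.
have [r r0 H] := tail_int ih h0 e2.
have lh := L1_locint ih.
exists (r + 1) => [|x xr]; first lra.
rewrite -ltr_sqr ?nnegrE ?(ltW e0)// real_normK ?num_real//.
apply: le_lt_trans (L2_AC_le x Ug hU hg) _; rewrite -/h.
suff : iv x (x + 1) h <= intR h - iv (- r) r h by have := H r (lexx _); lra.
have E1 s : r <= s -> iv (- s) (- r) h + iv (- r) r h + iv r s h <= intR h.
  move=> rs; have a1 : - s <= - r by rewrite lerN2.
  have a2 : - r <= r by lra.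
  rewrite -(iv_add a1 a2 lh) -(iv_add (le_trans a1 a2) rs lh).
  exact: iv_le_intR.
have p1 s : 0 <= iv (- s) (- r) h by exact: iv_ge0.
have p2 s : 0 <= iv r s h by exact: iv_ge0.
have [x0|x0] := ltP x 0.
  have [a1 a2 a3] : [/\ - (1 - x) <= x, x + 1 <= - r & r <= 1 - x].
    by move: xr; rewrite (ltr0_norm x0); split; lra.
  have := iv_sub a1 a2 lh h0; have := E1 _ a3; have := p2 (1 - x); clear; lra.
have [a1 a2] : r <= x /\ r <= x + 1 by move: xr; rewrite (ger0_norm x0); split; lra.
have := iv_sub a1 (lexx (x + 1)) lh h0; have := E1 _ a2; have := p1 (x + 1); clear; lra.
Qed.

Lemma eq_iv_co a b f g : locint f -> locint g -> (forall x, a <= x < b -> f x = g x) ->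
  iv a b f = iv a b g.
Proof.
move=> lf lg fg; rewrite /iv -!Rintegral_itv_bndo_bndc.
- by apply: eq_int => x; rewrite /= in_itv /=; exact: fg.
- by apply: IgS (lg a b) => //; apply: subset_itvl; rewrite bnd_simp.
- by apply: IgS (lf a b) => //; apply: subset_itvl; rewrite bnd_simp.
Qed.

(** The sign of the slope of a wave with crest [x0], positive before the crest and negative after
    it, so that one formula describes both flanks. *)
Definition sgn (x0 x : R) : R := if x < x0 then 1 else -1.

Lemma sgn_sqr x0 x : sgn x0 x ^+ 2 = 1.
Proof. by rewrite /sgn; case: ifP => _; ring. Qed.

Lemma sgn_norm x0 x : `|sgn x0 x| <= 1.
Proof. by rewrite /sgn; case: ifP => _; rewrite ?normrN1 ?normr1. Qed.

Lemma sgn_measurable x0 : measurable_fun [set: R] (sgn x0).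
Proof.
apply: measurable_fun_ifT => //; try exact: measurable_cst.
by apply: measurable_fun_ltr => //; exact: measurable_cst.
Qed.

Lemma locint_sgn x0 f : locint f -> locint (fun x => sgn x0 x * f x).
Proof.
move=> lf a b; apply: Ig_mulb (lf a b) => //.
  by apply: measurable_funTS; exact: sgn_measurable.
by move=> x _; exact: sgn_norm.
Qed.

Lemma iv_sgn V h x0 r : AC V h -> `|x0| <= r ->
  iv (- r) r (fun x => sgn x0 x * h x) = 2 * V x0 - V r - V (- r).
Proof.
move=> Vh; rewrite ler_norml => /andP[h1 h2].
have lh := AC_locint Vh; have ls := locint_sgn x0 lh.
rewrite (iv_add h1 h2 ls).
rewrite (@eq_iv_co (- r) x0 _ h)//; last first.
  by move=> x /andP[_ xx]; rewrite /sgn xx mul1r.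
rewrite (@eq_iv _ x0 r _ (fun x => -1 * h x)); last first.
  by move=> x /andP[xx _]; rewrite /sgn ltNge xx.
by rewrite ivZ// -(AC_iv Vh h1) -(AC_iv Vh h2); ring.
Qed.

(* Along a decaying profile, [\int sgn (V o U)'] only sees the value at the crest. *)
Lemma int_sgn V h x0 : AC V h -> L1 h -> decay V ->
  intR (fun x => sgn x0 x * h x) = 2 * V x0.
Proof.
move=> Vh ih dV.
have is_ : L1 (fun x => sgn x0 x * h x).
  by apply: L1_mulb ih; [exact: sgn_measurable|exact: sgn_norm].
apply/eqP; rewrite -subr_eq0 -normr_le0; apply/ler_addgt0Pr => e e0; rewrite add0r.
have e3 : 0 < e / 3 by lra.
have [r r0 Hr] := int_limit is_ e3; have [s s0 Hs] := dV _ e3.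
pose t := Num.max (Num.max r s) `|x0|.
have tr : r <= t by rewrite !le_max lexx.
have ts : s <= t by rewrite !le_max lexx !orbT.
have tx : `|x0| <= t by rewrite !le_max lexx !orbT.
have t0 : 0 <= t by lra.
have := Hr t tr; rewrite (iv_sgn Vh tx).
have := Hs t; rewrite ger0_norm// => /(_ ts).
have := Hs (- t); rewrite normrN ger0_norm// => /(_ ts).
by rewrite !ltr_norml ler_norml; lra.
Qed.

Lemma int_total V h : AC V h -> L1 h -> decay V -> intR h = 0.
Proof.
move=> Vh ih dV.
apply/eqP; rewrite -normr_le0; apply/ler_addgt0Pr => e e0; rewrite add0r.
have e3 : 0 < e / 3 by lra.
have [r r0 Hr] := int_limit ih e3; have [s s0 Hs] := dV _ e3.
pose t := Num.max r s.
have tr : r <= t by rewrite !le_max lexx.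
have ts : s <= t by rewrite !le_max lexx !orbT.
have t0 : 0 <= t by lra.
have tt : - t <= t by lra.
have := Hr t tr; rewrite -(AC_iv Vh tt).
have := Hs t; rewrite ger0_norm// => /(_ ts).
have := Hs (- t); rewrite normrN ger0_norm// => /(_ ts).
by rewrite !ltr_norml ler_norml; lra.
Qed.

End Sobolev.

(** * The variational comparison *)

Section ContinuityCombinators.
Variable R : realType.
Implicit Types (f g : R -> R).

Lemma cont_cst (k : R) : continuous (fun _ : R => k).
Proof. by move=> x; exact: cvg_cst. Qed.
Lemma cont_id : continuous (fun x : R => x).
Proof. by move=> x; exact: cvg_id. Qed.
Lemma contD f g : continuous f -> continuous g -> continuous (fun x => f x + g x).
Proof. by move=> cf cg x; apply: cvgD; [exact: cf|exact: cg]. Qed.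
Lemma contN f : continuous f -> continuous (fun x => - f x).
Proof. by move=> cf x; apply: cvgN; exact: cf. Qed.
Lemma contM f g : continuous f -> continuous g -> continuous (fun x => f x * g x).
Proof. by move=> cf cg x; apply: cvgM; [exact: cf|exact: cg]. Qed.
Lemma contX n f : continuous f -> continuous (fun x => f x ^+ n).
Proof.
move=> cf; elim: n => [|n IH].
  rewrite (_ : (fun x => _) = (fun=> 1)); first exact: cont_cst.
  by apply/funext => x; rewrite expr0.
rewrite (_ : (fun x => _) = (fun x => f x * f x ^+ n)); first exact: contM.
by apply/funext => x; rewrite exprS.
Qed.
Lemma contV f : (forall x, f x != 0) -> continuous f -> continuous (fun x => (f x)^-1).
Proof. by move=> f0 cf x; apply: cvgV => //; exact: cf. Qed.
Lemma cont_comp f g : continuous f -> continuous g -> continuous (fun x => f (g x)).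
Proof. by move=> cf cg x; apply: continuous_comp; [exact: cg|exact: cf]. Qed.
Lemma cont_sqrt f : continuous f -> continuous (fun x => Num.sqrt (f x)).
Proof. by move=> cf; apply: (cont_comp (f := Num.sqrt)) => //; exact: sqrt_continuous. Qed.
Lemma cont_norm f : continuous f -> continuous (fun x => `|f x|).
Proof. by move=> cf x; apply: cvg_norm; exact: cf. Qed.
Lemma cont_max f g : continuous f -> continuous g -> continuous (fun x => Num.max (f x) (g x)).
Proof. by move=> cf cg x; apply: continuous_max; [exact: cf|exact: cg]. Qed.

End ContinuityCombinators.

Section Auxiliary.
Variable R : realType.
Implicit Types (f g U : R -> R).

Lemma primitive_exists f : continuous f -> exists F : R -> R,
  [/\ forall x : R, is_derive x 1 F (f x), F 0 = 0 & forall a b, a <= b -> F b - F a = iv a b f].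
Proof.
move=> cf; have [F FAC] := AC_exists (locint_cont cf).
exists (fun x => F x - F 0); split; last 2 first.
- by rewrite subrr.
- by move=> a b ab; rewrite -(AC_iv FAC ab); ring.
move=> x.
have x1 : x - 1 < x by lra.
have D := FTC1c cf x1.
have D' := derD (der_cst (F (x - 1) - F 0) x) D; rewrite add0r in D'.
apply: near_eq_is_derive D'.
have : \forall y \near x, x - 1 < y by apply: lt_nbhsr.
by apply: filterS => y /ltW xy; rewrite -(AC_iv FAC xy); ring.
Qed.

Lemma continuous_bounded_itv f (a b : R) : continuous f ->
  exists2 C, 0 < C & forall x, a <= x <= b -> `|f x| <= C.
Proof.
move=> cf; have ab : a <= Num.max a b by rewrite le_max lexx.
have [c _ cM] := @EVT_max R _ _ _ ab (continuous_subspaceT (cont_norm cf)).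
exists (`|f c| + 1) => [|x /andP[ax xb]]; first by have := normr_ge0 (f c); lra.
have : `|f x| <= `|f c| by apply: cM; rewrite in_itv /= ax le_max xb orbT.
by lra.
Qed.

Lemma decay_comp U F : decay U -> (forall x, {for x, continuous F}) -> F 0 = 0 ->
  decay (fun x => F (U x)).
Proof.
move=> dU cF F0 e e0.
have /cvgrPdist_lt /(_ e e0) := cF 0.
move=> /nbhs_ballP[d /= d0 H].
have [r r0 Hr] := dU _ d0; exists r => // x /Hr Ux.
have := H (U x); rewrite /ball /= sub0r normrN => /(_ Ux).
by rewrite F0 sub0r normrN.
Qed.

(** From [|sqrt a - sqrt b| <= sqrt a + sqrt b]. The square root is not Lipschitz at [0], but
    squared differences are controlled linearly, and only these are integrated later. *)
Lemma sqrt_sub_le (a b : R) : 0 <= a -> 0 <= b ->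
  (Num.sqrt a - Num.sqrt b) ^+ 2 <= `|a - b|.
Proof.
move=> a0 b0.
have sa := sqr_sqrtr a0; have sb := sqr_sqrtr b0.
have := sqrtr_ge0 a; have := sqrtr_ge0 b; move: sa sb.
set p := Num.sqrt a; set q := Num.sqrt b => pa qb q0 p0.
rewrite -pa -qb subr_sqr normrM (ger0_norm (addr_ge0 p0 q0)).
have : `|p - q| <= p + q by rewrite ler_norml; lra.
have -> : (p - q) ^+ 2 = `|p - q| * `|p - q| by rewrite -normrM -expr2 ger0_norm ?sqr_ge0.
by move=> H; rewrite ler_wpM2l.
Qed.

End Auxiliary.

(** * The potential [W] and the critical speed *)

Section Potential.
Variables (R : realType) (A : R).

(** The threshold [A_1]; for waves moving left the threshold [A_2] appears as [- crit (- A)]. *)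
Definition crit : R := (- A + Num.sqrt (A ^+ 2 + 4)) / 2.

Lemma crit_eq : crit ^+ 2 + A * crit = 1.
Proof.
have : Num.sqrt (A ^+ 2 + 4) ^+ 2 = A ^+ 2 + 4.
  by rewrite sqr_sqrtr// addr_ge0 ?sqr_ge0.
rewrite /crit; set q := Num.sqrt _ => H.
have -> : ((- A + q) / 2) ^+ 2 + A * ((- A + q) / 2) = (q ^+ 2 - A ^+ 2) / 4 by field.
by rewrite H; field.
Qed.

Lemma crit_gt0 : 0 < crit.
Proof.
have : A < Num.sqrt (A ^+ 2 + 4).
  apply: le_lt_trans (ler_norm A) _; rewrite -sqrtr_sqr ltr_sqrt; first lra.
  by rewrite ltr_wpDl ?sqr_ge0.
by rewrite /crit; lra.
Qed.

Definition W (y : R) : R := y + A - y^-1.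

Lemma W_crit : W crit = 0.
Proof.
have c0 : crit != 0 by rewrite gt_eqF// crit_gt0.
have -> : W crit = (crit ^+ 2 + A * crit - 1) / crit by rewrite /W; field.
by rewrite crit_eq subrr mul0r.
Qed.

Lemma W_increasing y y' : 0 < y -> y <= y' -> W y + (y' - y) <= W y'.
Proof.
move=> y0 yy; rewrite /W.
have : y'^-1 <= y^-1 by rewrite lef_pV2 ?posrE//; lra.
by lra.
Qed.

Lemma W_ge y : crit <= y -> y - crit <= W y.
Proof. by move=> h; have := W_increasing crit_gt0 h; rewrite W_crit add0r. Qed.

Lemma W_lt0 y : 0 < y -> y < crit -> W y < 0.
Proof. by move=> y0 yc; have := W_increasing y0 (ltW yc); rewrite W_crit; lra. Qed.

(* The cut-off keeps the slope functions defined at levels above the crest, which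
   perturbed waves may reach. *)
Definition Wp (y : R) : R := Num.max 0 (y + A - (Num.max y crit)^-1).

Lemma maxcrit_gt0 y : 0 < Num.max y crit.
Proof. by rewrite lt_max crit_gt0 orbT. Qed.

Lemma Wp_ge0 y : 0 <= Wp y.
Proof. by rewrite le_max lexx. Qed.

Lemma WpE y : crit <= y -> Wp y = W y.
Proof.
move=> h; rewrite /Wp (max_idPl h) -/(W y); apply/max_idPr.
by have := W_ge h; lra.
Qed.

Lemma Wp0 y : y <= crit -> Wp y = 0.
Proof.
move=> h; rewrite /Wp (max_idPr h); apply/max_idPl.
by have := W_crit; rewrite /W; lra.
Qed.

Lemma Wp_cont : continuous Wp.
Proof.
apply: cont_max; first exact: (@cont_cst R 0).
apply: contD; first exact: contD (@cont_id R) (@cont_cst R A).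
apply: contN; apply: contV; first by move=> x; rewrite gt_eqF// maxcrit_gt0.
exact: cont_max (@cont_id R) (@cont_cst R crit).
Qed.

(** Above [crit] the difference quotient of [W] is [1 + 1 / (a b)], largest at [crit]; below, [Wp]
    is constant. The two regimes are joined at [crit]. *)
Lemma Wp_lip y y' : `|Wp y - Wp y'| <= (1 + crit ^- 2) * `|y - y'|.
Proof.
wlog yy : y y' / y <= y'.
  move=> H; have [|/ltW] := leP y y'; first exact: H.
  by move=> /H; rewrite distrC (distrC y').
rewrite distrC (distrC y) [`|y' - y|]ger0_norm ?subr_ge0//.
have c0 := crit_gt0; have cV : 0 < crit ^- 2 by rewrite invr_gt0 exprn_gt0.
have K a b : crit <= a -> a <= b -> `|Wp b - Wp a| <= (1 + crit ^- 2) * (b - a).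
  move=> ca ab; rewrite !WpE//; last by apply: le_trans ab.
  have h := W_increasing (lt_le_trans c0 ca) ab.
  have a0 : 0 < a by apply: lt_le_trans ca.
  have b0 : 0 < b by apply: lt_le_trans ab.
  rewrite ger0_norm; last by lra.
  have -> : W b - W a = (b - a) * (1 + (a * b)^-1).
    by rewrite /W; field; rewrite !gt_eqF.
  have e1 : 0 < crit ^+ 2 := exprn_gt0 2 c0.
  have e2 : 0 < a * b := mulr_gt0 a0 b0.
  rewrite [X in _ <= X]mulrC ler_wpM2l ?subr_ge0// lerD2l lef_pV2 ?posrE//.
  by rewrite expr2; apply: ler_pM; [exact: ltW c0|exact: ltW c0|exact: ca|exact: (le_trans ca ab)].
have [ca|ac] := leP crit y; first exact: K.
have [cb|bc] := leP y' crit.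
  by rewrite (Wp0 cb) (Wp0 (ltW ac)) subrr normr0 mulr_ge0 ?subr_ge0// addr_ge0// ltW.
rewrite (Wp0 (ltW ac)).
have := K crit y' (lexx _) (ltW bc); rewrite (Wp0 (lexx crit)) => /le_trans; apply.
by rewrite ler_wpM2l ?addr_ge0 ?ltW//; lra.
Qed.

End Potential.

(* Tangent-line inequality for the convex function [t |-> t * sqrt (a t + y)]: here
   [p ^+ 2 = a t + y] and [q ^+ 2 = a (t + h) + y]. *)
Lemma tangent_ineq (R : realFieldType) (a t y h p q : R) :
  0 <= a -> 0 <= t -> 0 < y -> 0 <= t + h -> 0 < p -> 0 < q ->
  p ^+ 2 = a * t + y -> q ^+ 2 = a * (t + h) + y ->
  t * p + h * (p + a * t / (2 * p)) <= (t + h) * q.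
Proof.
move=> a0 t0 y0 th0 p0 q0 pE qE.
have [a00|an0] := eqVneq a 0.
  have pq : p = q.
    apply/eqP; rewrite -(@eqrXn2 _ 2) ?ltW//.
    by rewrite pE qE a00 !mul0r.
  by rewrite a00 pq mul0r mul0r addr0; lra.
have ap : 0 < a by rewrite lt_neqAle eq_sym an0.
have ah : a * h = q ^+ 2 - p ^+ 2 by rewrite pE qE; ring.
rewrite -subr_ge0 -(pmulr_rge0 _ ap).
have -> : a * ((t + h) * q - (t * p + h * (p + a * t / (2 * p)))) =
   a * t * (q - p) + (a * h) * (q - p - a * t / (2 * p)) by ring.
rewrite ah.
have -> : a * t * (q - p) + (q ^+ 2 - p ^+ 2) * (q - p - a * t / (2 * p)) =
  (q - p) ^+ 2 * (2 * p * (q + p) - a * t) / (2 * p) by field; rewrite gt_eqF.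
apply: mulr_ge0; last by rewrite invr_ge0 mulr_ge0// ltW.
by apply: mulr_ge0; [exact: sqr_ge0|nra].
Qed.

(** * Slope functions of the waves and convexity of the action in the speed *)

Section Calibration.
Variables (R : realType) (A sigma : R).
Hypothesis sigma1 : sigma <= 1.
Local Notation crit := (crit A).
Local Notation Wp := (Wp A).

(** A floor for the mobility [k - sigma * u]. Along a wave the mobility is at least [crit], and the
    smallness conditions in [core] never let it drop below a quarter of that. *)
Definition kap : R := crit / 4.

Lemma kap_gt0 : 0 < kap.
Proof. by rewrite divr_gt0// crit_gt0. Qed.

Definition ZZ (k s : R) : R := Num.max (k - sigma * s) kap.

Lemma ZZ_ge k s : kap <= ZZ k s.
Proof. by rewrite le_max lexx orbT. Qed.

Lemma ZZ_gt0 k s : 0 < ZZ k s.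
Proof. exact: lt_le_trans kap_gt0 (ZZ_ge k s). Qed.

Lemma ZZE k s : kap <= k - sigma * s -> ZZ k s = k - sigma * s.
Proof. by move=> h; apply/max_idPl. Qed.

Lemma ZZ_cont k : continuous (ZZ k).
Proof.
apply: cont_max; last exact: (@cont_cst R kap).
apply: contD; first exact: (@cont_cst R k).
by apply: contN; apply: contM; [exact: (@cont_cst R sigma)|exact: (@cont_id R)].
Qed.

Definition sW (k s : R) : R := Num.sqrt (Wp (k - s)).
Definition sZ (k s : R) : R := Num.sqrt (ZZ k s).

Lemma sW_ge0 k s : 0 <= sW k s. Proof. exact: sqrtr_ge0. Qed.
Lemma sW_sqr k s : sW k s ^+ 2 = Wp (k - s).
Proof. by rewrite sqr_sqrtr// Wp_ge0. Qed.
Lemma sZ_gt0 k s : 0 < sZ k s. Proof. by rewrite sqrtr_gt0 ZZ_gt0. Qed.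
Lemma sZ_sqr k s : sZ k s ^+ 2 = ZZ k s.
Proof. by rewrite sqr_sqrtr// ltW// ZZ_gt0. Qed.

Lemma sW_cont k : continuous (sW k).
Proof.
apply: cont_sqrt; apply: (cont_comp (@Wp_cont R A)).
by apply: contD; [exact: (@cont_cst R k)|apply: contN; exact: (@cont_id R)].
Qed.

Lemma sZ_cont k : continuous (sZ k).
Proof. by apply: cont_sqrt; exact: ZZ_cont. Qed.

Lemma sZV_cont k : continuous (fun s => (sZ k s)^-1).
Proof. by apply: contV; [move=> s; rewrite gt_eqF// sZ_gt0|exact: sZ_cont]. Qed.

(* The first integral [(k - sigma phi) phi' ^ 2 = phi ^ 2 W (k - phi)] makes [gg k s] the
   slope of the wave of speed [k] at level [s]; [ff k] and [rr k] are the densities, with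
   respect to the level, of half the action [k E - F] and of half the energy [E]. *)
Definition ff (k s : R) : R := s * (sW k s * sZ k s).
Definition gg (k s : R) : R := s * (sW k s * (sZ k s)^-1).
Definition rr (c s : R) : R := sW c s * (sZ c s + (1 - sigma) / 2 * (s * (sZ c s)^-1)).

Lemma ff_cont k : continuous (ff k).
Proof.
by apply: contM; [exact: (@cont_id R)|apply: contM; [exact: sW_cont|exact: sZ_cont]].
Qed.

Lemma gg_cont k : continuous (gg k).
Proof.
by apply: contM; [exact: (@cont_id R)|apply: contM; [exact: sW_cont|exact: sZV_cont]].
Qed.

Lemma rr_cont k : continuous (rr k).
Proof.
apply: contM; first exact: sW_cont.
apply: contD; first exact: sZ_cont.
apply: contM; first exact: (@cont_cst R ((1 - sigma) / 2)).
by apply: contM; [exact: (@cont_id R)|exact: sZV_cont].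
Qed.

(* Shifting the speed and the level together keeps the factor [sW] and makes the
   rest convex in the shift, whence the tangent inequality under the integral. *)
Lemma ff_tangent c h s : 0 <= s -> 0 <= s + h -> crit <= c - s ->
  ff c s + h * rr c s <= ff (c + h) (s + h).
Proof.
move=> s0 sh0 cs.
have c0 := crit_gt0 A.
have kc : kap <= crit by rewrite /kap; lra.
have a0 : 0 <= 1 - sigma by rewrite subr_ge0.
have e1 : c - sigma * s = (1 - sigma) * s + (c - s) by ring.
have e2 : c + h - sigma * (s + h) = (1 - sigma) * (s + h) + (c - s) by ring.
have m1 : 0 <= (1 - sigma) * s by exact: mulr_ge0.
have m2 : 0 <= (1 - sigma) * (s + h) by exact: mulr_ge0.
have z1 : ZZ c s = (1 - sigma) * s + (c - s).
  by rewrite -e1; apply: ZZE; lra.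
have z2 : ZZ (c + h) (s + h) = (1 - sigma) * (s + h) + (c - s).
  by rewrite -e2; apply: ZZE; lra.
have y0 : 0 < c - s by lra.
have T := tangent_ineq a0 s0 y0 sh0 (sZ_gt0 c s) (sZ_gt0 (c + h) (s + h)).
rewrite !sZ_sqr z1 z2 in T; have {}T := T erefl erefl.
have sWE : sW (c + h) (s + h) = sW c s by rewrite /sW; congr (Num.sqrt (Wp _)); ring.
rewrite /ff /rr sWE.
have p0 : sZ c s != 0 by rewrite gt_eqF// sZ_gt0.
have -> : s * (sW c s * sZ c s) +
    h * (sW c s * (sZ c s + (1 - sigma) / 2 * (s * (sZ c s)^-1))) =
    sW c s * (s * sZ c s + h * (sZ c s + (1 - sigma) * s / (2 * sZ c s))) by field.
have -> : (s + h) * (sW c s * sZ (c + h) (s + h)) =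
    sW c s * ((s + h) * sZ (c + h) (s + h)) by ring.
by rewrite ler_wpM2l// sW_ge0.
Qed.

(** In the lower half of the levels, [s <= (c - crit) / 2], the product of the two square roots is
    at least [4 * gap c]; this is the source of strict convexity. *)
Definition gap (c : R) : R := Num.sqrt ((c - crit) / 2 * kap) / 4.

Lemma gap_gt0 c : crit < c -> 0 < gap c.
Proof.
move=> cc; rewrite divr_gt0// sqrtr_gt0 mulr_gt0 ?kap_gt0// divr_gt0//; lra.
Qed.

Lemma sWZ_ge c s k s' : crit < c -> (c - crit) / 2 <= c - s - crit ->
  4 * gap c <= sW c s * sZ k s'.
Proof.
move=> cc cs; rewrite /sW /sZ -sqrtrM ?Wp_ge0//.
have -> : 4 * gap c = Num.sqrt ((c - crit) / 2 * kap) by rewrite /gap; field.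
have k0 := kap_gt0.
rewrite ler_sqrt; last by rewrite mulr_ge0 ?Wp_ge0// ltW// ZZ_gt0.
have cs' : crit <= c - s by lra.
apply: ler_pM; [lra|lra| |exact: ZZ_ge].
by rewrite WpE//; have := W_ge cs'; lra.
Qed.

(** After shifting the level by [h], the integrands satisfy the tangent inequality pointwise on the
    common range. The quadratic gain comes from the interval of length [|h|] at the bottom that only
    one of the two integrals covers: half of it contributes a length [|h| / 2], a level [|h| / 2]
    and the factor [4 * gap c]. *)
Lemma speed_convexity c h : crit < c -> `|h| <= (c - crit) / 4 ->
  iv 0 (c - crit) (ff c) + h * iv 0 (c - crit) (rr c) + gap c * h ^+ 2 <=
  iv 0 (c - crit + h) (ff (c + h)).
Proof.
move=> cc hM; have g0 := gap_gt0 cc.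
pose M := c - crit; rewrite -/M in hM *.
have M0 : 0 < M by rewrite /M; lra.
pose T s := ff c s + h * rr c s.
pose X s := ff (c + h) (s + h).
have lf k : locint (ff k) := locint_cont (@ff_cont k).
have lr k : locint (rr k) := locint_cont (@rr_cont k).
have lT : locint T by apply: locintD => //; exact: locintZ.
have lX : locint X by exact: locint_shift.
have -> : iv 0 M (ff c) + h * iv 0 M (rr c) = iv 0 M T.
  by rewrite ivD// ?ivZ//; exact: locintZ.
have -> : iv 0 (M + h) (ff (c + h)) = iv (- h) M X.
  by rewrite /X iv_shift// addNr.
have TX s : 0 <= s -> 0 <= s + h -> s <= M -> T s <= X s.
  by move=> s0 sh sM; apply: ff_tangent => //; rewrite /M in sM; lra.
have lcst k : locint (fun _ : R => k) := locint_cont (@cont_cst R k).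
have [h0|h0] := leP 0 h.
  rewrite ger0_norm// in hM.
  have a1 : - h <= 0 by lra.
  rewrite (iv_add a1 (ltW M0) lX).
  have : iv 0 M T <= iv 0 M X.
    by apply: iv_mono => // s /andP[s0 sM]; apply: TX => //; lra.
  suff : gap c * h ^+ 2 <= iv (- h) 0 X by lra.
  have a2 : - h <= - h / 2 by lra.
  have a3 : - h / 2 <= 0 by lra.
  rewrite (iv_add a2 a3 lX).
  have XE s : X s = (s + h) * (sW c s * sZ (c + h) (s + h)).
    by rewrite /X /ff /sW; congr (_ * (Num.sqrt (Wp _) * _)); ring.
  have b1 : 0 <= iv (- h) (- h / 2) X.
    apply: iv_ge0 => s /andP[s1 s2]; rewrite XE mulr_ge0//; first lra.
    by rewrite mulr_ge0 ?sW_ge0// ltW// sZ_gt0.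
  have b2 : iv (- h / 2) 0 (fun=> h / 2 * (4 * gap c)) <= iv (- h / 2) 0 X.
    apply: iv_mono => // s /andP[s1 s2]; rewrite XE.
    by apply: ler_pM; [lra|lra|lra|apply: sWZ_ge => //; rewrite /M in M0; lra].
  have E : iv (- h / 2) 0 (fun=> h / 2 * (4 * gap c)) = gap c * h ^+ 2.
    by rewrite iv_cst//; field.
  by rewrite E in b2; lra.
rewrite ltr0_norm// in hM.
have a1 : 0 <= - h by lra.
have a2 : - h <= M by lra.
rewrite (iv_add a1 a2 lT).
have : iv (- h) M T <= iv (- h) M X.
  by apply: iv_mono => // s /andP[s0 sM]; apply: TX => //; lra.
suff : iv 0 (- h) T <= - (gap c * h ^+ 2) by lra.
have a3 : 0 <= - h / 2 by lra.
have a4 : - h / 2 <= - h by lra.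
rewrite (iv_add a3 a4 lT).
(* The [(1 - sigma)] part of [rr] is nonnegative and multiplied by [h < 0], so it may be dropped
   from the upper bound. *)
have TE s : 0 <= s -> s <= - h -> T s <= (s + h) * (sW c s * sZ c s).
  move=> s0 sh; rewrite /T /ff /rr.
  have : h * (sW c s * ((1 - sigma) / 2 * (s * (sZ c s)^-1))) <= 0.
    rewrite mulr_le0_ge0//; first exact: ltW.
    rewrite mulr_ge0 ?sW_ge0// mulr_ge0//; first by rewrite divr_ge0// subr_ge0.
    by rewrite mulr_ge0// invr_ge0 ltW// sZ_gt0.
  by lra.
have WZ0 s : 0 <= sW c s * sZ c s by rewrite mulr_ge0 ?sW_ge0// ltW// sZ_gt0.
have b1 : iv (- h / 2) (- h) T <= 0.
  rewrite -[X in _ <= X](mul0r (- h - (- h / 2))) -iv_cst//.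
  apply: iv_mono => // s /andP[s1 s2]; apply: (le_trans (TE s _ s2)); first lra.
  by rewrite mulr_le0_ge0//; lra.
have b2 : iv 0 (- h / 2) T <= iv 0 (- h / 2) (fun=> h / 2 * (4 * gap c)).
  apply: iv_mono => // s /andP[s1 s2]; apply: (le_trans (TE s s1 _)); first lra.
  rewrite -lerN2 -!mulNr; apply: ler_pM; [lra|lra|lra|].
  by apply: sWZ_ge => //; rewrite /M in hM; lra.
have E : iv 0 (- h / 2) (fun=> h / 2 * (4 * gap c)) = - (gap c * h ^+ 2).
  by rewrite iv_cst//; field.
by rewrite E in b2; lra.
Qed.

(** Near the crest the slope depends on the speed like a square root, since [W] vanishes there; its
    squared variation is nevertheless linear in [|k - c|]. The factor [s ^ 2] keeps the bound
    integrable over the line. *)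
Lemma gg_speed c k s : kap <= c - sigma * s -> kap <= k - sigma * s ->
  (gg k s - gg c s) ^+ 2 <=
  s ^+ 2 * ((kap^-1 * (1 + crit ^- 2) + Wp (c - s) / kap ^+ 2) * `|k - c|).
Proof.
move=> hc hk.
have k0 := kap_gt0.
have z1 := ZZE hc; have z2 := ZZE hk.
have sV (k' : R) : (sW k' s * (sZ k' s)^-1) = Num.sqrt (Wp (k' - s) / ZZ k' s).
  by rewrite sqrtrM ?Wp_ge0// sqrtrV// ltW// ZZ_gt0.
have -> : gg k s - gg c s = s * (Num.sqrt (Wp (k - s) / ZZ k s) - Num.sqrt (Wp (c - s) / ZZ c s)).
  by rewrite /gg !sV; ring.
rewrite exprMn ler_wpM2l ?sqr_ge0//.
apply: le_trans (sqrt_sub_le _ _) _.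
- by rewrite divr_ge0 ?Wp_ge0// ltW// ZZ_gt0.
- by rewrite divr_ge0 ?Wp_ge0// ltW// ZZ_gt0.
set a := Wp (k - s); set b := Wp (c - s).
have b0 : 0 <= b by exact: Wp_ge0.
have zk0 := ZZ_gt0 k s; have zc0 := ZZ_gt0 c s.
have -> : a / ZZ k s - b / ZZ c s = (a - b) / ZZ k s - b * (k - c) / (ZZ k s * ZZ c s).
  rewrite z1 z2; rewrite z1 in zc0; rewrite z2 in zk0.
  by field; rewrite !gt_eqF.
apply: le_trans (ler_normB _ _) _; rewrite [leRHS]mulrDl; apply: lerD.
  rewrite normrM normfV (gtr0_norm zk0) mulrC -mulrA.
  have L := Wp_lip A (k - s) (c - s).
  have E : k - s - (c - s) = k - c by ring.
  rewrite E in L; apply: ler_pM => //; first by rewrite invr_ge0 ltW.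
  by rewrite lef_pV2 ?posrE//; exact: ZZ_ge.
rewrite !normrM normfV normrM (ger0_norm b0) (gtr0_norm zk0) (gtr0_norm zc0).
have e1 : 0 < kap ^+ 2 := exprn_gt0 2 k0.
have e2 := mulr_gt0 zk0 zc0.
rewrite mulrAC ler_wpM2r// ler_wpM2l// lef_pV2 ?posrE//.
by rewrite expr2; apply: ler_pM; [exact: ltW|exact: ltW|exact: ZZ_ge|exact: ZZ_ge].
Qed.

End Calibration.

(** * Completing the squares in [k E - F] *)

Section Energies.
Variables (R : realType) (A sigma : R).
Local Notation crit := (crit A).
Local Notation kap := (kap A).

Lemma L1_energy (U u1 v : R -> R) : L2 U -> L2 u1 -> L2 v ->
  L1 (fun x => U x ^+ 2 + u1 x ^+ 2 + v x ^+ 2).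
Proof. by move=> hU h1 hv; apply: L1D; [apply: L1D|]; exact: L2_sqr. Qed.

Lemma L1_flux (U u1 v : R -> R) M : (forall x, `|U x| <= M) -> L2 U -> L2 u1 -> L2 v ->
  L1 (fun x => U x ^+ 3 + sigma * U x * u1 x ^+ 2 + 2 * U x * v x
                 + U x * v x ^+ 2 - A * U x ^+ 2).
Proof.
move=> UM hU h1 hv.
have mU := L2_measurable hU.
have i0 := L2_sqr hU; have i1 := L2_sqr h1; have i2 := L2_sqr hv; have i3 := L2M hU hv.
have j0 := L1_mulb mU UM i0; have j1 := L1_mulb mU UM i1; have j2 := L1_mulb mU UM i2.
have H := L1B (L1D (L1D (L1D j0 (L1Z sigma j1)) (L1Z 2 i3)) j2) (L1Z A i0).
by apply: (eq_L1 _ H) => x; ring.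
Qed.

Lemma L2_comp_lin (F U : R -> R) C : continuous F -> L2 U -> 
  (forall x, `|F (U x)| <= C * `|U x|) -> L2 (fun x => F (U x)).
Proof.
move=> cF hU H; apply: (L2_le _ (L2Z C hU)).
  apply: (measurableT_comp (f := F)); last exact: L2_measurable.
  exact: continuous_measurable_fun.
by move=> x; rewrite normrM; apply: le_trans (H x) _; rewrite ler_wpM2r// ler_norm.
Qed.

Lemma sW_bound k (U : R -> R) M : (forall x, `|U x| <= M) ->
  exists2 C, 0 < C & forall x, sW A k (U x) * sZ A sigma k (U x) <= C.
Proof.
move=> UM.
have [C C0 H] := continuous_bounded_itv (- M) M
  (contM (@sW_cont R A k) (@sZ_cont R A sigma k)).
exists C => // x; apply: le_trans (ler_norm _) _.
by apply: (H (U x)); rewrite -ler_norml.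
Qed.

Lemma L1_ff k (U u1 : R -> R) M : (forall x, `|U x| <= M) -> L2 U -> L2 u1 ->
  L1 (fun x => ff A sigma k (U x) * u1 x).
Proof.
move=> UM hU h1; have [C C0 HC] := sW_bound k UM.
apply: L2M => //; apply: (L2_comp_lin (C := C)) => //; first exact: ff_cont.
move=> x; rewrite /ff normrM mulrC ler_wpM2r// ger0_norm ?HC//.
by rewrite mulr_ge0 ?sW_ge0// ltW// sZ_gt0.
Qed.

Definition slope_defect k m0 (U u1 : R -> R) : R -> R := fun x =>
  (sZ A sigma k (U x) * u1 x - sgn m0 x * (sW A k (U x) * U x)) ^+ 2.
Definition density_defect k (U v : R -> R) : R -> R := fun x =>
  (k - U x) * (v x - U x / (k - U x)) ^+ 2.

(* Completing squares: [k E - F] exceeds its calibrated lower bound by two squares. *)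
Lemma deficit k m0 (U u1 v : R -> R) : AC U u1 -> L2 U -> L2 u1 -> L2 v ->
  (forall x, kap <= k - sigma * U x) -> (forall x, crit <= k - U x) ->
  0 <= U m0 ->
  [/\ L1 (slope_defect k m0 U u1), L1 (density_defect k U v) &
  2 * (k * Efun U u1 v - Ffun A sigma U u1 v) =
  intR (slope_defect k m0 U u1) + intR (density_defect k U v)
  + 4 * iv 0 (U m0) (ff A sigma k)].
Proof.
move=> aU hU h1 hv Hz Hy Um0.
have cU := AC_continuous aU; have dU := sobolev_decay aU hU h1.
have [M M0 UM] := continuous_decay_bounded cU dU.
have c0 := crit_gt0 A.
have iE := L1_energy hU h1 hv; have iF := L1_flux UM hU h1 hv.
have iff := L1_ff k UM hU h1.
have is_ : L1 (fun x => sgn m0 x * (ff A sigma k (U x) * u1 x)).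
  by apply: L1_mulb iff; [exact: sgn_measurable|exact: sgn_norm].
have y0 x : 0 < k - U x by apply: lt_le_trans c0 (Hy x).
have mU := L2_measurable hU.
have cy : continuous (fun x => k - U x).
  by apply: contD; [exact: (@cont_cst R k)|exact: contN].
have mVy : measurable_fun [set: R] (fun x => (k - U x)^-1).
  apply: continuous_measurable_fun; apply: contV => // x.
  by rewrite gt_eqF.
have hUy : L2 (fun x => U x / (k - U x)).
  apply: (eq_L2 _ (L2_mulb (M := crit^-1) mVy _ hU)) => [x|x]; first by rewrite mulrC.
  by rewrite ger0_norm ?invr_ge0 ?(ltW (y0 x))// lef_pV2 ?posrE//.
have id_ : L1 (density_defect k U v).
  apply: (L1_mulb (M := `|k| + M)).
  - exact: continuous_measurable_fun.
  - by move=> x; apply: le_trans (ler_normB _ _) _; rewrite lerD2l.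
  - by apply: L2_sqr; exact: L2B.
(* The density square takes up the terms in [v] and leaves a surplus [U ^ 2 / (k - U)], which the
   summand [- 1 / y] of [W] compensates. The cross term of the slope square is, up to the sign
   [sgn m0], a total derivative. *)
have key x : k * (U x ^+ 2 + u1 x ^+ 2 + v x ^+ 2) -
    (U x ^+ 3 + sigma * U x * u1 x ^+ 2 + 2 * U x * v x
                 + U x * v x ^+ 2 - A * U x ^+ 2) =
    slope_defect k m0 U u1 x + density_defect k U v x +
    2 * (sgn m0 x * (ff A sigma k (U x) * u1 x)).
  rewrite /slope_defect /density_defect /ff.
  have zE := sZ_sqr A sigma k (U x); rewrite ZZE// in zE.
  have wE := sW_sqr A k (U x); rewrite WpE// /W in wE.
  have sE := sgn_sqr m0 x.
  move: (sZ _ _ _ _) (sW _ _ _) (sgn _ _) zE wE sE => p q s zE wE sE.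
  have -> : (p * u1 x - s * (q * U x)) ^+ 2 =
     p ^+ 2 * u1 x ^+ 2 + s ^+ 2 * q ^+ 2 * U x ^+ 2 - 2 * (s * (U x * (q * p) * u1 x)) by ring.
  rewrite zE wE sE; field; by rewrite gt_eqF.
have isl : L1 (slope_defect k m0 U u1).
  apply: (eq_L1 _ (L1B (L1B (L1B (L1Z k iE) iF) id_) (L1Z 2 is_))) => x.
  by rewrite key; ring.
split=> //.
have -> : 2 * (k * Efun U u1 v - Ffun A sigma U u1 v) =
  intR (fun x => k * (U x ^+ 2 + u1 x ^+ 2 + v x ^+ 2) -
    (U x ^+ 3 + sigma * U x * u1 x ^+ 2 + 2 * U x * v x
                 + U x * v x ^+ 2 - A * U x ^+ 2)).
  by rewrite intR_B//; [rewrite intR_Z// /Efun /Ffun; field|exact: L1Z].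
rewrite (eq_intR key) intR_D; [|exact: L1D|exact: L1Z].
rewrite intR_D// intR_Z//; congr (_ + _).
have [F [dF F0 Fi]] := primitive_exists (@ff_cont R A sigma k).
have aF := AC_comp dF (@ff_cont R A sigma k) aU.
have cF x : {for x, continuous F} by exact: der_continuous (dF x).
(* The two flanks contribute [F (U m0)] each, and the cross term carries another factor [2]. *)
rewrite (int_sgn m0 aF iff (decay_comp dU cF F0)).
by rewrite -(Fi _ _ Um0) F0; ring.
Qed.

End Energies.

(** Normal form of a wave with [c > 0]. Both equations are kept: the signed first-order one drives
    the comparison, the second-order one makes [phi2] square integrable and yields the energy
    identity. *)
Record profile (R : realType) (A sigma c : R) (phi phi1 phi2 eta : R -> R) (m0 : R) : Prop := {
  pr_c : crit A < c;
  pr_d1 : forall x : R, is_derive x 1 phi (phi1 x);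
  pr_d2 : forall x : R, is_derive x 1 phi1 (phi2 x);
  pr_c2 : continuous phi2;
  pr_pos : forall x, 0 < phi x;
  pr_le : forall x, phi x <= c - crit A;
  pr_top : phi m0 = c - crit A;
  pr_off : forall x, x != m0 -> phi x < c - crit A;
  pr_eta : forall x, eta x = phi x / (c - phi x);
  pr_ode1 : forall x, phi1 x = sgn m0 x * gg A sigma c (phi x);
  pr_ode2 : forall x, (c - sigma * phi x) * phi2 x =
    (c + A) * phi x - 3 / 2 * phi x ^+ 2 + sigma / 2 * phi1 x ^+ 2
    - eta x - eta x ^+ 2 / 2;
  pr_L2 : L2 phi }.

(** * Integrability, action and energy of a profile *)

Section ProfileFacts.
Variables (R : realType) (A sigma c : R) (phi phi1 phi2 eta : R -> R) (m0 : R).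
Hypothesis sigma1 : sigma <= 1.
Hypothesis P : profile A sigma c phi phi1 phi2 eta m0.
Local Notation crit := (crit A).
Local Notation kap := (kap A).

Lemma phi_cont : continuous phi.
Proof. by move=> x; exact: der_continuous (pr_d1 P x). Qed.
Lemma phi1_cont : continuous phi1.
Proof. by move=> x; exact: der_continuous (pr_d2 P x). Qed.
Lemma phi_AC : AC phi phi1.
Proof. exact: AC_C1 (pr_d1 P) phi1_cont. Qed.
Lemma phi1_AC : AC phi1 phi2.
Proof. exact: AC_C1 (pr_d2 P) (pr_c2 P). Qed.

Lemma phi_y x : crit <= c - phi x.
Proof. by have := pr_le P x; lra. Qed.

Lemma phi_z x : crit <= c - sigma * phi x.
Proof.
have := phi_y x; have := pr_pos P x.
have : 0 <= (1 - sigma) * phi x by rewrite mulr_ge0 ?subr_ge0// ltW// (pr_pos P).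
by lra.
Qed.

Lemma kap_le_crit : kap <= crit.
Proof. by have := crit_gt0 A; rewrite /kap; lra. Qed.

Lemma phi_zk x : kap <= c - sigma * phi x.
Proof. exact: le_trans kap_le_crit (phi_z x). Qed.

Lemma phi1_sqr x : phi1 x ^+ 2 * (c - sigma * phi x) = phi x ^+ 2 * W A (c - phi x).
Proof.
rewrite (pr_ode1 P) /gg !exprMn sgn_sqr exprVn.
rewrite sW_sqr sZ_sqr ZZE ?phi_zk// WpE ?phi_y//.
have z0 : c - sigma * phi x != 0 by rewrite gt_eqF// (lt_le_trans (crit_gt0 A))// phi_z.
by field.
Qed.

Lemma phi_norm x : `|phi x| = phi x.
Proof. by rewrite gtr0_norm// (pr_pos P). Qed.

Lemma phi_bound x : `|phi x| <= c - crit.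
Proof. by rewrite phi_norm (pr_le P). Qed.

Lemma phi1_le : exists2 C, 0 < C & forall x, `|phi1 x| <= C * `|phi x|.
Proof.
have [C C0 H] := continuous_bounded_itv 0 (c - crit)
  (contM (@sW_cont R A c) (@sZV_cont R A sigma c)).
exists C => // x; rewrite (pr_ode1 P) /gg !normrM.
have := sgn_norm m0 x; have := H (phi x); rewrite (pr_le P) ltW ?(pr_pos P)// => /(_ isT).
rewrite normrM; set a := `|sgn _ _|; set b := `|sW _ _ _| * _ => hb ha.
have b0 : 0 <= b by rewrite /b mulr_ge0.
have a0 : 0 <= a by exact: normr_ge0.
rewrite mulrCA mulrC ler_wpM2r//.
by apply: le_trans hb; rewrite ler_piMl.
Qed.

Lemma phi1_L2 : L2 phi1.
Proof.
have [C C0 H] := phi1_le; apply: (L2_le _ (L2Z C (pr_L2 P))).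
  by apply: continuous_measurable_fun; exact: phi1_cont.
by move=> x; rewrite normrM (gtr0_norm C0).
Qed.

Lemma eta_le x : `|eta x| <= crit^-1 * `|phi x|.
Proof.
have y0 : 0 < c - phi x by apply: lt_le_trans (crit_gt0 A) (phi_y x).
rewrite (pr_eta P) normrM mulrC ler_wpM2r// ger0_norm ?invr_ge0 ?(ltW y0)//.
by rewrite lef_pV2 ?posrE ?crit_gt0// phi_y.
Qed.

Lemma eta_cont : continuous eta.
Proof.
rewrite (_ : eta = fun x => phi x * (c - phi x)^-1); last first.
  by apply/funext => x; rewrite (pr_eta P).
apply: contM; first exact: phi_cont.
apply: contV.
  by move=> x; rewrite gt_eqF// (lt_le_trans (crit_gt0 A))// phi_y.
by apply: contD; [exact: (@cont_cst R c)|apply: contN; exact: phi_cont].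
Qed.

Lemma eta_L2 : L2 eta.
Proof.
apply: (L2_le _ (L2Z crit^-1 (pr_L2 P))).
  by apply: continuous_measurable_fun; exact: eta_cont.
have cV : 0 <= crit^-1 by rewrite invr_ge0 ltW// crit_gt0.
by move=> x; rewrite normrM (ger0_norm cV); exact: eta_le.
Qed.

Lemma phi_decay : decay phi.
Proof. exact: sobolev_decay phi_AC (pr_L2 P) phi1_L2. Qed.

Lemma phi1_decay : decay phi1.
Proof. by have [C _ H] := phi1_le; exact: decay_le phi_decay H. Qed.

(** Solving the second-order equation for [phi2] bounds it by a multiple of [|phi|], every other
    term being at least linear in [phi]. It is needed for the integration by parts in
    [wave_close]. *)
Lemma phi2_L2 : L2 phi2.
Proof.
have [C C0 H1] := phi1_le.
have c0 := crit_gt0 A.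
set M := c - crit.
pose K := crit^-1 * (`|c + A| + 3 / 2 * M + `|sigma / 2| * (C ^+ 2 * M) + crit^-1 + crit^-1 ^+ 2 * M / 2).
apply: (L2_le _ (L2Z K (pr_L2 P))).
  by apply: continuous_measurable_fun; exact: (pr_c2 P).
have M0 : 0 <= M by rewrite /M; have := pr_c P; lra.
have cV : 0 <= crit^-1 by rewrite invr_ge0 ltW.
have C0' := ltW C0.
have K0 : 0 <= K.
  by rewrite /K mulr_ge0// !addr_ge0 ?mulr_ge0 ?normr_ge0 ?sqr_ge0//.
move=> x; rewrite normrM (ger0_norm K0).
have z0 : 0 < c - sigma * phi x by apply: lt_le_trans c0 (phi_z x).
have -> : phi2 x = (c - sigma * phi x)^-1 * ((c + A) * phi x - 3 / 2 * phi x ^+ 2 + sigma / 2 * phi1 x ^+ 2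
    - eta x - eta x ^+ 2 / 2) by rewrite -(pr_ode2 P) mulKf// gt_eqF.
rewrite normrM /K -(mulrA crit^-1); apply: ler_pM => //.
  by rewrite ger0_norm ?invr_ge0 ?(ltW z0)// lef_pV2 ?posrE// phi_z.
set f := `|phi x|.
have f0 : 0 <= f by exact: normr_ge0.
have fM : f <= M by exact: phi_bound.
have ff2 : f ^+ 2 <= M * f by rewrite expr2 ler_wpM2r.
have t1 : `|(c + A) * phi x| <= `|c + A| * f by rewrite normrM.
have t2 : `|3 / 2 * phi x ^+ 2| <= 3 / 2 * M * f.
  by rewrite normrM normrX -/f ger0_norm// -mulrA ler_wpM2l.
have t3 : `|sigma / 2 * phi1 x ^+ 2| <= `|sigma / 2| * (C ^+ 2 * M) * f.
  rewrite normrM normrX -(mulrA `|sigma / 2|); apply: ler_wpM2l => //.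
  apply: (@le_trans _ _ ((C * f) ^+ 2)).
    by rewrite ler_sqr ?nnegrE ?mulr_ge0// ltW.
  by rewrite exprMn -(mulrA (C ^+ 2)) ler_wpM2l ?sqr_ge0.
have t4 : `|eta x| <= crit^-1 * f by exact: eta_le.
have t5 : `|eta x ^+ 2 / 2| <= crit^-1 ^+ 2 * M / 2 * f.
  rewrite normrM normrX (ger0_norm (_ : 0 <= 2^-1))//.
  have : `|eta x| ^+ 2 <= (crit^-1 * f) ^+ 2 by rewrite ler_sqr ?nnegrE ?mulr_ge0.
  rewrite exprMn => h.
  have : crit^-1 ^+ 2 * f ^+ 2 <= crit^-1 ^+ 2 * (M * f) by rewrite ler_wpM2l ?sqr_ge0.
  by move: h; lra.
apply: le_trans (ler_normB _ _) _.
apply: le_trans (lerD (ler_normB _ _) (lexx _)) _.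
apply: le_trans (lerD (lerD (ler_normD _ _) (lexx _)) (lexx _)) _.
apply: le_trans (lerD (lerD (lerD (ler_normB _ _) (lexx _)) (lexx _)) (lexx _)) _.
by move: t1 t2 t3 t4 t5; rewrite /f; lra.
Qed.

Local Notation E0 := (Efun phi phi1 eta).
Local Notation F0 := (Ffun A sigma phi phi1 eta).

(** Both squares of [deficit] vanish along the wave itself. *)
Lemma profile_action : c * E0 - F0 = 2 * iv 0 (c - crit) (ff A sigma c).
Proof.
have top0 : 0 <= phi m0 by exact: ltW (pr_pos P m0).
have [_ _] := deficit phi_AC (pr_L2 P) phi1_L2 eta_L2 phi_zk phi_y top0.
rewrite (pr_top P).
have -> : intR (slope_defect A sigma c m0 phi phi1) = 0.
  rewrite -[RHS](@intR_0 R); apply: eq_intR => x.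
  rewrite /slope_defect (pr_ode1 P) /gg.
  have p0 : sZ A sigma c (phi x) != 0 by rewrite gt_eqF// sZ_gt0.
  by field.
have -> : intR (density_defect c phi eta) = 0.
  rewrite -[RHS](@intR_0 R); apply: eq_intR => x.
  by rewrite /density_defect (pr_eta P) subrr expr0n mulr0.
by lra.
Qed.

(** As [rr] is the derivative of the shifted action density in the speed, this is the relation
    [d/dc (c E - F) = E] along the family of waves. It is proved on a single wave: half the energy
    density differs from [sgn m0 * rr (phi) * phi1] by the derivative of the flux
    [(c - sigma phi) phi1], which decays. *)
Lemma profile_energy : E0 = 2 * iv 0 (c - crit) (rr A sigma c).
Proof.
have c0 := crit_gt0 A.
have M0 : 0 <= c - crit by have := pr_c P; lra.
have cr := @rr_cont R A sigma c.
have [F [dF F0 Fi]] := primitive_exists cr.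
rewrite -(subr0 (iv _ _ _)) -(Fi _ _ M0) F0 !subr0.
have aF := AC_comp dF cr phi_AC.
have cF x : {for x, continuous F} by exact: der_continuous (dF x).
have dFp := decay_comp phi_decay cF F0.
have ie := L1_energy (pr_L2 P) phi1_L2 eta_L2.
pose Z x := (c - sigma * phi x) * phi1 x.
have aZ : AC Z (fun x => (0 - sigma * phi1 x) * phi1 x + (c - sigma * phi x) * phi2 x).
  apply: AC_M phi1_AC; apply: AC_C1 => [x|]; last first.
    apply: contD; first exact: (@cont_cst R 0).
    by apply: contN; apply: contM; [exact: (@cont_cst R sigma)|exact: phi1_cont].
  exact: derB (der_cst c x) (derZ sigma (pr_d1 P x)).
have dZ : decay Z.
  apply: (decay_le (C := `|c| + `|sigma| * (c - crit)) phi1_decay) => x.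
  rewrite /Z normrM ler_wpM2r//; apply: le_trans (ler_normB _ _) _.
  by rewrite lerD2l normrM ler_wpM2l// phi_bound.
have key x : sgn m0 x * (rr A sigma c (phi x) * phi1 x) =
   1 / 2 * (phi x ^+ 2 + phi1 x ^+ 2 + eta x ^+ 2) +
   ((0 - sigma * phi1 x) * phi1 x + (c - sigma * phi x) * phi2 x).
  rewrite (pr_ode2 P).
  have H1 := phi1_sqr x.
  have z0 : c - sigma * phi x != 0 by rewrite gt_eqF// (lt_le_trans c0)// phi_z.
  have y0 : c - phi x != 0 by rewrite gt_eqF// (lt_le_trans c0)// phi_y.
  have -> : sgn m0 x * (rr A sigma c (phi x) * phi1 x) =
     phi x * W A (c - phi x) + (1 - sigma) / 2 * phi1 x ^+ 2.
    rewrite (pr_ode1 P) /gg /rr.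
    have := sZ_sqr A sigma c (phi x); rewrite ZZE ?phi_zk// => zE.
    have := sW_sqr A c (phi x); rewrite WpE ?phi_y// => wE.
    have sE := sgn_sqr m0 x.
    have p0 : sZ A sigma c (phi x) != 0 by rewrite gt_eqF// sZ_gt0.
    move: (sZ _ _ _ _) (sW _ _ _) (sgn _ _) p0 zE wE sE => p q s p0 zE wE sE.
    rewrite -wE.
    have -> : s * (q * (p + (1 - sigma) / 2 * (phi x * p^-1)) * (s * (phi x * (q * p^-1)))) =
       s ^+ 2 * (phi x * q ^+ 2 + (1 - sigma) / 2 * (phi x * (q * p^-1)) ^+ 2) by field.
    have -> : (s * (phi x * (q * p^-1))) ^+ 2 = s ^+ 2 * (phi x * (q * p^-1)) ^+ 2 by ring.
    by rewrite sE !mul1r.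
  by rewrite (pr_eta P) /W; field.
apply/eqP; rewrite -subr_eq0 -normr_le0; apply/ler_addgt0Pr => e e0; rewrite add0r.
have e5 : 0 < e / 5 by lra.
have [r1 r10 H1] := int_limit ie e5; have [r2 r20 H2] := dFp _ e5.
have [r3 r30 H3] := dZ _ e5.
pose t := Num.max (Num.max r1 r2) (Num.max r3 `|m0|).
have t1 : r1 <= t by rewrite !le_max lexx.
have t2 : r2 <= t by rewrite !le_max lexx !orbT.
have t3 : r3 <= t by rewrite !le_max lexx !orbT.
have t4 : `|m0| <= t by rewrite !le_max lexx !orbT.
have t0 : 0 <= t by lra.
have tt : - t <= t by lra.
have := iv_sgn aF t4; rewrite (pr_top P) (eq_iv (fun x _ => key x)).
rewrite ivD; [|apply: locintZ; exact: L1_locint|exact: AC_locint aZ].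
rewrite ivZ; last exact: L1_locint.
rewrite -(AC_iv aZ tt).
have := H1 t t1.
have := H2 t; rewrite ger0_norm// => /(_ t2).
have := H2 (- t); rewrite normrN ger0_norm// => /(_ t2).
have := H3 t; rewrite ger0_norm// => /(_ t3).
have := H3 (- t); rewrite normrN ger0_norm// => /(_ t3).
rewrite /Efun; set I := intR _.
by rewrite !ltr_norml ler_norml; lra.
Qed.

End ProfileFacts.

(** * Travel times and the one-sided comparison *)

Section OneSidedComparison.
Variables (R : realType) (A sigma c : R) (phi phi1 phi2 eta : R -> R) (m0 : R).
Hypothesis sigma1 : sigma <= 1.
Hypothesis P : profile A sigma c phi phi1 phi2 eta m0.
Local Notation crit := (crit A).
Local Notation kap := (kap A).
Local Notation g := (gg A sigma c).
Local Notation Mc := (c - crit).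

Definition ode_error (U u1 : R -> R) : R -> R := fun x => u1 x - sgn m0 x * g (U x).

Lemma locint_ode_error (U u1 : R -> R) : AC U u1 -> locint (ode_error U u1).
Proof.
move=> aU; apply: locintB; first exact: AC_locint aU.
apply: locint_sgn; apply: locint_cont; apply: cont_comp; first exact: gg_cont.
exact: AC_continuous aU.
Qed.

Lemma gphi_pos x : x != m0 -> 0 < g (phi x).
Proof.
move=> xm; rewrite /gg mulr_gt0 ?(pr_pos P)// divr_gt0 ?sZ_gt0// sqrtr_gt0.
have := pr_off P xm => h; rewrite WpE; last by lra.
by have := @W_ge _ A (c - phi x); lra.
Qed.

Lemma gphi_ge0 x : 0 <= g (phi x).
Proof.
by rewrite /gg mulr_ge0 ?(ltW (pr_pos P x))// divr_ge0 ?sW_ge0// ltW// sZ_gt0.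
Qed.

Lemma AC_sgn V h a b : AC V h -> a <= b -> b <= m0 \/ m0 <= a ->
  iv a b (fun x => sgn m0 x * h x) = sgn m0 a * (V b - V a).
Proof.
move=> Vh ab H; have lh := AC_locint Vh; have ls := locint_sgn m0 lh.
case: H => H.
  move: ab; rewrite le_eqVlt => /orP[/eqP <-|ab]; first by rewrite ivxx subrr mulr0.
  rewrite (@eq_iv_co _ a b _ h)//; last first.
    by move=> x /andP[_ xb]; rewrite /sgn (lt_le_trans xb H) mul1r.
  by rewrite -(AC_iv Vh (ltW ab)) /sgn (lt_le_trans ab H) mul1r.
rewrite (@eq_iv _ a b _ (fun x => -1 * h x)); last first.
  by move=> x /andP[ax _]; rewrite /sgn ltNge (le_trans H ax).
by rewrite ivZ// -(AC_iv Vh ab) /sgn ltNge H.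
Qed.

(* [\int g/(|g|+gam)] along the profile is almost the elapsed time, since [g] only
   vanishes at the crest. *)
Lemma profile_time (r w : R) : 0 < r -> 0 < w -> exists2 g0, 0 < g0 & forall gam, 0 < gam -> gam <= g0 ->
  iv (m0 - r) (m0 + r) (fun x => gam / (g (phi x) + gam)) <= w.
Proof.
move=> r0 w0.
(* Near the crest the integrand is only known to be at most [1], so a window of radius at most
   [w / 4] is conceded. Outside it [g (phi x) >= a], and [gam <= w a / (4 r)] leaves [w / 4] on each
   side. *)
pose rho := Num.min r (w / 4).
have rho0 : 0 < rho by rewrite lt_min r0 divr_gt0.
have rr : rho <= r by rewrite ge_min lexx.
have rw : rho <= w / 4 by rewrite ge_min lexx orbT.
have cg : continuous (fun x => g (phi x)).
  by apply: cont_comp; [exact: gg_cont|exact: phi_cont P].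
have [x1 x1I H1] := @EVT_min R (fun x => g (phi x)) (m0 - r) (m0 - rho) (ltac:(lra)) (continuous_subspaceT cg).
have [x2 x2I H2] := @EVT_min R (fun x => g (phi x)) (m0 + rho) (m0 + r) (ltac:(lra)) (continuous_subspaceT cg).
pose a := Num.min (g (phi x1)) (g (phi x2)).
have a0 : 0 < a.
  rewrite lt_min !gphi_pos//; apply/eqP => E.
    by move: x2I; rewrite E in_itv /=; lra.
  by move: x1I; rewrite E in_itv /=; lra.
exists (w * a / (4 * r)); first by rewrite divr_gt0 ?mulr_gt0.
move=> gam gam0 gamle.
have cq : continuous (fun x => gam / (g (phi x) + gam)).
  apply: contM; first exact: (@cont_cst R gam).
  apply: contV; first by move=> x; rewrite gt_eqF// ltr_wpDl// gphi_ge0.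
  by apply: contD => //; exact: (@cont_cst R gam).
have lq := locint_cont cq.
have lc k : locint (fun _ : R => k) := locint_cont (@cont_cst R k).
have q1 x : gam / (g (phi x) + gam) <= 1.
  by rewrite ler_pdivrMr ?mul1r ?lerDr ?gphi_ge0// ltr_wpDl// gphi_ge0.
have qa x : a <= g (phi x) -> gam / (g (phi x) + gam) <= w / (4 * r).
  move=> ag; rewrite ler_pdivrMr; last by lra.
  have : gam * (4 * r) <= w * a by rewrite -ler_pdivlMr// mulr_gt0.
  move=> h; rewrite mulrAC ler_pdivlMr ?mulr_gt0//.
  apply: le_trans h _; rewrite ler_wpM2l ?ltW//; lra.
rewrite (@iv_add _ _ (m0 - rho) _ _ _ _ lq); [|lra|lra].
rewrite (@iv_add _ (m0 - rho) (m0 + rho) _ _ _ _ lq); [|lra|lra].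
have b1 : iv (m0 - r) (m0 - rho) (fun x => gam / (g (phi x) + gam)) <= w / (4 * r) * r.
  apply: (@le_trans _ _ (iv (m0 - r) (m0 - rho) (fun=> w / (4 * r)))).
    apply: iv_mono => // x xI; apply: qa; rewrite ge_min; apply/orP; left.
    by apply: H1; rewrite in_itv.
  rewrite iv_cst; last lra.
  by rewrite ler_wpM2l ?divr_ge0 ?mulr_ge0 ?ltW//; lra.
have b2 : iv (m0 - rho) (m0 + rho) (fun x => gam / (g (phi x) + gam)) <= 2 * rho.
  apply: (@le_trans _ _ (iv (m0 - rho) (m0 + rho) (fun=> 1))).
    by apply: iv_mono => // x _; exact: q1.
  by rewrite iv_cst; lra.
have b3 : iv (m0 + rho) (m0 + r) (fun x => gam / (g (phi x) + gam)) <= w / (4 * r) * r.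
  apply: (@le_trans _ _ (iv (m0 + rho) (m0 + r) (fun=> w / (4 * r)))).
    apply: iv_mono => // x xI; apply: qa; rewrite ge_min; apply/orP; right.
    by apply: H2; rewrite in_itv.
  rewrite iv_cst; last lra.
  by rewrite ler_wpM2l ?divr_ge0 ?mulr_ge0 ?ltW//; lra.
have E : w / (4 * r) * r = w / 4 by field; rewrite gt_eqF.
by rewrite E in b1 b3; lra.
Qed.

(* [Psi] measures the time needed to descend along the wave: [U] descends at most about as
   fast as [phi] from about the same crest, so it cannot fall much below [phi]. *)
Lemma one_sided (r nu : R) : 0 < r -> 0 < nu -> exists2 t, 0 < t & forall U u1 : R -> R,
  AC U u1 -> L2 (ode_error U u1) -> intR (fun x => ode_error U u1 x ^+ 2) <= t ^+ 2 ->
  `|U m0 - Mc| <= t -> (forall x, - Mc <= U x <= 2 * Mc) ->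
  forall x, `|x - m0| <= r -> phi x - nu <= U x.
Proof.
move=> r0 nu0.
have cg := @gg_cont R A sigma c.
have Mc0 : 0 < Mc by have := pr_c P; lra.
have [G G0 HG] := continuous_bounded_itv (- Mc) (2 * Mc) cg.
(* Slopes on the relevant range are at most [G], so a delay of [2 w] costs at most
   [2 w (G + 1) = nu / 2] in height. *)
pose w := nu / (4 * (G + 1)).
have w0 : 0 < w by rewrite divr_gt0// mulr_gt0//; lra.
have [g0 g00 Hg] := profile_time r0 w0.
pose gam := Num.min g0 1.
have gam0 : 0 < gam by rewrite lt_min g00 ltr01.
have gam1 : gam <= 1 by rewrite ge_min lexx orbT.
have gamg : gam <= g0 by rewrite ge_min lexx.
(* Makes the total error [gam^-1 * (t * (2 + r))] equal to [w]: a share [1 + r] from the travel time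
   of [U], a share [1] from its crest level. *)
pose t := w * gam / (2 + r).
have r2 : 0 < 2 + r by lra.
have t0 : 0 < t := divr_gt0 (mulr_gt0 w0 gam0) r2.
exists t => // U u1 aU he Ie UM Urange x xr.
rewrite leNgt; apply/negP => Ux.
(* The exact travel time has density [1 / g], singular at the crest and at level [0]; adding [gam]
   removes both singularities. *)
pose gh s := `|g s| + gam.
have gh0 s : 0 < gh s by rewrite ltr_wpDl.
have cgh : continuous (fun s => (gh s)^-1).
  apply: contV; first by move=> s; rewrite gt_eqF.
  by apply: contD; [exact: cont_norm|exact: (@cont_cst R gam)].
have [Psi [dPsi _ IPsi]] := primitive_exists cgh.
have aUP := AC_comp dPsi cgh aU.
have aPP := AC_comp dPsi cgh (phi_AC P).
have [a [b [ab Hab am bm]]] : exists a b, [/\ a <= b,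
    (a = x /\ b = m0) \/ (a = m0 /\ b = x), m0 - r <= a & b <= m0 + r].
  move: xr; rewrite ler_norml => /andP[h1 h2]; have [h|/ltW h] := leP x m0.
    by exists x, m0; split=> //; [left|lra|lra].
  by exists m0, x; split=> //; [right|lra|lra].
have side V h : AC V h -> V m0 - V x = iv a b (fun y => sgn m0 y * h y).
  case: Hab => -[ea eb] Vh; move: ab; rewrite ea eb.
    move=> ab; rewrite (AC_sgn Vh ab) ?lexx; last by left.
    move: ab; rewrite le_eqVlt => /orP[/eqP <-|h']; first by rewrite !subrr mulr0.
    by rewrite /sgn h' mul1r.
  move=> ab; rewrite (AC_sgn Vh ab); last by right.
  by rewrite /sgn ltxx; ring.
have bal : b - a <= r by case: Hab => -[ea eb]; move: am bm; rewrite ea eb; lra.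
have le := locint_ode_error aU.
have lcst k : locint (fun _ : R => k) := locint_cont (@cont_cst R k).
have le2 := L1_locint (L2_sqr he).
have S1 : Psi (U m0) - Psi (U x) <= (b - a) + gam^-1 * (t * (1 + r)).
  rewrite (side _ _ aUP).
  have gV : 0 <= gam^-1 by rewrite invr_ge0 ltW.
  (* The bound [|e| <= e ^ 2 / t + t] turns mean-square smallness of the error into smallness of its
     integral over a bounded interval. *)
  apply: (@le_trans _ _ (iv a b (fun y => 1 + gam^-1 * (t^-1 * ode_error U u1 y ^+ 2 + t)))).
    apply: iv_mono.
    - by apply: locint_sgn; exact: AC_locint aUP.
    - by apply: locintD => //; apply: locintZ; apply: locintD => //; exact: locintZ.
    move=> y _.
    have -> : sgn m0 y * ((gh (U y))^-1 * u1 y) =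
       (sgn m0 y ^+ 2 * g (U y) + sgn m0 y * ode_error U u1 y) / gh (U y).
      by rewrite /ode_error; ring.
    rewrite sgn_sqr mul1r mulrDl; apply: lerD.
      by rewrite ler_pdivrMr// mul1r /gh; have := ler_norm (g (U y)); lra.
    apply: le_trans (ler_norm _) _; rewrite normrM normfV (gtr0_norm (gh0 _)) mulrC.
    apply: ler_pM => //; first by rewrite invr_ge0 ltW.
      by rewrite lef_pV2 ?posrE// /gh lerDr.
    rewrite normrM; apply: (@le_trans _ _ `|ode_error U u1 y|).
      by rewrite ler_piMl// sgn_norm.
    set e := ode_error U u1 y.
    have tV : 0 < t^-1 by rewrite invr_gt0.
    have : 0 <= t^-1 * (`|e| - t) ^+ 2 by rewrite mulr_ge0 ?sqr_ge0// ltW.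
    have -> : t^-1 * (`|e| - t) ^+ 2 = t^-1 * e ^+ 2 + t - 2 * `|e|.
      by rewrite -(real_normK (num_real e)); field; rewrite gt_eqF.
    by have := normr_ge0 e; lra.
  rewrite ivD; [|exact: lcst|by apply: locintZ; apply: locintD => //; exact: locintZ].
  rewrite iv_cst// mul1r lerD2l ivZ; last by apply: locintD => //; exact: locintZ.
  rewrite ler_wpM2l// ivD; [|exact: locintZ|exact: lcst].
  rewrite ivZ// iv_cst//.
  have -> : t * (1 + r) = t + t * r by ring.
  apply: lerD; last by rewrite ler_wpM2l// ltW.
  rewrite ler_pdivrMl// -expr2; apply: le_trans Ie.
  by apply: iv_le_intR; [exact: L2_sqr|move=> y; exact: sqr_ge0].
have S2 : (b - a) - w <= Psi (phi m0) - Psi (phi x).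
  rewrite (side _ _ aPP).
  pose q y := gam / (g (phi y) + gam).
  have gp y : 0 < g (phi y) + gam by rewrite ltr_wpDl// gphi_ge0.
  have cq : continuous q.
    apply: contM; first exact: (@cont_cst R gam).
    apply: contV; first by move=> y; rewrite gt_eqF.
    by apply: contD; [apply: cont_comp => //; exact: phi_cont P|exact: (@cont_cst R gam)].
  have lq := locint_cont cq.
  rewrite (@eq_iv _ _ _ _ (fun y => 1 - q y)); last first.
    move=> y _; rewrite (pr_ode1 P) /gh (ger0_norm (gphi_ge0 y)) /q.
    have := sgn_sqr m0 y => sE.
    have -> : sgn m0 y * ((g (phi y) + gam)^-1 * (sgn m0 y * g (phi y))) =
      sgn m0 y ^+ 2 * (g (phi y) / (g (phi y) + gam)) by ring.
    by rewrite sE mul1r; field; rewrite gt_eqF.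
  rewrite ivB// iv_cst// mul1r lerD2l lerN2.
  apply: le_trans (Hg gam gam0 gamg); apply: iv_sub => // y.
  by rewrite divr_ge0// ltW.
have S3 : Psi (phi m0) - Psi (U m0) <= gam^-1 * t.
  have [h|h] := leP (phi m0) (U m0).
    have : 0 <= Psi (U m0) - Psi (phi m0).
      by rewrite IPsi//; apply: iv_ge0 => s _; rewrite invr_ge0 ltW.
    have : 0 <= gam^-1 * t by rewrite mulr_ge0 ?invr_ge0 ?(ltW gam0) ?(ltW t0).
    by lra.
  rewrite (IPsi _ _ (ltW h)).
  apply: (@le_trans _ _ (iv (U m0) (phi m0) (fun=> gam^-1))).
    apply: iv_mono => //; first exact: locint_cont.
    by move=> s _; rewrite lef_pV2 ?posrE// /gh lerDr.
  rewrite (iv_cst _ (ltW h)) ler_wpM2l ?invr_ge0 ?(ltW gam0)//.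
  by move: UM; rewrite (pr_top P) ler_norml; lra.
have S4 : (phi x - U x) / (G + 1) <= Psi (phi x) - Psi (U x).
  have Uphi : U x <= phi x by lra.
  rewrite IPsi//.
  apply: (@le_trans _ _ (iv (U x) (phi x) (fun=> (G + 1)^-1))).
    by rewrite iv_cst// mulrC.
  apply: iv_mono => //; first exact: locint_cont.
  move=> s /andP[s1 s2].
  have sI : - Mc <= s <= 2 * Mc.
    by have /andP[u1' u2] := Urange x; have := pr_le P x; lra.
  by rewrite lef_pV2 ?posrE ?gh0// ?/gh; [apply: lerD => //; exact: HG|lra].
have S5 : (phi x - U x) / (G + 1) <= w + gam^-1 * (t * (2 + r)).
  apply: le_trans S4 _; have -> : t * (2 + r) = t * (1 + r) + t by ring.
  by rewrite mulrDr; lra.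
have E : gam^-1 * (t * (2 + r)) = w.
  by rewrite /t; field; rewrite !gt_eqF//; lra.
rewrite E in S5.
have : (phi x - U x) <= (w + w) * (G + 1) by rewrite -ler_pdivrMr//; lra.
have -> : (w + w) * (G + 1) = nu / 2 by rewrite /w; field; rewrite gt_eqF//; lra.
by lra.
Qed.

End OneSidedComparison.

(** * From approximate profile equations to closeness in H^1 x L^2 *)

Section Closeness.
Variables (R : realType) (A sigma c : R) (phi phi1 phi2 eta : R -> R) (m0 : R).
Hypothesis sigma1 : sigma <= 1.
Hypothesis P : profile A sigma c phi phi1 phi2 eta m0.
Local Notation crit := (crit A).
Local Notation kap := (kap A).
Local Notation g := (gg A sigma c).
Local Notation Mc := (c - crit).
Local Notation E0 := (Efun phi phi1 eta).
Local Notation F0 := (Ffun A sigma phi phi1 eta).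

Definition dens (u : R) : R := u / (c - u).

Lemma dens_diff (u p : R) : u != c -> p != c ->
  dens u - dens p = c * (u - p) / ((c - u) * (c - p)).
Proof. by move=> uc pc; rewrite /dens; field; rewrite !subr_eq0 eq_sym pc eq_sym uc. Qed.

(** Above [p], the function [u ^ 2 + dens u ^ 2] exceeds its value at [p] by at least [(u - p) ^ 2];
    below [p], the hypothesis confines [u] to a layer of width [nu], where all terms are of order
    [nu]. This is how a one-sided bound becomes coercive. *)
Lemma density_gap_near (u p nu : R) : 0 < p -> p <= Mc -> 0 < nu -> nu <= 1 ->
  u <= Mc + crit / 2 -> p - nu <= u ->
  (u - p) ^+ 2 / 2 - (1 + 2 * Mc + 2 * c * Mc / crit ^+ 3) * nu <=
  (u ^+ 2 + dens u ^+ 2) - (p ^+ 2 + dens p ^+ 2).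
Proof.
move=> p0 pM nu0 nu1 uM pu.
have c0 := crit_gt0 A; have cc := pr_c P.
have Mc0 : 0 < Mc by lra.
have cp : 0 < c - p by lra.
have cu : 0 < c - u by lra.
have c30 : 0 < crit ^+ 3 by rewrite exprn_gt0.
have K0 : 0 <= 2 * c * Mc / crit ^+ 3.
  by apply: divr_ge0; [apply: mulr_ge0; [lra|lra]|lra].
have uc : u != c by rewrite -subr_eq0 -opprB oppr_eq0 gt_eqF.
have pc : p != c by rewrite -subr_eq0 -opprB oppr_eq0 gt_eqF.
have dp0 : 0 <= dens p by rewrite /dens divr_ge0 ?ltW.
have dd := dens_diff uc pc.
have [h|h] := leP p u.
  have : 0 <= dens u - dens p.
    by rewrite dd; apply: divr_ge0; apply: mulr_ge0; lra.
  move=> hd.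
  have h1 : 0 <= (dens u - dens p) * (dens u + dens p) by apply: mulr_ge0; lra.
  have h2 : 0 <= p * (u - p) by apply: mulr_ge0; lra.
  have h3 : 0 <= (1 + 2 * Mc + 2 * c * Mc / crit ^+ 3) * nu by apply: mulr_ge0; lra.
  by have := sqr_ge0 (u - p); lra.
have dn : (u - p) ^+ 2 / 2 <= nu.
  have : (p - u) * (p - u) <= nu * 1 by apply: ler_pM; lra.
  by lra.
have t1 : p ^+ 2 - u ^+ 2 <= 2 * Mc * nu.
  have -> : p ^+ 2 - u ^+ 2 = (p - u) * (p + u) by ring.
  apply: (@le_trans _ _ ((p - u) * (2 * Mc))); first by rewrite ler_wpM2l; lra.
  by rewrite mulrC ler_wpM2l; lra.
have t2 : dens p ^+ 2 - dens u ^+ 2 <= 2 * c * Mc / crit ^+ 3 * nu.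
  have -> : dens p ^+ 2 - dens u ^+ 2 = (dens p - dens u) * (dens p + dens u) by ring.
  have d1 : 0 <= dens p - dens u.
    have -> : dens p - dens u = c * (p - u) / ((c - u) * (c - p)).
      by rewrite -opprB dd -mulNr; congr (_ / _); ring.
    by apply: divr_ge0; apply: mulr_ge0; lra.
  have d2 : dens p - dens u <= c * nu / crit ^+ 2.
    have -> : dens p - dens u = c * (p - u) / ((c - u) * (c - p)).
      by rewrite -opprB dd -mulNr; congr (_ / _); ring.
    apply: ler_pM.
    - by apply: mulr_ge0; lra.
    - by rewrite invr_ge0; apply: mulr_ge0; lra.
    - by rewrite ler_wpM2l; lra.
    - rewrite lef_pV2 ?posrE; [|exact: mulr_gt0|exact: exprn_gt0].
      by rewrite expr2; apply: ler_pM; lra.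
  have d3 : dens p <= Mc / crit.
    rewrite /dens; apply: ler_pM => //; [exact: ltW|by rewrite invr_ge0 ltW|].
    by rewrite lef_pV2 ?posrE//; lra.
  apply: (@le_trans _ _ ((dens p - dens u) * (2 * (Mc / crit)))).
    by rewrite ler_wpM2l//; lra.
  have -> : 2 * c * Mc / crit ^+ 3 * nu = c * nu / crit ^+ 2 * (2 * (Mc / crit)).
    by field; rewrite gt_eqF.
  rewrite ler_wpM2r//; apply: mulr_ge0 => //; apply: divr_ge0; lra.
by lra.
Qed.

Lemma density_gap_far (u p : R) : 0 < p -> p <= Mc ->
  (u - p) ^+ 2 / 2 - (2 + crit^-1 ^+ 2) * p ^+ 2 <=
  (u ^+ 2 + dens u ^+ 2) - (p ^+ 2 + dens p ^+ 2).
Proof.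
move=> p0 pM; have c0 := crit_gt0 A.
have : dens p ^+ 2 <= crit^-1 ^+ 2 * p ^+ 2.
  rewrite /dens exprMn mulrC ler_wpM2r ?sqr_ge0// ler_sqr ?nnegrE ?invr_ge0; try lra.
  by rewrite lef_pV2 ?posrE//; lra.
by have := sqr_ge0 (dens u); have := sqr_ge0 (u + p); lra.
Qed.

(** [[- Mc, 2 Mc]] is a fixed compact range on which the slope function is bounded; the last bound
    keeps [c - U >= crit / 2], so that [dens (U x)] stays under control. *)
Definition admissible (U u1 v : R -> R) : Prop :=
  [/\ AC U u1, L2 U, L2 u1, L2 v &
     forall x, [/\ - Mc <= U x, U x <= 2 * Mc & U x <= Mc + crit / 2]].

Definition near_wave (t : R) (U u1 v : R -> R) : Prop :=
  [/\ intR (fun x => ode_error A sigma c m0 U u1 x ^+ 2) <= t ^+ 2,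
      intR (fun x => (v x - dens (U x)) ^+ 2) <= t ^+ 2,
      `|U m0 - Mc| <= t & `|Efun U u1 v - E0| <= t].

Lemma ode_error_L2 U u1 v : admissible U u1 v -> L2 (ode_error A sigma c m0 U u1).
Proof.
move=> [aU hU h1 hv Ur]; apply: L2B => //.
have cU := AC_continuous aU; have dU := sobolev_decay aU hU h1.
have [M M0 UM] := continuous_decay_bounded cU dU.
have [C C0 H] := continuous_bounded_itv (- M) M
  (contM (@sW_cont R A c) (@sZV_cont R A sigma c)).
apply: L2_mulb (@sgn_measurable R m0) (@sgn_norm R m0) _.
apply: (L2_comp_lin (C := C)) => //; first exact: gg_cont.
move=> x; rewrite /gg normrM mulrC ler_wpM2r//.
by apply: H; rewrite -ler_norml.
Qed.

Lemma dens_L2 U u1 v : admissible U u1 v -> L2 (fun x => dens (U x)).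
Proof.
move=> [aU hU h1 hv Ur]; have cU := AC_continuous aU; have c0 := crit_gt0 A.
have y0 x : crit / 2 <= c - U x by case: (Ur x); lra.
have yp x : 0 < c - U x by have := y0 x; lra.
apply: (eq_L2 _ (L2_mulb (M := (crit / 2)^-1) _ _ hU)) => [x||x]; first by rewrite mulrC.
  apply: continuous_measurable_fun; apply: contV.
    by move=> x; rewrite gt_eqF.
  by apply: contD; [exact: (@cont_cst R c)|exact: contN].
by rewrite gtr0_norm ?invr_gt0// lef_pV2 ?posrE//; lra.
Qed.

Lemma E0_ge0 : 0 <= E0.
Proof.
apply: divr_ge0 => //; apply: intR_ge0 => x.
by rewrite !addr_ge0 ?sqr_ge0.
Qed.

Lemma norm_le_energy (U u1 v : R -> R) (f : R -> R) : L2 U -> L2 u1 -> L2 v -> L1 f ->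
  (forall x, f x <= U x ^+ 2 + u1 x ^+ 2 + v x ^+ 2) -> intR f <= 2 * Efun U u1 v.
Proof.
move=> hU h1 hv hf H; have -> : 2 * Efun U u1 v = intR (fun x => U x ^+ 2 + u1 x ^+ 2 + v x ^+ 2).
  by rewrite /Efun; field.
by apply: intR_mono => //; exact: L1_energy.
Qed.

(** With [F] a primitive of [g], [\int u1 ^ 2 = 2 F (U m0) + \int u1 * ode_error]: up to the error
    term the gradient norm depends on the crest level alone, and for the wave there is no error
    term. *)
Lemma slope_norm : exists2 K, 0 < K & forall t U u1 v, 0 < t -> t <= 1 ->
  admissible U u1 v -> near_wave t U u1 v ->
  `|intR (fun x => u1 x ^+ 2) - intR (fun x => phi1 x ^+ 2)| <= K * t.
Proof.
have c0 := crit_gt0 A; have cc := pr_c P; have Mc0 : 0 < Mc by lra.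
have cg := @gg_cont R A sigma c.
have [G G0 HG] := continuous_bounded_itv (- Mc) (2 * Mc) cg.
have [F [dF F0' Fi]] := primitive_exists cg.
have cF x : {for x, continuous F} by exact: der_continuous (dF x).
(* Bounds the integral of [u1 ^ 2]; being at least [1], it is also below [L ^ 2], the form the
   Cauchy-Schwarz bound asks for. *)
pose L := 2 * E0 + 2 + 1.
have E00 := E0_ge0.
have L0 : 0 < L by rewrite /L; lra.
exists (2 * G + L) => [|t U u1 v t0 t1 adm near]; first lra.
have he := ode_error_L2 adm.
case: adm => aU hU h1 hv Ur; case: near => Ie In IM IE.
have calib V v1 : AC V v1 -> L2 V -> L2 v1 -> L1 (fun x => g (V x) * v1 x) ->
    intR (fun x => sgn m0 x * (g (V x) * v1 x)) = 2 * F (V m0).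
  move=> aV hV hv1 ig.
  have aF := AC_comp dF cg aV.
  exact: (int_sgn m0 aF ig (decay_comp (sobolev_decay aV hV hv1) cF F0')).
have Ephi : intR (fun x => phi1 x ^+ 2) = 2 * F Mc.
  rewrite -(pr_top P) -(calib phi phi1 (phi_AC P) (pr_L2 P) (phi1_L2 P)).
    by apply: eq_intR => x; rewrite expr2 {1}(pr_ode1 P); ring.
  apply: L2M (phi1_L2 P); have [K _ HK] := phi1_le P.
  apply: (L2_comp_lin (C := K)) => //; first exact: pr_L2 P.
  move=> x; apply: le_trans (HK x); rewrite (pr_ode1 P) (normrM (sgn m0 x)).
  by rewrite /sgn; case: ifP => _; rewrite ?normrN1 ?normr1 mul1r.
have ig : L2 (fun x => g (U x)).
  have := L2_mulb (@sgn_measurable R m0) (@sgn_norm R m0) (L2B h1 he).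
  apply: eq_L2 => x; rewrite /ode_error; have := sgn_sqr m0 x => sE.
  have -> : sgn m0 x * (u1 x - (u1 x - sgn m0 x * g (U x))) = sgn m0 x ^+ 2 * g (U x) by ring.
  by rewrite sE mul1r.
have EU : intR (fun x => u1 x ^+ 2) = 2 * F (U m0) + intR (fun x => u1 x * ode_error A sigma c m0 U u1 x).
  rewrite -(calib U u1 aU hU h1); last exact: L2M.
  rewrite -intR_D; [|exact: L1_mulb (@sgn_measurable R m0) (@sgn_norm R m0) (L2M ig h1)|exact: L2M].
  by apply: eq_intR => x; rewrite /ode_error; ring.
rewrite Ephi EU.
have B1 : `|F (U m0) - F Mc| <= G * t.
  have [r1 r2 _] := Ur m0.
  have lip a b : - Mc <= a -> a <= b -> b <= 2 * Mc -> `|F b - F a| <= G * (b - a).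
    move=> a1 ab b1; rewrite Fi// -(iv_cst G ab).
    apply: le_trans (iv_le_norm _ _ (locint_cont cg)) _.
    apply: iv_mono; [exact: locint_norm (locint_cont cg)|exact: locint_cont (@cont_cst R G)|].
    by move=> x /andP[x1 x2]; apply: HG; rewrite (le_trans a1 x1) (le_trans x2 b1).
  move: IM; rewrite ler_norml => /andP[m1 m2].
  have [h|/ltW h] := leP (U m0) Mc.
    rewrite distrC; apply: le_trans (lip _ _ r1 h _) _; first lra.
    by rewrite ler_wpM2l ?(ltW G0)//; lra.
  apply: le_trans (lip _ _ _ h r2) _; first lra.
  by rewrite ler_wpM2l ?(ltW G0)//; lra.
have B2 : `|intR (fun x => u1 x * ode_error A sigma c m0 U u1 x)| <= L * t.
  apply: cauchy_schwarz_le => //; [exact: ltW|exact: ltW|].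
  apply: (@le_trans _ _ (2 * Efun U u1 v)).
    apply: norm_le_energy => //; first exact: L2_sqr.
    by move=> x; have := sqr_ge0 (U x); have := sqr_ge0 (v x); lra.
  have : L * 1 <= L * L by rewrite ler_wpM2l ?(ltW L0)// /L; lra.
  by move: IE; rewrite ler_norml -expr2 /L; lra.
by move: B1 B2; rewrite !ler_norml; lra.
Qed.

(** With [n = v - dens U], the integrands differ by [2 v n - n ^ 2]. *)
Lemma density_norm : exists2 K, 0 < K & forall t U u1 v, 0 < t -> t <= 1 ->
  admissible U u1 v -> near_wave t U u1 v ->
  `|intR (fun x => v x ^+ 2) - intR (fun x => dens (U x) ^+ 2)| <= K * t.
Proof.
have E00 := E0_ge0.
pose L := 2 * E0 + 2 + 1.
have L0 : 0 < L by rewrite /L; lra.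
exists (2 * L + 1) => [|t U u1 v t0 t1 adm near]; first lra.
have hd := dens_L2 adm.
case: adm => aU hU h1 hv Ur; case: near => Ie In IM IE.
pose n x := v x - dens (U x).
have hn : L2 n by exact: L2B.
have -> : intR (fun x => v x ^+ 2) - intR (fun x => dens (U x) ^+ 2) =
    2 * intR (fun x => v x * n x) - intR (fun x => n x ^+ 2).
  rewrite -intR_Z; last exact: L2M.
  rewrite -!intR_B; try solve [exact: L2_sqr|by apply: L1Z; exact: L2M].
  by apply: eq_intR => x; rewrite /n; ring.
have B : `|intR (fun x => v x * n x)| <= L * t.
  apply: cauchy_schwarz_le => //; [exact: ltW|exact: ltW|].
  apply: (@le_trans _ _ (2 * Efun U u1 v)).
    apply: norm_le_energy => //; first exact: L2_sqr.
    by move=> x; have := sqr_ge0 (U x); have := sqr_ge0 (u1 x); lra.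
  have : L * 1 <= L * L by rewrite ler_wpM2l ?(ltW L0)// /L; lra.
  by move: IE; rewrite ler_norml -expr2 /L; lra.
have n0 : 0 <= intR (fun x => n x ^+ 2) by apply: intR_ge0 => x; exact: sqr_ge0.
have tt : t ^+ 2 <= t by rewrite expr2; rewrite -[X in _ <= X]mulr1 ler_wpM2l ?(ltW t0).
move: B In; rewrite -/n !ler_norml => /andP[b1 b2] In.
by apply/andP; split; rewrite mulrDl mul1r; lra.
Qed.

(** The gradient and density parts of the energy match those of the wave up to [O(t)], so closeness
    of the energies passes to the part that depends on the level of [U] only. The matching lower
    bounds are [density_gap_near] and [density_gap_far]. *)
Lemma level_norm : exists2 K, 0 < K & forall t U u1 v, 0 < t -> t <= 1 ->
  admissible U u1 v -> near_wave t U u1 v ->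
  intR (fun x => (U x ^+ 2 + dens (U x) ^+ 2) - (phi x ^+ 2 + dens (phi x) ^+ 2)) <= K * t.
Proof.
have [K1 K10 H1] := slope_norm; have [K2 K20 H2] := density_norm.
exists (2 + K1 + K2) => [|t U u1 v t0 t1 adm near]; first lra.
have B1 := H1 t U u1 v t0 t1 adm near; have B2 := H2 t U u1 v t0 t1 adm near.
have hd := dens_L2 adm.
case: adm => aU hU h1 hv Ur; case: near => _ _ _ IE.
have hp := pr_L2 P; have hp1 := phi1_L2 P; have he := eta_L2 P.
have Ee : intR (fun x => eta x ^+ 2) = intR (fun x => dens (phi x) ^+ 2).
  by apply: eq_intR => x; rewrite (pr_eta P).
have hdp : L2 (fun x => dens (phi x)).
  by apply: (eq_L2 _ he) => x; rewrite (pr_eta P).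
have i1 := L2_sqr hU; have i2 := L2_sqr h1; have i3 := L2_sqr hv.
have j1 := L2_sqr hp; have j2 := L2_sqr hp1; have j3 := L2_sqr he.
have d1 := L2_sqr hd; have d2 := L2_sqr hdp.
rewrite intR_B ?intR_D//; try exact: L1D.
have EU : 2 * Efun U u1 v = intR (fun x => U x ^+ 2) + intR (fun x => u1 x ^+ 2) + intR (fun x => v x ^+ 2).
  by rewrite /Efun !intR_D//; [field|exact: L1D].
have EP : 2 * E0 = intR (fun x => phi x ^+ 2) + intR (fun x => phi1 x ^+ 2) + intR (fun x => eta x ^+ 2).
  by rewrite /Efun !intR_D//; [field|exact: L1D].
rewrite Ee in EP.
by move: B1 B2 IE; rewrite !ler_norml => /andP[? ?] /andP[? ?] /andP[? ?]; rewrite !mulrDl; lra.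
Qed.

Lemma level_close (lam : R) : 0 < lam -> exists2 t, 0 < t <= 1 & forall s U u1 v,
  0 < s -> s <= t -> admissible U u1 v -> near_wave s U u1 v ->
  intR (fun x => (U x - phi x) ^+ 2) <= lam ^+ 2.
Proof.
move=> lam0; have l2 : 0 < lam ^+ 2 by exact: exprn_gt0.
have [K K0 HK] := level_norm.
have hp := pr_L2 P; have ip := L2_sqr hp.
pose C2 := 2 + crit^-1 ^+ 2.
have C20 : 0 < C2 by rewrite /C2; have := sqr_ge0 crit^-1; lra.
(* Half of the integral of [(U - phi) ^ 2] will be bounded by three errors of at most [lam ^ 2 / 8]
   each: the tail of the wave, the layer of width [nu], and the mismatch of the norms. *)
have [r r0 Hr] := tail_int ip (fun x => sqr_ge0 (phi x)) (divr_gt0 l2 (mulr_gt0 (ltr0n _ 8 : 0 < 8%:R) C20)).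
pose C1 := 1 + 2 * Mc + 2 * c * Mc / crit ^+ 3.
have c0 := crit_gt0 A; have cc := pr_c P.
have C10 : 0 < C1.
  have : 0 <= 2 * c * Mc / crit ^+ 3.
    by apply: divr_ge0; [apply: mulr_ge0; lra|apply: ltW; exact: exprn_gt0].
  by rewrite /C1; lra.
pose nu := Num.min 1 (lam ^+ 2 / (16 * r * C1)).
have rC0 : 0 < 16 * r * C1 by rewrite !mulr_gt0.
have nu0 : 0 < nu by rewrite lt_min ltr01 divr_gt0.
have nu1 : nu <= 1 by rewrite ge_min lexx.
have nul : nu <= lam ^+ 2 / (16 * r * C1) by rewrite ge_min lexx orbT.
(* The comparison is centred at the crest [m0], the tail estimate at [0]; this radius covers
   [[- r, r]]. *)
have R0 : 0 < r + `|m0| by have := normr_ge0 m0; lra.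
have [t1 t10 Hone] := one_sided P R0 nu0.
pose t := Num.min (Num.min t1 1) (lam ^+ 2 / (8 * K)).
have t0 : 0 < t by rewrite !lt_min t10 ltr01 divr_gt0// mulr_gt0.
have tt1 : t <= t1 by rewrite !ge_min lexx.
have tle1 : t <= 1 by rewrite !ge_min lexx !orbT.
have tK : t <= lam ^+ 2 / (8 * K) by rewrite !ge_min lexx !orbT.
exists t => [|s U u1 v s0 st adm near]; first by rewrite t0.
have s1 : s <= 1 by exact: le_trans tle1.
have L := HK s U u1 v s0 s1 adm near.
have he := ode_error_L2 adm; have hd := dens_L2 adm.
case: adm => aU hU h1 hv Ur; case: near => Ie In IM IE.
have low x : `|x| <= r -> phi x - nu <= U x.
  move=> xr; apply: (Hone U u1 aU he).
  - by apply: le_trans Ie _; rewrite ler_sqr ?nnegrE ?(ltW s0) ?(ltW t10)// (le_trans st).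
  - by apply: le_trans IM (le_trans st tt1).
  - by move=> y; case: (Ur y) => -> -> _.
  - by apply: le_trans (ler_normB _ _) _; rewrite lerD2r.
have hD := L2B hU hp; have iD := L2_sqr hD.
have hdp : L2 (fun x => dens (phi x)).
  by apply: (eq_L2 _ (eta_L2 P)) => x; rewrite (pr_eta P).
pose ind x := \1_(`[- r, r]%classic) x : R.
have iind : L1 ind by exact: L1_1itv.
have ipind : L1 (fun x => ind x * phi x ^+ 2) by apply/L1_indic; exact: L1_locint.
have iq : L1 (fun x => (U x ^+ 2 + dens (U x) ^+ 2) - (phi x ^+ 2 + dens (phi x) ^+ 2)).
  by apply: L1B; apply: L1D; exact: L2_sqr.
have pw x : 1 / 2 * (U x - phi x) ^+ 2 <=
   ((U x ^+ 2 + dens (U x) ^+ 2) - (phi x ^+ 2 + dens (phi x) ^+ 2)) +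
   C1 * nu * ind x + C2 * (phi x ^+ 2 - ind x * phi x ^+ 2).
  have p0 := pr_pos P x; have pM := pr_le P x; have [_ _ uM] := Ur x.
  rewrite /ind indicE; have [xI|xI] := boolP (x \in _) => /=.
    have xr : `|x| <= r by move: xI; rewrite inE /= in_itv /= ler_norml.
    have := density_gap_near p0 pM nu0 nu1 uM (low x xr).
    by rewrite -/C1; clear; lra.
  have := density_gap_far (U x) p0 pM; rewrite -/C2.
  by clear; lra.
have i3 : L1 (fun x => C1 * nu * ind x) by exact: L1Z.
have i4 : L1 (fun x => phi x ^+ 2 - ind x * phi x ^+ 2) by exact: L1B.
have i5 := L1Z C2 i4.
have := intR_mono (L1Z (1 / 2) iD) (L1D (L1D iq i3) i5) pw.
have rr : - r <= r by lra.
rewrite intR_Z// intR_D//; last exact: L1D.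
have q1 : intR (fun x => C1 * nu * ind x) = C1 * nu * (r - - r).
  by rewrite intR_Z// (int_1itv rr).
have q2 : intR (fun x => C2 * (phi x ^+ 2 - ind x * phi x ^+ 2)) =
    C2 * (intR (fun x => phi x ^+ 2) - iv (- r) r (fun x => phi x ^+ 2)).
  rewrite intR_Z// intR_B//; congr (_ * (_ - _)); exact: int_indic.
rewrite (intR_D iq i3) q1 q2.
have T := Hr r (lexx _).
have T2 : C2 * (intR (fun x => phi x ^+ 2) - iv (- r) r (fun x => phi x ^+ 2)) <= lam ^+ 2 / 8.
  have -> : lam ^+ 2 / 8 = C2 * (lam ^+ 2 / (8 * C2)) by field; rewrite gt_eqF.
  by rewrite ler_wpM2l ?(ltW C20)// ltW.
have T3 : C1 * nu * (r - - r) <= lam ^+ 2 / 8.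
  have -> : C1 * nu * (r - - r) = nu * (2 * r * C1) by ring.
  apply: (@le_trans _ _ (lam ^+ 2 / (16 * r * C1) * (2 * r * C1))).
    by rewrite ler_wpM2r// !mulr_ge0// ltW.
  by rewrite le_eqVlt; apply/orP; left; apply/eqP; field; rewrite !gt_eqF.
have T4 : K * s <= lam ^+ 2 / 8.
  have -> : lam ^+ 2 / 8 = K * (lam ^+ 2 / (8 * K)) by field; rewrite gt_eqF.
  by rewrite ler_wpM2l ?(ltW K0)// (le_trans st tK).
by clear -L T2 T3 T4 l2; lra.
Qed.

Lemma dens_lip (u p : R) : u <= Mc + crit / 2 -> p <= Mc ->
  (dens u - dens p) ^+ 2 <= (2 * c / crit ^+ 2) ^+ 2 * (u - p) ^+ 2.
Proof.
move=> uM pM; have c0 := crit_gt0 A; have cc := pr_c P.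
have cu : crit / 2 <= c - u by lra.
have cp : crit <= c - p by lra.
have cu0 : 0 < c - u by lra.
have cp0 : 0 < c - p by lra.
have c1 : 0 < crit / 2 by lra.
have cp1 : 0 < c by lra.
rewrite dens_diff; [|by rewrite -subr_eq0 -opprB oppr_eq0 gt_eqF..].
have -> : c * (u - p) / ((c - u) * (c - p)) = c / ((c - u) * (c - p)) * (u - p) by ring.
rewrite exprMn ler_wpM2r ?sqr_ge0//.
have q0 : 0 < (c - u) * (c - p) by exact: mulr_gt0.
have -> : 2 * c / crit ^+ 2 = c / (crit / 2 * crit) by field; rewrite gt_eqF.
have q1 : 0 < crit / 2 * crit by exact: mulr_gt0.
rewrite ler_sqr ?nnegrE ?divr_ge0 ?(ltW cp1) ?(ltW q0) ?(ltW q1)//.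
rewrite ler_pM2l// lef_pV2 ?posrE//.
by apply: ler_pM => //; exact: ltW.
Qed.

(** Closeness of [U] in L^2 passes to the slope because the norms of [u1] and [phi1] are close,
    while the product of [u1 - phi1] with [phi1] is moved by parts onto [(U - phi) * phi2]. The
    density follows from the Lipschitz bound on [dens]. *)
Lemma wave_close (eps : R) : 0 < eps -> exists2 t, 0 < t & forall U u1 v,
  admissible U u1 v -> near_wave t U u1 v ->
  intR (fun x => (U x - phi x) ^+ 2 + (u1 x - phi1 x) ^+ 2 + (v x - eta x) ^+ 2) < eps ^+ 2.
Proof.
move=> eps0; have e2 : 0 < eps ^+ 2 by exact: exprn_gt0.
have c0 := crit_gt0 A; have cc := pr_c P.
have hp := pr_L2 P; have hp1 := phi1_L2 P; have hp2 := phi2_L2 sigma1 P.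
have [K K0 HK] := slope_norm.
pose N := intR (fun x => phi2 x ^+ 2) + 1.
have N0 : 0 <= intR (fun x => phi2 x ^+ 2) by apply: intR_ge0 => x; exact: sqr_ge0.
have N1 : 1 <= N by rewrite /N; lra.
have NN : intR (fun x => phi2 x ^+ 2) <= N ^+ 2.
  by apply: (@le_trans _ _ N); [rewrite /N; lra|rewrite expr2 ler_peMl//; lra].
pose C3 := (2 * c / crit ^+ 2) ^+ 2.
have C30 : 0 <= C3 by exact: sqr_ge0.
(* The three parts add up to at most [lam (1 + 2 N + 2 C3) + t (K + 2)]; each of the two products is
   made at most [eps ^ 2 / 4]. *)
pose lam := Num.min 1 (eps ^+ 2 / (4 * (1 + 2 * N + 2 * C3))).
have B0 : 0 < 4 * (1 + 2 * N + 2 * C3) by lra.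
have lam0 : 0 < lam by rewrite lt_min ltr01 divr_gt0.
have lam1 : lam <= 1 by rewrite ge_min lexx.
have lamB : lam * (4 * (1 + 2 * N + 2 * C3)) <= eps ^+ 2.
  by rewrite -ler_pdivlMr// ge_min lexx orbT.
have [t1 /andP[t10 t11] Hc] := level_close lam0.
pose t := Num.min t1 (eps ^+ 2 / (4 * (K + 2))).
have BK : 0 < 4 * (K + 2) by lra.
have t0 : 0 < t by rewrite lt_min t10 divr_gt0.
have tt1 : t <= t1 by rewrite ge_min lexx.
have t1' : t <= 1 by lra.
have tB : t * (4 * (K + 2)) <= eps ^+ 2.
  by rewrite -ler_pdivlMr// ge_min lexx orbT.
exists t => // U u1 v adm near.
have D := Hc t U u1 v t0 tt1 adm near.
have S := HK t U u1 v t0 t1' adm near.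
have hd := dens_L2 adm.
case: adm => aU hU h1 hv Ur; case: near => Ie In IM IE.
have hD := L2B hU hp; have h1p := L2B h1 hp1.
have hdp : L2 (fun x => dens (phi x)).
  by apply: (eq_L2 _ (eta_L2 P)) => x; rewrite (pr_eta P).
have lam2 : lam ^+ 2 <= lam by rewrite expr2 ler_piMl// ltW.
have t2 : t ^+ 2 <= t by rewrite expr2 ler_piMl// ltW.
rewrite intR_D; [|by apply: L1D; exact: L2_sqr|by apply: L2_sqr; apply: L2B => //; exact: eta_L2 P].
rewrite intR_D; [|exact: L2_sqr|exact: L2_sqr].
have slope : intR (fun x => (u1 x - phi1 x) ^+ 2) <= K * t + 2 * (lam * N).
  have aP := AC_M (AC_B aU (phi_AC P)) (phi1_AC P).
  have T : intR (fun x => (u1 x - phi1 x) * phi1 x) = - intR (fun x => (U x - phi x) * phi2 x).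
    apply/eqP; rewrite -addr_eq0 -intR_D; [|exact: L2M|exact: L2M].
    apply/eqP; apply: (int_total aP); first by apply: L1D; exact: L2M.
    have [C _ HC] := continuous_decay_bounded (phi1_cont P) (phi1_decay P).
    apply: (decay_le (C := C) (sobolev_decay (AC_B aU (phi_AC P)) hD h1p)) => x.
    by rewrite normrM mulrC ler_wpM2r.
  have -> : intR (fun x => (u1 x - phi1 x) ^+ 2) = (intR (fun x => u1 x ^+ 2) -
     intR (fun x => phi1 x ^+ 2)) - 2 * intR (fun x => (u1 x - phi1 x) * phi1 x).
    rewrite -intR_B; [|exact: L2_sqr|exact: L2_sqr].
    rewrite -intR_Z; last exact: L2M.
    rewrite -intR_B; [|by apply: L1B; exact: L2_sqr|by apply: L1Z; exact: L2M].
    by apply: eq_intR => x; ring.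
  rewrite T.
  have CS : `|intR (fun x => (U x - phi x) * phi2 x)| <= lam * N.
    by apply: cauchy_schwarz_le => //; [exact: ltW|exact: le_trans N1].
  by move: S CS; rewrite !ler_norml => /andP[? ?] /andP[? ?]; lra.
have density : intR (fun x => (v x - eta x) ^+ 2) <= 2 * t ^+ 2 + 2 * (C3 * lam ^+ 2).
  have i1 := L2_sqr (L2B hv hd); have i2 := L2_sqr hD.
  apply: (@le_trans _ _ (intR (fun x => 2 * (v x - dens (U x)) ^+ 2 + 2 * (C3 * (U x - phi x) ^+ 2)))).
    apply: intR_mono.
    - by apply: L2_sqr; apply: L2B => //; exact: eta_L2 P.
    - by apply: L1D; apply: L1Z => //; exact: L1Z.
    move=> x; have [_ _ uM] := Ur x; have pM := pr_le P x.
    rewrite (pr_eta P) -/(dens (phi x)).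
    have := dens_lip uM pM; rewrite -/C3.
    move=> h; have := sqr_ge0 ((v x - dens (U x)) - (dens (U x) - dens (phi x))).
    by lra.
  rewrite intR_D; [|exact: L1Z|by apply: L1Z; exact: L1Z].
  rewrite !intR_Z//; last exact: L1Z.
  have : C3 * intR (fun x => (U x - phi x) ^+ 2) <= C3 * lam ^+ 2 by apply: ler_wpM2l.
  by move: In; clear; lra.
have C3l : C3 * lam ^+ 2 <= C3 * lam by rewrite ler_wpM2l.
clear -D slope density C3l lam2 t2 tB lamB t0 lam0 e2.
by clearbody N C3 lam t; lra.
Qed.

End Closeness.

(** * From the conserved quantities to the profile equations *)

Section Core.
Variables (R : realType) (A sigma c : R) (phi phi1 phi2 eta : R -> R) (m0 : R).
Hypothesis sigma1 : sigma <= 1.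
Hypothesis P : profile A sigma c phi phi1 phi2 eta m0.
Local Notation crit := (crit A).
Local Notation kap := (kap A).
Local Notation g := (gg A sigma c).
Local Notation Mc := (c - crit).
Local Notation E0 := (Efun phi phi1 eta).
Local Notation F0 := (Ffun A sigma phi phi1 eta).

(** The value of the action integral at [c] cancels against [c E0 - F0], and its slope in [h]
    against [h E0]; only differences of conserved quantities remain on the right. *)
Lemma deficit_bound (h : R) (U u1 v : R -> R) : AC U u1 -> L2 U -> L2 u1 -> L2 v ->
  (forall x, kap <= c + h - sigma * U x) -> (forall x, crit <= c + h - U x) ->
  U m0 = Mc + h -> `|h| <= Mc / 4 ->
  intR (slope_defect A sigma (c + h) m0 U u1) + intR (density_defect (c + h) U v)
    + 4 * (gap A c * h ^+ 2) <=
  2 * ((c + h) * (Efun U u1 v - E0) - (Ffun A sigma U u1 v - F0)).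
Proof.
move=> aU hU h1 hv Hz Hy UM hM.
have cc := pr_c P.
have U0 : 0 <= U m0 by rewrite UM; move: hM; rewrite ler_norml; lra.
have [_ _ D] := deficit aU hU h1 hv Hz Hy U0.
have S := speed_convexity sigma1 cc hM.
have PA := profile_action sigma1 P; have PE := profile_energy sigma1 P.
rewrite UM in D.
move: D S PA PE; set I1 := intR _; set I2 := intR _; set J1 := iv _ _ _; set J2 := iv _ _ _.
set J3 := iv _ _ _; set EU := Efun U u1 v; set FU := Ffun _ _ U u1 v.
set e0 := Efun _ _ _; set f0 := Ffun _ _ _ _ _; clear => D S PA PE.
have e1 : h * e0 = 2 * (h * J3) by rewrite PE; ring.
lra.
Qed.

(** Two changes at once: the weighted square is divided by the mobility, which is at least [kap],
    and the reference speed returns from [c + h] to [c] at a cost linear in [|h|] by [gg_speed]. The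
    constant depends on [U] only through [M] and [L]. *)
Lemma slope_error_bound (M L : R) : exists2 C, 0 < C & forall (h : R) (U u1 v : R -> R),
  AC U u1 -> L2 U -> L2 u1 ->
  (forall x, kap <= c + h - sigma * U x) -> (forall x, kap <= c - sigma * U x) ->
  (forall x, `|U x| <= M) -> intR (fun x => U x ^+ 2) <= L ->
  L1 (slope_defect A sigma (c + h) m0 U u1) -> L2 (ode_error A sigma c m0 U u1) ->
  intR (fun x => ode_error A sigma c m0 U u1 x ^+ 2) <=
  C * (intR (slope_defect A sigma (c + h) m0 U u1) + `|h|).
Proof.
have k0 := kap_gt0 A.
have cW : continuous (fun s => Wp A (c - s)).
  apply: cont_comp; first exact: Wp_cont.
  by apply: contD; [exact: (@cont_cst R c)|apply: contN; exact: (@cont_id R)].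
have [Wm Wm0 HW] := continuous_bounded_itv (- M) M cW.
have c2 : 0 < crit ^- 2 by rewrite invr_gt0 exprn_gt0// crit_gt0.
pose C4 := kap^-1 * (1 + crit ^- 2) + Wm / kap ^+ 2.
have C40 : 0 < C4.
  by rewrite /C4 addr_gt0// ?mulr_gt0 ?divr_gt0 ?invr_gt0 ?exprn_gt0// addr_gt0.
have L0 : 0 <= `|L| by exact: normr_ge0.
have kV : 0 < kap^-1 by rewrite invr_gt0.
exists (2 * kap^-1 + 2 * C4 * `|L|).
  by have := mulr_ge0 (ltW C40) L0; lra.
move=> h U u1 v aU hU h1 Hz Hz' UM UL isl he.
set S := slope_defect _ _ _ _ _ _.
have S0 : 0 <= intR S by apply: intR_ge0 => x; exact: sqr_ge0.
have iU := L2_sqr hU.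
apply: (@le_trans _ _ (intR (fun x => 2 * kap^-1 * S x + 2 * C4 * `|h| * U x ^+ 2))).
  apply: intR_mono; [exact: L2_sqr|by apply: L1D; exact: L1Z|] => x.
  pose a := u1 x - sgn m0 x * gg A sigma (c + h) (U x).
  pose b := sgn m0 x * (gg A sigma (c + h) (U x) - g (U x)).
  have -> : ode_error A sigma c m0 U u1 x = a + b by rewrite /ode_error /a /b; ring.
  have Ha : a ^+ 2 <= kap^-1 * S x.
    have -> : S x = ZZ A sigma (c + h) (U x) * a ^+ 2.
      rewrite /S /slope_defect /a /gg -sZ_sqr.
      have p0 : sZ A sigma (c + h) (U x) != 0 by rewrite gt_eqF// sZ_gt0.
      by field.
    rewrite ler_pdivlMl//; apply: ler_wpM2r; [exact: sqr_ge0|exact: ZZ_ge].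
  have Hb : b ^+ 2 <= C4 * `|h| * U x ^+ 2.
    rewrite /b exprMn sgn_sqr mul1r.
    apply: le_trans (gg_speed (Hz' x) (Hz x)) _.
    have -> : c + h - c = h by ring.
    rewrite mulrC ler_wpM2r ?sqr_ge0// ler_wpM2r// /C4 lerD2l ler_wpM2r//.
      by rewrite invr_ge0 exprn_ge0// ltW.
    by apply: le_trans (ler_norm _) _; apply: (HW (U x)); rewrite -ler_norml.
  by have := sqr_ge0 (a - b); lra.
rewrite intR_D ?intR_Z//; [|exact: L1Z|exact: L1Z].
have UL' : intR (fun x => U x ^+ 2) <= `|L| by apply: le_trans UL (ler_norm _).
have h0 : 0 <= `|h| by exact: normr_ge0.
have t1 : C4 * `|h| * intR (fun x => U x ^+ 2) <= C4 * `|h| * `|L|.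
  by apply: ler_wpM2l => //; apply: mulr_ge0 => //; exact: ltW.
have t2 : 0 <= C4 * `|L| * intR S by rewrite mulr_ge0// mulr_ge0// ltW.
have t3 : 0 <= kap^-1 * `|h| by rewrite mulr_ge0// ltW.
by move: t1 t2 t3; clear -sigma1 P; lra.
Qed.

(** As for the slope, with the weight [c + h - U >= crit] in place of the mobility. The change of
    speed costs [U * h] up to a bounded factor, and [|h| <= 1] lets [|h|] replace [h ^ 2]. *)
Lemma density_error_bound (L : R) : exists2 C, 0 < C & forall (h : R) (U v : R -> R),
  L2 U -> L2 v -> (forall x, crit <= c + h - U x) -> (forall x, crit / 2 <= c - U x) ->
  `|h| <= 1 -> intR (fun x => U x ^+ 2) <= L ->
  L1 (density_defect (c + h) U v) -> L2 (fun x => dens c (U x)) ->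
  intR (fun x => (v x - dens c (U x)) ^+ 2) <=
  C * (intR (density_defect (c + h) U v) + `|h|).
Proof.
have c0 := crit_gt0 A.
have cV : 0 < crit^-1 by rewrite invr_gt0.
pose C5 := (2 / crit ^+ 2) ^+ 2.
have C50 : 0 < C5 by rewrite exprn_gt0// divr_gt0// exprn_gt0.
have L0 : 0 <= `|L| by exact: normr_ge0.
exists (2 * crit^-1 + 2 * C5 * `|L|).
  by have := mulr_ge0 (ltW C50) L0; lra.
move=> h U v hU hv Hy Hy' hh UL id_ hd.
set S := density_defect _ _ _.
have yp x : 0 < c + h - U x by apply: lt_le_trans (Hy x).
have yp' x : 0 < c - U x by have := Hy' x; lra.
have S0 : 0 <= intR S.
  by apply: intR_ge0 => x; apply: mulr_ge0; [exact: ltW|exact: sqr_ge0].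
have iU := L2_sqr hU.
apply: (@le_trans _ _ (intR (fun x => 2 * crit^-1 * S x + 2 * C5 * `|h| * U x ^+ 2))).
  apply: intR_mono; [by apply: L2_sqr; exact: L2B|by apply: L1D; exact: L1Z|] => x.
  pose a := v x - U x / (c + h - U x).
  pose b := U x * (- h / ((c + h - U x) * (c - U x))).
  have -> : v x - dens c (U x) = a + b.
    by rewrite /dens /a /b; field; rewrite !gt_eqF.
  have Ha : a ^+ 2 <= crit^-1 * S x.
    rewrite /S /density_defect -/a ler_pdivlMl//; apply: ler_wpM2r; [exact: sqr_ge0|exact: Hy].
  have Hb : b ^+ 2 <= C5 * `|h| * U x ^+ 2.
    rewrite /b exprMn mulrC ler_wpM2r ?sqr_ge0//.
    have q0 : 0 < (c + h - U x) * (c - U x) by exact: mulr_gt0.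
    have -> : (- h / ((c + h - U x) * (c - U x))) ^+ 2 = ((c + h - U x) * (c - U x))^-1 ^+ 2 * `|h| ^+ 2.
      by rewrite real_normK ?num_real//; field; rewrite !gt_eqF.
    apply: ler_pM; [exact: sqr_ge0|exact: sqr_ge0| |].
      rewrite /C5 ler_sqr ?nnegrE ?invr_ge0 ?(ltW q0)//; last first.
        by rewrite divr_ge0// exprn_ge0// ltW.
      have -> : 2 / crit ^+ 2 = (crit * (crit / 2))^-1 by field; rewrite gt_eqF.
      rewrite lef_pV2 ?posrE//; last by apply: mulr_gt0; lra.
      by apply: ler_pM; [lra|lra|exact: Hy|exact: Hy'].
    by rewrite expr2 ler_piMl.
  by have := sqr_ge0 (a - b); lra.
rewrite intR_D ?intR_Z//; [|exact: L1Z|exact: L1Z].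
have UL' : intR (fun x => U x ^+ 2) <= `|L| by apply: le_trans UL (ler_norm _).
have h0 : 0 <= `|h| by exact: normr_ge0.
have t1 : C5 * `|h| * intR (fun x => U x ^+ 2) <= C5 * `|h| * `|L|.
  by apply: ler_wpM2l => //; apply: mulr_ge0 => //; exact: ltW.
have t2 : 0 <= C5 * `|L| * intR S by rewrite mulr_ge0// mulr_ge0// ltW.
have t3 : 0 <= crit^-1 * `|h| by rewrite mulr_ge0// ltW.
move: t1 t2 t3; rewrite -[2 / _]/(2 * crit^-1); lra.
Qed.

(* The comparison speed [c + h] is the one whose wave has its crest at the crest of [U];
   strict convexity of the action in the speed then controls [h]. *)
Lemma core : exists2 eps0, 0 < eps0 & forall eps, 0 < eps -> exists2 del, 0 < del &
  forall U u1 v : R -> R, AC U u1 -> L2 U -> L2 u1 -> L2 v ->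
  (forall x, - eps0 <= U x) -> (forall x, U x <= U m0) -> `|U m0 - Mc| <= eps0 ->
  `|Efun U u1 v - E0| < del -> `|Ffun A sigma U u1 v - F0| < del ->
  intR (fun x => (U x - phi x) ^+ 2 + (u1 x - phi1 x) ^+ 2 + (v x - eta x) ^+ 2) < eps ^+ 2.
Proof.
have c0 := crit_gt0 A; have cc := pr_c P.
have s0 := normr_ge0 sigma.
(* For [sigma < 0] a negative [U] lowers the mobility [c - sigma * U]; a depth of [e1] lowers it by
   at most [crit / 4]. *)
pose e1 := crit / (4 * (`|sigma| + 1)).
have e10 : 0 < e1 by rewrite divr_gt0// mulr_gt0//; lra.
have se1 : `|sigma| * e1 <= crit / 4.
  have -> : crit / 4 = (`|sigma| + 1) * e1.
    by rewrite /e1; field; rewrite gt_eqF//; lra.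
  by rewrite ler_wpM2r ?(ltW e10)//; lra.
pose eps0 := Num.min (Num.min (Mc / 4) (crit / 4)) (Num.min e1 1).
have ee1 : eps0 <= e1 by rewrite !ge_min lexx !orbT.
have ee2 : eps0 <= 1 by rewrite !ge_min lexx !orbT.
have ee3 : eps0 <= Mc / 4 by rewrite !ge_min lexx.
have ee4 : eps0 <= crit / 4 by rewrite !ge_min lexx !orbT.
have eps00 : 0 < eps0.
  have a1 : 0 < Mc / 4 by lra.
  have a2 : 0 < crit / 4 by lra.
  by rewrite !lt_min a1 a2 e10 ltr01.
exists eps0 => // eps epsp.
have E00 : 0 <= E0 by exact: E0_ge0.
pose L := 2 * (E0 + 1).
have [Ca Ca0 HCa] := slope_error_bound (2 * Mc) L.
have [Cb Cb0 HCb] := density_error_bound L.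
have [t t0 Hclose] := wave_close sigma1 P epsp.
have t20 : 0 < t ^+ 2 by exact: exprn_gt0.
(* [Ca] and [Cb] multiply the sum of a defect and a shift, each at most [s], so the squared errors
   stay below [t ^ 2]. *)
pose s := Num.min t (t ^+ 2 / (2 * (Ca + Cb))).
have CC : 0 < 2 * (Ca + Cb) by lra.
have sp : 0 < s by rewrite lt_min t0 divr_gt0.
have st : s <= t by rewrite ge_min lexx.
have sC : s * (2 * (Ca + Cb)) <= t ^+ 2 by rewrite -ler_pdivlMr// ge_min lexx orbT.
have gp := gap_gt0 cc.
(* When the excess is at most [X], both defects are at most [s], and the term
   [4 * (gap A c * h ^ 2)] forces [|h| <= s]. *)
pose X := Num.min (4 * (gap A c * s ^+ 2)) s.
have X0 : 0 < X.
  have a1 : 0 < gap A c * s ^+ 2 by rewrite mulr_gt0// exprn_gt0.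
  by rewrite lt_min sp andbT mulr_gt0.
have Xs : X <= s by rewrite ge_min lexx orbT.
have Xg : X <= 4 * (gap A c * s ^+ 2) by rewrite ge_min lexx.
(* As [h <= 1], the excess is at most [2 * ((c + 1) * del + del)]. *)
pose K := 2 * (c + 2).
have K0 : 0 < K by rewrite /K; lra.
pose del := Num.min (Num.min t 1) (X / K).
have del0 : 0 < del by rewrite !lt_min t0 ltr01 divr_gt0.
have delt : del <= t by rewrite !ge_min lexx.
have del1 : del <= 1 by rewrite !ge_min lexx !orbT.
have delK : del * K <= X by rewrite -ler_pdivlMr// ge_min lexx orbT.
exists del => // U u1 v aU hU h1 hv Ulo Uhi UM dE dF.
pose h := U m0 - Mc.
have UMh : U m0 = Mc + h by rewrite /h; ring.
have hM : `|h| <= Mc / 4 by exact: le_trans ee3.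
have hb := UM; rewrite -/h ler_norml in hb; case/andP: hb => hb1 hb2.
clearbody h eps0.
have Hy x : crit <= c + h - U x by have := Uhi x; rewrite UMh; clear -sigma1 P; lra.
have Hyc x : crit / 2 <= c - U x by have := Hy x; move: hb2 ee4 c0; clear -sigma1 P; lra.
have neg x : U x < 0 -> - (crit / 4) <= - (sigma * U x).
  move=> Ux; have l := Ulo x.
  have : sigma * U x <= `|sigma| * eps0.
    apply: le_trans (ler_norm _) _; rewrite normrM ler_wpM2l// ltr0_norm//.
    by move: l; clear -sigma1 P; lra.
  have : `|sigma| * eps0 <= `|sigma| * e1 by rewrite ler_wpM2l.
  by move: se1; clear -sigma1 P; lra.
have pos x : 0 <= U x -> 0 <= U x - sigma * U x.
  by move=> Ux; rewrite -[X in X - _]mul1r -mulrBl mulr_ge0// subr_ge0.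
have Hz x : kap <= c + h - sigma * U x.
  have kc : kap = crit / 4 by [].
  have [Ux|Ux] := leP 0 (U x).
    by have := pos x Ux; have := Hy x; move: kc c0; clear -sigma1 P; lra.
  by have := neg x Ux; move: kc c0 hb1 ee3 cc; clear -sigma1 P; lra.
have Hzc x : kap <= c - sigma * U x.
  have kc : kap = crit / 4 by [].
  have [Ux|Ux] := leP 0 (U x).
    by have := pos x Ux; have := Hyc x; move: kc c0; clear -sigma1 P; lra.
  by have := neg x Ux; move: kc c0 cc; clear -sigma1 P; lra.
have adm : admissible A c U u1 v.
  split=> // x; have l := Ulo x; have u := Uhi x; rewrite UMh in u.
  by split; move: l u hb2 ee3 ee4 cc c0; clear -sigma1 P; lra.
have B := deficit_bound aU hU h1 hv Hz Hy UMh hM.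
have U0 : 0 <= U m0 by rewrite UMh; move: hb1 ee3 cc; clear -sigma1 P; lra.
have [i1 i2 _] := deficit aU hU h1 hv Hz Hy U0.
have he := ode_error_L2 sigma m0 adm; have hd := dens_L2 adm.
set I1 := intR (slope_defect _ _ _ _ _ _) in B; set I2 := intR (density_defect _ _ _) in B.
have I10 : 0 <= I1 by apply: intR_ge0 => x; exact: sqr_ge0.
have I20 : 0 <= I2.
  apply: intR_ge0 => x; apply: mulr_ge0; last exact: sqr_ge0.
  by apply: le_trans (Hy x); exact: ltW.
have gh0 : 0 <= gap A c * h ^+ 2 by rewrite mulr_ge0 ?sqr_ge0// ltW.
have BX : 2 * ((c + h) * (Efun U u1 v - E0) - (Ffun A sigma U u1 v - F0)) <= X.
  apply: le_trans delK.
  have ch : 0 <= c + h by move: hb1 ee3 cc c0; clear -sigma1 P; lra.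
  have ch1 : c + h <= c + 1 by move: hb2 ee2; clear -sigma1 P; lra.
  have : (c + h) * (Efun U u1 v - E0) <= (c + 1) * del.
    apply: (@le_trans _ _ ((c + h) * del)).
      by rewrite ler_wpM2l// (le_trans (ler_norm _))// ltW.
    by rewrite ler_wpM2r// ltW.
  move: dF; rewrite ltr_norml => /andP[dF _]; move: dF; rewrite /K; clear -sigma1 P; lra.
have hs : `|h| <= s.
  rewrite -ler_sqr ?nnegrE ?(ltW sp)// real_normK ?num_real//.
  rewrite -(ler_pM2l gp); move: B BX Xg I10 I20; clear -sigma1 P; lra.
have UL : intR (fun x => U x ^+ 2) <= L.
  apply: (@le_trans _ _ (2 * Efun U u1 v)).
    apply: norm_le_energy => //; first exact: L2_sqr.
    by move=> x; have := sqr_ge0 (u1 x); have := sqr_ge0 (v x); clear -sigma1 P; lra.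
  by move: dE; rewrite ltr_norml /L => /andP[_]; move: del1; clear -sigma1 P; lra.
have UM2 x : `|U x| <= 2 * Mc.
  have l := Ulo x; have u := Uhi x; rewrite UMh in u.
  by rewrite ler_norml; apply/andP; split; move: l u hb2 ee3 cc; clear -sigma1 P; lra.
have I1X : I1 <= s by move: B BX Xs I20 gh0; clear -sigma1 P; lra.
have I2X : I2 <= s by move: B BX Xs I10 gh0; clear -sigma1 P; lra.
have ss C : 0 < C -> C <= Ca + Cb -> C * (s + s) <= t ^+ 2.
  move=> C0 CC'; apply: le_trans sC; rewrite [leRHS]mulrC.
  have : C * s <= (Ca + Cb) * s by rewrite ler_wpM2r// ltW.
  by clear -sigma1 P; lra.
apply: (Hclose U u1 v adm); split.
- apply: le_trans (HCa h U u1 v aU hU h1 Hz Hzc UM2 UL i1 he) _.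
  apply: le_trans (ss _ Ca0 _); last by move: Cb0; clear -sigma1 P; lra.
  by apply: ler_wpM2l; [exact: ltW|exact: lerD].
- apply: le_trans (HCb h U v hU hv Hy Hyc _ UL i2 hd) _.
    by rewrite ler_norml; apply/andP; split; move: hb1 hb2 ee2; clear -sigma1 P; lra.
  apply: le_trans (ss _ Cb0 _); last by move: Ca0; clear -sigma1 P; lra.
  by apply: ler_wpM2l; [exact: ltW|exact: lerD].
- have -> : U m0 - Mc = h by rewrite UMh; ring.
  exact: le_trans st.
- by apply: ltW; exact: lt_le_trans delt.
Qed.

End Core.

(** * Profiles of solitary waves *)

Section OneVariable.
Variable R : realType.
Implicit Types (f g : R -> R).

Lemma ivt f x y v : continuous f -> f x < v -> v < f y -> exists z, f z = v.
Proof.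
move=> cf fx fy.
have cw a b : {within `[a, b], continuous f} by apply: continuous_subspaceT.
have [xy|yx] := leP x y.
  have [|z _ <-] := @IVT R f x y v xy (cw _ _); last by exists z.
  by rewrite ge_min (ltW fx) le_max (ltW fy) orbT.
have [|z _ <-] := @IVT R f y x v (ltW yx) (cw _ _); last by exists z.
by rewrite ge_min (ltW fx) orbT le_max (ltW fy).
Qed.

Lemma derive_ge0_le f g a b : (forall x : R, is_derive x 1 f (g x)) -> continuous g ->
  a <= b -> (forall x, a <= x <= b -> 0 <= g x) -> f a <= f b.
Proof.
move=> df cg ab H; rewrite -subr_ge0 (AC_iv (AC_C1 df cg) ab).
exact: iv_ge0.
Qed.

Lemma derive0_const f x y : (forall x : R, is_derive x 1 f 0) -> f x = f y.
Proof.
move=> df.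
have H a b : a <= b -> f a = f b.
  move=> ab; apply/eqP; rewrite eq_sym -subr_eq0.
  by rewrite (AC_iv (AC_C1 df (@cont_cst R 0)) ab) iv_cst// mul0r.
by have [xy|yx] := leP x y; [exact: H|apply/esym/H/ltW].
Qed.

Lemma local_max_derive0 f g x0 : (forall x : R, is_derive x 1 f (g x)) ->
  (forall x, f x <= f x0) -> g x0 = 0.
Proof.
move=> df H.
have h : is_derive x0 1 f 0.
  apply: (@derive1_at_max R f (x0 - 1) (x0 + 1) x0); first by lra.
  - by move=> x _; exact: der_derivable (df x).
  - by rewrite in_itv/=; apply/andP; split; lra.
  - by move=> x _; exact: H.
by rewrite -(der_derive1 (df x0)) (der_derive1 h).
Qed.

Lemma interior_min_derive0 f g a b x0 : (forall x : R, is_derive x 1 f (g x)) ->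
  a < x0 < b -> (forall x, a < x < b -> f x0 <= f x) -> g x0 = 0.
Proof.
move=> df /andP[ax xb] H.
have h : is_derive x0 1 f 0.
  apply: (@derive1_at_min R f a b x0); first by lra.
  - by move=> x _; exact: der_derivable (df x).
  - by rewrite in_itv/= ax xb.
  - by move=> x; rewrite in_itv/=; exact: H.
by rewrite -(der_derive1 (df x0)) (der_derive1 h).
Qed.

Lemma decay_const f k : decay f -> (forall x, f x = k) -> k = 0.
Proof.
move=> df H; apply/eqP; apply: contraT => k0.
have [|r r0] := df `|k|; first by rewrite normr_gt0.
by move=> /(_ r); rewrite H ltxx ger0_norm ?(ltW r0)// lexx => /(_ isT).
Qed.

Lemma decay_opp_arg f : decay f -> decay (fun x => f (- x)).
Proof.
by move=> df e /df[r r0 H]; exists r => // x rx; apply: H; rewrite normrN.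
Qed.

(** Gronwall: [f ^ 2 exp (2 C x)] increases and [f ^ 2 exp (- 2 C x)] decreases, so a zero
    propagates to the left and to the right respectively. *)
Lemma sqr_deriv_bounded f g C x0 : (forall x : R, is_derive x 1 f (g x)) -> continuous g ->
  (forall x, g x ^+ 2 <= C ^+ 2 * f x ^+ 2) -> 0 <= C -> f x0 = 0 -> forall x, f x = 0.
Proof.
move=> df cg H C0 f0.
have cf : continuous f by move=> x; exact: der_continuous (df x).
have fg x : `|f x * g x| <= C * f x ^+ 2.
  have h : `|g x| <= C * `|f x|.
    have n0 : 0 <= C * `|f x| by rewrite mulr_ge0.
    by rewrite -ler_sqr ?nnegrE// exprMn !real_normK ?num_real.
  rewrite normrM -(@real_normK _ (f x)) ?num_real//.
  by have := ler_wpM2l (normr_ge0 (f x)) h; lra.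
have key x y : x <= y ->
    f x ^+ 2 * expR (2 * C * x) <= f y ^+ 2 * expR (2 * C * y) /\
    f y ^+ 2 * expR (- (2 * C) * y) <= f x ^+ 2 * expR (- (2 * C) * x).
  move=> xy.
  have dE (k z : R) : is_derive z 1 (fun z => expR (k * z)) (expR (k * z) * k).
    by apply: der_comp; apply: der_eq (derZ k (der_id z)) => //; rewrite mulr1.
  have d (k z : R) : is_derive z 1 (fun z => f z ^+ 2 * expR (k * z))
      ((2 * (f z * g z) + k * f z ^+ 2) * expR (k * z)).
    by apply: der_eq (derM (derX 2 (df z)) (dE k z)) => //=; rewrite expr1; ring.
  have c (k : R) : continuous (fun z => (2 * (f z * g z) + k * f z ^+ 2) * expR (k * z)).
    apply: contM.
      apply: contD; apply: contM; [exact: cont_cst|exact: contM|exact: cont_cst|exact: contX].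
    by move=> z; exact: der_continuous (dE k z).
  split.
    apply: (derive_ge0_le (d (2 * C)) (c _) xy) => z _.
    rewrite mulr_ge0 ?expR_ge0//; have := fg z; rewrite ler_norml => /andP[]; lra.
  rewrite -lerN2.
  apply: (derive_ge0_le (fun z => derN (d (- (2 * C)) z)) (contN (c _)) xy) => z _.
  rewrite -mulNr mulr_ge0 ?expR_ge0//; have := fg z; rewrite ler_norml => /andP[]; lra.
move=> x; have e0 (k : R) : 0 < expR (k * x) by exact: expR_gt0.
apply/eqP; rewrite -sqrf_eq0.
have [xx|xx] := leP x x0.
  have [+ _] := key x x0 xx; rewrite f0 expr0n/= mul0r => h.
  by rewrite eq_le sqr_ge0 andbT -(pmulr_lle0 _ (e0 (2 * C))).
have [_ +] := key x0 x (ltW xx); rewrite f0 expr0n/= mul0r => h.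
by rewrite eq_le sqr_ge0 andbT -(pmulr_lle0 _ (e0 (- (2 * C)))).
Qed.

(** Between two critical points, both at level [M], a lower minimum would be an interior critical
    point, hence at level [M] as well; so [f] would be constant there, against [f2 < 0]. Thus [f1]
    has no zero right of [m0], and decay of [f] makes it negative. *)
Lemma unique_crest f f1 f2 M m0 : (forall x : R, is_derive x 1 f (f1 x)) ->
  (forall x : R, is_derive x 1 f1 (f2 x)) -> continuous f1 ->
  decay f -> 0 < M -> f m0 = M -> (forall x, f x <= M) ->
  (forall x, f1 x = 0 -> f x = M) -> (forall x, f x = M -> f2 x < 0) ->
  forall x, m0 < x -> f1 x < 0 /\ f x < M.
Proof.
move=> d1 d2 c1 df M0 fm fM H1 H2.
have cf : continuous f by move=> x; exact: der_continuous (d1 x).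
have nz x : m0 < x -> f1 x != 0.
  move=> mx; apply/eqP => fx0; have fxM := H1 _ fx0.
  have cw : {within `[m0, x], continuous f} by exact: continuous_subspaceT.
  have [z zi zmin] := @EVT_min R f m0 x (ltW mx) cw.
  rewrite in_itv/= in zi; case/andP: zi => z1 z2.
  have fz : f z = M.
    have [e1|e1] := eqVneq z m0; first by rewrite e1.
    have [e2|e2] := eqVneq z x; first by rewrite e2.
    apply: H1; apply: (@interior_min_derive0 f f1 m0 x z d1).
      by rewrite !lt_neqAle z1 z2 e2 eq_sym e1.
    by move=> y /andP[y1 y2]; apply: zmin; rewrite in_itv/= (ltW y1) (ltW y2).
  have fc y : m0 < y < x -> f y = M.
    move=> /andP[y1 y2]; apply/eqP; rewrite eq_le fM -fz/=.
    by apply: zmin; rewrite in_itv/= (ltW y1) (ltW y2).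
  pose w := (m0 + x) / 2.
  have wi : m0 < w < x by rewrite /w; apply/andP; split; lra.
  have f1z y : m0 < y < x -> f1 y = 0.
    move=> yi; apply: (@interior_min_derive0 f f1 m0 x y d1 yi) => u ui.
    by rewrite fc// fc.
  have := H2 w (fc _ wi).
  have -> : f2 w = 0.
    apply: (@interior_min_derive0 f1 f2 m0 x w d2 wi) => u ui.
    by rewrite f1z// f1z.
  by rewrite ltxx.
have [r r0 fr] := df _ M0.
have neg : exists2 y, m0 < y & f1 y < 0.
  pose b := Num.max r (m0 + 1).
  have mb : m0 < b by rewrite lt_max; apply/orP; right; lra.
  have fb : f b < M.
    apply: le_lt_trans (ler_norm _) _; apply: fr.
    by apply: le_trans (ler_norm _); rewrite le_max lexx.
  have cw : {within `[m0, b], continuous f} by exact: continuous_subspaceT.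
  have [y yi e] := MVT mb (fun x _ => d1 x) cw.
  rewrite in_itv/= in yi; case/andP: yi => y1 y2.
  exists y => //; rewrite -(pmulr_llt0 _ (_ : 0 < b - m0)) ?subr_gt0//.
  by rewrite -e fm subr_lt0.
case: neg => y my fy x mx; have fx : f1 x < 0.
  rewrite ltNge le_eqVlt eq_sym (negbTE (nz _ mx)) /=; apply/negP => fx.
  have cw a b : {within `[a, b], continuous f1} by exact: continuous_subspaceT.
  have [yx|xy] := leP y x.
    have [|z zi z0] := @IVT R f1 y x 0 yx (cw _ _).
      by rewrite ge_min (ltW fy) le_max (ltW fx) orbT.
    rewrite in_itv/= in zi; case/andP: zi => z1 _.
    by have := nz z (lt_le_trans my z1); rewrite z0 eqxx.
  have [|z zi z0] := @IVT R f1 x y 0 (ltW xy) (cw _ _).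
    by rewrite ge_min (ltW fy) orbT le_max (ltW fx).
  rewrite in_itv/= in zi; case/andP: zi => z1 _.
  by have := nz z (lt_le_trans mx z1); rewrite z0 eqxx.
split=> //; rewrite lt_neqAle fM andbT; apply/eqP => fx'.
have fmax z : f z <= f x by rewrite fx'.
by move: fx; rewrite (local_max_derive0 d1 fmax) ltxx.
Qed.

End OneVariable.

(* [stationary] is invariant under the sign change of [phi], [c] and [A], which reverses the
   direction of propagation. *)
Record stationary (R : realType) (A sigma c : R) (phi phi1 phi2 eta eta1 : R -> R) : Prop := {
  st_d1 : forall x : R, is_derive x 1 phi (phi1 x);
  st_d2 : forall x : R, is_derive x 1 phi1 (phi2 x);
  st_d3 : forall x : R, is_derive x 1 eta (eta1 x);
  st_c2 : continuous phi2;
  st_mass : forall x, (c - phi x) * eta x = phi x;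
  st_ode : forall x, (c - sigma * phi x) * phi2 x =
    (c + A) * phi x - 3 / 2 * phi x ^+ 2 + sigma / 2 * phi1 x ^+ 2
    - eta x - eta x ^+ 2 / 2;
  st_dphi : decay phi;
  st_deta : decay eta;
  st_L2 : L2 phi;
  st_L21 : L2 phi1;
  st_nz : exists x, phi x != 0 \/ eta x != 0 }.

Lemma stationaryN (R : realType) (A sigma c : R) (phi phi1 phi2 eta eta1 : R -> R) :
  stationary A sigma c phi phi1 phi2 eta eta1 ->
  stationary (- A) sigma (- c) (fun x => - phi x) (fun x => - phi1 x) (fun x => - phi2 x)
    eta eta1.
Proof.
case=> d1 d2 d3 c2 mass ode dp de l2 l21 [x0 nz]; split=> //.
- by move=> x; exact: derN.
- by move=> x; exact: derN.
- exact: contN.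
- by move=> x; have := mass x; lra.
- by move=> x; have := ode x; rewrite !sqrrN; lra.
- by apply: (decay_le dp (C := 1)) => x; rewrite normrN mul1r.
- exact: L2N.
- exact: L2N.
- by exists x0; rewrite oppr_eq0.
Qed.

(** * The shape of stationary waves *)

Section Stationary.
Variables (R : realType) (A sigma c : R) (phi phi1 phi2 eta eta1 : R -> R).
Hypothesis sigma1 : sigma <= 1.
Hypothesis P : stationary A sigma c phi phi1 phi2 eta eta1.
Local Notation crit := (crit A).

Let cphi : continuous phi. Proof. by move=> x; exact: der_continuous (st_d1 P x). Qed.
Let cphi1 : continuous phi1. Proof. by move=> x; exact: der_continuous (st_d2 P x). Qed.
Let ceta : continuous eta. Proof. by move=> x; exact: der_continuous (st_d3 P x). Qed.

(** The two equations make the difference of the sides a constant [K]. Decay of [phi1] is not yet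
    available; instead, [K != 0] would keep [phi1 ^ 2] away from [0] far out, against its
    integrability. *)
Lemma first_integral x : (c - sigma * phi x) * phi1 x ^+ 2 =
  (c + A) * phi x ^+ 2 - phi x ^+ 3 - phi x * eta x.
Proof.
pose B x := (c + A) * phi x ^+ 2 - phi x ^+ 3 - phi x * eta x.
pose J x := (c - sigma * phi x) * phi1 x ^+ 2 - B x.
have dJ (y : R) : is_derive y 1 J 0.
  have m1 : - phi1 y * eta y + (c - phi y) * eta1 y = phi1 y.
    have h : is_derive y 1 phi (- phi1 y * eta y + (c - phi y) * eta1 y).
      apply: der_eq (derM (derB (der_cst c y) (st_d1 P y)) (st_d3 P y)).
        by move=> z; exact: (st_mass P).
      by rewrite sub0r.
    by rewrite -(der_derive1 h) (der_derive1 (st_d1 P y)).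
  apply: der_eq (derB (derM (derB (der_cst c y) (derZ sigma (st_d1 P y))) (derX 2 (st_d2 P y)))
    (derB (derB (derZ (c + A) (derX 2 (st_d1 P y))) (derX 3 (st_d1 P y)))
      (derM (st_d1 P y) (st_d3 P y)))) => //=.
  (* The multipliers are [2 phi1] for the momentum equation, [- eta1] for the mass equation and
     [eta] for the derivative [m1] of the latter. *)
  transitivity (2 * phi1 y * ((c - sigma * phi y) * phi2 y -
    ((c + A) * phi y - 3 / 2 * phi y ^+ 2 + sigma / 2 * phi1 y ^+ 2 - eta y - eta y ^+ 2 / 2))
    + eta y * ((- phi1 y * eta y + (c - phi y) * eta1 y) - phi1 y)
    - eta1 y * ((c - phi y) * eta y - phi y)); first by field.
  by rewrite m1 (st_mass P) (st_ode P); ring.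
have [K JK] : exists K, forall y, J y = K.
  by exists (J 0) => y; exact: derive0_const.
suff K0 : K = 0 by apply/eqP; rewrite -subr_eq0 -/(B x) -/(J x) JK K0.
apply/eqP; apply: contraT => Kn0.
have Kp : 0 < `|K| / 2 by rewrite divr_gt0// normr_gt0.
have cB : continuous B.
  apply: contD; last by apply: contN; exact: contM.
  apply: contD; last by apply: contN; exact: contX.
  by apply: contM; [exact: cont_cst|exact: contX].
have dB : decay B.
  have [Ce Ce0 HCe] := continuous_decay_bounded ceta (st_deta P).
  have [Cp Cp0 HCp] := continuous_decay_bounded cphi (st_dphi P).
  apply: (decay_le (st_dphi P) (C := `|c + A| * Cp + Cp ^+ 2 + Ce)) => y.
  have -> : B y = phi y * ((c + A) * phi y - phi y ^+ 2 - eta y) by rewrite /B; ring.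
  rewrite normrM mulrC ler_wpM2r//.
  apply: le_trans (ler_normB _ _) _; apply: lerD; last exact: HCe.
  apply: le_trans (ler_normB _ _) _; apply: lerD.
    by rewrite normrM ler_wpM2l.
  by rewrite normrX ler_pXn2r// ?nnegrE// ltW.
have [r1 r10 H1] := dB _ Kp.
have ds : decay (fun y => sigma * phi y).
  by apply: (decay_le (st_dphi P) (C := `|sigma|)) => y; rewrite normrM.
have [r2 r20 H2] := ds _ ltr01.
pose C := `|c| + 1.
have C0 : 0 < C by rewrite ltr_wpDl.
pose r := Num.max r1 r2.
have low y : r <= y -> `|K| / 2 / C <= phi1 y ^+ 2.
  move=> ry; have ry' : r <= `|y| by exact: le_trans (ler_norm _).
  have [b1 b2] : r1 <= `|y| /\ r2 <= `|y| by move: ry'; rewrite ge_max => /andP[].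
  have h1 := H1 _ b1; have h2 := H2 _ b2.
  rewrite ler_pdivrMr//.
  have h3 : `|K| <= `|(c - sigma * phi y) * phi1 y ^+ 2| + `|B y|.
    by rewrite -(JK y) /J; exact: ler_normB.
  have h4 : `|(c - sigma * phi y) * phi1 y ^+ 2| <= C * phi1 y ^+ 2.
    rewrite normrM (ger0_norm (sqr_ge0 (phi1 y))) ler_wpM2r ?sqr_ge0//.
    by apply: le_trans (ler_normB _ _) _; rewrite lerD2l ltW.
  by move: h1 h3 h4; clear -P sigma1 cphi cphi1 ceta; lra.
have i1 := L2_sqr (st_L21 P).
pose q := `|K| / 2 / C.
have q0 : 0 < q by rewrite divr_gt0.
pose b := r + (intR (fun x => phi1 x ^+ 2) + 1) / q.
have I0 : 0 <= intR (fun x => phi1 x ^+ 2) by apply: intR_ge0 => y; exact: sqr_ge0.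
have rb : r <= b by rewrite /b lerDl divr_ge0 ?(ltW q0)//; lra.
have : iv r b (fun=> q) <= iv r b (fun x => phi1 x ^+ 2).
  apply: iv_mono; [exact: (locint_cont (@cont_cst R q))|exact: L1_locint|].
  by move=> y /andP[ry _]; exact: low.
rewrite iv_cst//.
have -> : q * (b - r) = intR (fun x => phi1 x ^+ 2) + 1.
  by rewrite /b; field; rewrite gt_eqF.
have := @iv_le_intR R r b (fun x => phi1 x ^+ 2) i1 (fun x => sqr_ge0 _).
lra.
Qed.

(* For [c = 0] the density [eta] can only take the values [0], [-1] and [-2]; being
   continuous and vanishing at infinity, it is [0]. *)
Lemma speed_neq0 : c != 0.
Proof.
apply/eqP => c0.
have M x : phi x * (1 + eta x) = 0 by have := st_mass P x; rewrite c0; lra.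
have V x : eta x != -1 -> eta x = 0 \/ eta x = -2.
  move=> ex.
  have ne : 0 < `|1 + eta x| by rewrite normr_gt0 addrC -[1]opprK subr_eq0.
  have cv : continuous (fun y => `|1 + eta y|).
    by apply: cont_norm; apply: contD; [exact: cont_cst|exact: ceta].
  have /nbhs_ballP[d /= d0 Hd] : \forall y \near x, 0 < `|1 + eta y|.
    exact: (cvgr_gt _ (cv x)).
  have p0 y : x - d < y < x + d -> phi y = 0.
    move=> yd; have : 0 < `|1 + eta y| by apply: Hd; rewrite /ball/= ltr_distlC; exact: yd.
    rewrite normr_gt0 => /negbTE n0.
    by have /eqP := M y; rewrite mulf_eq0 n0 orbF => /eqP.
  have p1 y : x - d < y < x + d -> phi1 y = 0.
    move=> yd; apply: (@interior_min_derive0 _ phi phi1 (x - d) (x + d) y (st_d1 P) yd) => z zd.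
    by rewrite !p0.
  have xd : x - d < x < x + d by apply/andP; split; lra.
  have := st_ode P x; rewrite (p0 _ xd) (p1 _ xd).
  have -> : phi2 x = 0.
    apply: (@interior_min_derive0 _ phi1 phi2 (x - d) (x + d) x (st_d2 P) xd) => z zd.
    by rewrite !p1.
  move=> e; have /eqP : eta x * (eta x + 2) = 0 by lra.
  by rewrite mulf_eq0 addr_eq0 => /orP[/eqP|/eqP]; [left|right].
have e0 x : eta x = 0.
  have [r r0 /(_ r)] : exists2 r, 0 < r & forall y, r <= `|y| -> `|eta y| < 1 / 2.
    by apply: (st_deta P); lra.
  rewrite (ger0_norm (ltW r0)) lexx => /(_ isT); rewrite ltr_norml => /andP[er _].
  have hi : - (3 / 4) <= eta x.
    rewrite leNgt; apply/negP => lo.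
    have [|z ez] := ivt ceta lo (_ : _ < eta r); first by lra.
    have zn : eta z != -1 by rewrite ez; apply/eqP; lra.
    by case: (V z zn); rewrite ez; lra.
  have xn : eta x != -1 by apply/eqP => e; move: hi; rewrite e; lra.
  by case: (V x xn) => // e; move: hi; rewrite e; lra.
have [x [|]] := st_nz P; last by rewrite e0 eqxx.
by have /eqP := M x; rewrite e0 addr0 mulr1 => ->.
Qed.

Hypothesis c0 : 0 < c.

(** The mass equation excludes the value [c], where it would read [0 = c]; continuity and decay then
    keep [phi] below it. *)
Lemma phi_lt_speed x : phi x < c.
Proof.
have nc y : phi y != c.
  by apply/eqP => h; have := st_mass P y; rewrite h subrr mul0r => e; move: c0; rewrite -e ltxx.
have [r r0 /(_ r)] := st_dphi P c0.
rewrite (ger0_norm (ltW r0)) lexx => /(_ isT) h.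
rewrite ltNge; apply/negP; rewrite le_eqVlt eq_sym (negbTE (nc x))/= => h'.
have [z ez] := ivt cphi (le_lt_trans (ler_norm _) h) h'.
by move: (nc z); rewrite ez eqxx.
Qed.

Lemma eta_eq x : eta x = phi x / (c - phi x).
Proof.
have h : c - phi x != 0 by rewrite subr_eq0 gt_eqF// phi_lt_speed.
by apply: (mulfI h); rewrite (st_mass P) mulrC divfK.
Qed.

Lemma slope_eq x : (c - sigma * phi x) * phi1 x ^+ 2 = phi x ^+ 2 * W A (c - phi x).
Proof.
rewrite first_integral eta_eq /W; have := phi_lt_speed x; rewrite -subr_gt0 => h.
by field; rewrite gt_eqF.
Qed.

Lemma phi_neq0 : exists x, phi x != 0.
Proof.
have [x [h|h]] := st_nz P; exists x => //.
by apply: contraNneq h => e; rewrite eta_eq e mul0r.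
Qed.

(** Decay and the intermediate value theorem. It supplies points where the first integral can be
    read near level [0] without being trivial. *)
Lemma crossing_small e : 0 < e -> exists2 z, phi z != 0 & `|phi z| < e.
Proof.
move=> ep; have [x nx] := phi_neq0.
pose v := Num.min e `|phi x| / 2.
have w0 : 0 < Num.min e `|phi x| by rewrite lt_min ep normr_gt0.
have v0 : 0 < v by rewrite divr_gt0.
have vw : v < Num.min e `|phi x| by rewrite /v; lra.
have [ve vx] : v < e /\ v < `|phi x| by apply/andP; rewrite -lt_min.
have [r r0 /(_ r)] := st_dphi P v0; rewrite (ger0_norm (ltW r0)) lexx => /(_ isT) h.
have [z ez] := ivt (cont_norm cphi) h vx.
by exists z; [rewrite -normr_gt0 ez|rewrite ez].
Qed.

(** At a negative minimum the first integral forces [W (c - phi) = 0], impossible since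
    [c - phi > crit] there. *)
Lemma wave_ge0 : crit <= c -> forall x, 0 <= phi x.
Proof.
move=> cc x; rewrite leNgt; apply/negP => px.
have [m Hm] : exists m, forall y, - phi y <= - phi m.
  apply: (@decay_max _ (fun y => - phi y) x); [exact: contN| |by rewrite oppr_gt0].
  by apply: (decay_le (st_dphi P) (C := 1)) => y; rewrite normrN mul1r.
have f0 : - phi1 m = 0.
  exact: (@local_max_derive0 _ (fun y => - phi y) (fun y => - phi1 y) m (fun y => derN (st_d1 P y)) Hm).
have pm : phi m < 0 by have := Hm x; lra.
have := slope_eq m; rewrite -[phi1 m]opprK f0 oppr0 expr0n/= mulr0 => /esym/eqP.
rewrite mulf_eq0 sqrf_eq0 (lt_eqF pm)/= => /eqP h.
by have := @W_ge _ A (c - phi m) _; rewrite h => /(_ ltac:(lra)); lra.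
Qed.

(* Below the critical speed the first integral forces [phi = 0] wherever [phi] is small. *)
Lemma crit_lt_speed : crit < c.
Proof.
rewrite ltNge; apply/negP => cc.
have npos x : phi x <= 0.
  rewrite leNgt; apply/negP => px.
  have y0 := phi_lt_speed x.
  have z0 : 0 <= c - sigma * phi x.
    by have : sigma * phi x <= 1 * phi x; [rewrite ler_wpM2r// ltW|lra].
  have := mulr_ge0 z0 (sqr_ge0 (phi1 x)); rewrite slope_eq leNgt pmulr_rlt0 ?exprn_gt0//.
  by rewrite W_lt0//; lra.
have s0 := normr_ge0 sigma.
have [cc'|cc'] := leP crit c.
  by have [x /eqP[]] := phi_neq0; apply/eqP; rewrite eq_le npos wave_ge0.
pose e := Num.min (crit - c) (c / (`|sigma| + 1)).
have e0 : 0 < e by rewrite lt_min subr_gt0 cc' divr_gt0//; lra.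
have [z nz ze] := crossing_small e0.
move: (ze); rewrite /e lt_min ltr_pdivlMr; last by lra.
move=> /andP[z1 z2].
have z0 : 0 <= c - sigma * phi z.
  have := ler_norm (sigma * phi z); rewrite normrM => h.
  by have := normr_ge0 (phi z); move: h z2; lra.
have := mulr_ge0 z0 (sqr_ge0 (phi1 z)); rewrite slope_eq leNgt pmulr_rlt0.
  rewrite W_lt0//; first by have := phi_lt_speed z; lra.
  by move: z1; rewrite ltr_norml; lra.
by rewrite lt_neqAle sqr_ge0 eq_sym sqrf_eq0 nz.
Qed.

Lemma wave_le x : phi x <= c - crit.
Proof.
have cc := crit_lt_speed; rewrite leNgt; apply/negP => px.
have y0 := phi_lt_speed x; have p0 : 0 < phi x by lra.
have z0 : 0 <= c - sigma * phi x.
  by have : sigma * phi x <= 1 * phi x; [rewrite ler_wpM2r// ltW|lra].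
have := mulr_ge0 z0 (sqr_ge0 (phi1 x)); rewrite slope_eq leNgt pmulr_rlt0 ?exprn_gt0//.
by rewrite W_lt0//; lra.
Qed.

Lemma mobility_ge x : crit <= c - sigma * phi x.
Proof.
have p0 := wave_ge0 (ltW crit_lt_speed) x.
have : sigma * phi x <= 1 * phi x by rewrite ler_wpM2r.
by have := wave_le x; lra.
Qed.

(** The first integral bounds [|phi1|] by a multiple of [|phi|], so a zero would spread over the
    whole line by [sqr_deriv_bounded]. *)
Lemma wave_gt0 x : 0 < phi x.
Proof.
have cc := crit_lt_speed; have k0 := crit_gt0 A.
rewrite lt_neqAle wave_ge0 ?(ltW cc)// andbT eq_sym; apply/eqP => px.
pose B := W A c / crit.
have W0 : 0 <= W A c by have := @W_ge _ A c (ltW cc); lra.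
have B0 : 0 <= B by rewrite divr_ge0// ltW.
have H y : phi1 y ^+ 2 <= (B + 1) ^+ 2 * phi y ^+ 2.
  apply: (@le_trans _ _ (B * phi y ^+ 2)); last first.
    by rewrite ler_wpM2r ?sqr_ge0//; have := sqr_ge0 B; lra.
  rewrite /B mulrAC ler_pdivlMr//.
  apply: (@le_trans _ _ ((c - sigma * phi y) * phi1 y ^+ 2)).
    by rewrite mulrC ler_wpM2r ?sqr_ge0// mobility_ge.
  rewrite slope_eq mulrC ler_wpM2r ?sqr_ge0//.
  have p0 := wave_ge0 (ltW cc) y; have y1 := phi_lt_speed y.
  by have := @W_increasing _ A (c - phi y) c; lra.
have [y /eqP[]] := phi_neq0.
by apply: (sqr_deriv_bounded (st_d1 P) cphi1 H _ px); lra.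
Qed.

Lemma critical_top x : phi1 x = 0 -> phi x = c - crit.
Proof.
move=> h; have := slope_eq x; rewrite h expr0n/= mulr0 => /esym/eqP.
have px := wave_gt0 x.
rewrite mulf_eq0 sqrf_eq0 (gt_eqF px)/= => /eqP e.
apply/eqP; rewrite eq_le wave_le/=.
by have := @W_ge _ A (c - phi x); rewrite e; have := wave_le x; lra.
Qed.

Lemma top_critical x : phi x = c - crit -> phi1 x = 0.
Proof.
move=> e; apply: (local_max_derive0 (st_d1 P)) => y; rewrite e; exact: wave_le.
Qed.

(** The value comes from the second-order equation at a critical point, with [A = 1 / crit - crit]
    eliminating [A]. It is what excludes a plateau in [unique_crest]. *)
Lemma top_concave x : phi x = c - crit -> phi2 x < 0.
Proof.
move=> e; have := st_ode P x; rewrite (top_critical e) eta_eq e.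
have c1 := crit_gt0 A; have cc := crit_lt_speed.
have -> : c - (c - crit) = crit by ring.
set M := c - crit.
have -> : (c + A) * M - 3 / 2 * M ^+ 2 + sigma / 2 * 0 ^+ 2 - M / crit - (M / crit) ^+ 2 / 2
    = - (M ^+ 2 * (1 + crit ^- 2) / 2).
  have eA : A = crit^-1 - crit.
    apply: (mulIf (x := crit)); first by rewrite gt_eqF.
    by rewrite mulrBl mulVf ?gt_eqF//; have := crit_eq A; lra.
  by rewrite [X in c + X]eA /M; field; rewrite gt_eqF.
have M0 : 0 < M ^+ 2 by rewrite exprn_gt0// subr_gt0.
have q0 : 0 < crit ^- 2 by rewrite invr_gt0 exprn_gt0.
have := mobility_ge x; rewrite e -/M => z0 h.
rewrite -(pmulr_rlt0 _ (_ : 0 < c - sigma * M)) ?h; last by lra.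
by rewrite oppr_lt0 divr_gt0// mulr_gt0// addr_gt0.
Qed.

Lemma stationary_profile : exists m0, profile A sigma c phi phi1 phi2 eta m0.
Proof.
have cc := crit_lt_speed; have c1 := crit_gt0 A.
have [m0 Hm] := decay_max cphi (st_dphi P) (wave_gt0 0).
have top : phi m0 = c - crit.
  by apply: critical_top; exact: (local_max_derive0 (st_d1 P)).
have M0 : 0 < c - crit by rewrite subr_gt0.
have right := unique_crest (st_d1 P) (st_d2 P) cphi1 (st_dphi P) M0 top wave_le
  critical_top top_concave.
(* The left flank is the right flank of the reflected wave. *)
have left x : x < m0 -> 0 < phi1 x /\ phi x < c - crit.
  move=> xm.
  have d1 y : is_derive y (1 : R) (fun z => phi (- z)) (- phi1 (- y)).
    by apply: der_eq (der_comp (st_d1 P (- y)) (derN (der_id y))) => //; rewrite mulrN1.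
  have d2 y : is_derive y (1 : R) (fun z => - phi1 (- z)) (phi2 (- y)).
    by apply: der_eq (derN (der_comp (st_d2 P (- y)) (derN (der_id y)))) => //; rewrite mulrN1 opprK.
  have cN : continuous (fun z : R => - z) by apply: contN; exact: cont_id.
  have c1' : continuous (fun z => - phi1 (- z)) by apply: contN; exact: cont_comp.
  have top' : phi (- (- m0)) = c - crit by rewrite opprK.
  have := @unique_crest _ (fun z => phi (- z)) (fun z => - phi1 (- z)) (fun z => phi2 (- z))
    (c - crit) (- m0) d1 d2 c1' (decay_opp_arg (st_dphi P)) M0 top' (fun z => wave_le _).
  move=> /(_ _ _ (- x)); rewrite opprK oppr_lt0 ltrN2; apply => //.
    by move=> y /eqP; rewrite oppr_eq0 => /eqP; exact: critical_top.
  by move=> y; exact: top_concave.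
exists m0; split => //.
- exact: (st_d1 P).
- exact: (st_d2 P).
- exact: (st_c2 P).
- exact: wave_gt0.
- exact: wave_le.
- by move=> x; rewrite neq_lt => /orP[/left[]|/right[]].
- exact: eta_eq.
- move=> x; have z0 : 0 < c - sigma * phi x by apply: lt_le_trans (mobility_ge x).
  have y1 : crit <= c - phi x by have := wave_le x; lra.
  have Z0 : ZZ A sigma c (phi x) = c - sigma * phi x.
    rewrite /ZZ; apply/max_idPl; have := mobility_ge x; have := kap_le_crit A; lra.
  have sq : phi1 x ^+ 2 = gg A sigma c (phi x) ^+ 2.
    apply: (mulfI (x := c - sigma * phi x)); first by rewrite gt_eqF.
    rewrite slope_eq /gg !exprMn exprVn sW_sqr sZ_sqr Z0 WpE//.
    by field; rewrite gt_eqF.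
  have g0 : 0 <= gg A sigma c (phi x).
    by rewrite /gg !mulr_ge0// ?sqrtr_ge0 ?invr_ge0 ?sqrtr_ge0// ltW// wave_gt0.
  have g1 : `|phi1 x| = gg A sigma c (phi x).
    by rewrite -sqrtr_sqr sq sqrtr_sqr ger0_norm.
  rewrite -g1 /sgn; have [xm|xm|->] := ltgtP x m0.
  + by rewrite mul1r gtr0_norm//; case: (left _ xm).
  + by rewrite mulN1r ltr0_norm ?opprK//; case: (right _ xm).
  + by rewrite (top_critical top) normr0 mulr0.
- exact: (st_ode P).
- exact: (st_L2 P).
Qed.

End Stationary.

(** * Convolution with the exponential kernel *)

Section ExponentialKernel.
Variable R : realType.
Variable K : R -> R.
Hypothesis cK : continuous K.
Hypothesis iK : L1 (fun y => expR (- `|y|) * K y).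

Let dE (k x : R) : is_derive x 1 (fun y => expR (k * y)) (k * expR (k * x)).
Proof.
by apply: der_eq (der_comp (is_derive_expR (k * x)) (derZ k (der_id x))) => //; rewrite mulr1 mulrC.
Qed.

Let cE (k : R) : continuous (fun y => expR (k * y) * K y).
Proof. by apply: contM => // x; exact: der_continuous (dE k x). Qed.

Lemma pker_cont : continuous (@pker R).
Proof.
apply: contM; last exact: cont_cst.
apply: (@cont_comp _ expR (fun x => - `|x|)); last by apply: contN; exact: cont_norm (@cont_id R).
exact: continuous_expR.
Qed.

(** The kernel factorises on either side of [y = x]: [a + G1 x] is the integral of [exp y * K y] up
    to [x], and [b - G2 x] that of [exp (- y) * K y] from [x] on. The primitives start at [0], so
    the line is split there, with a correction between [0] and [x]. *)
Lemma conv_pE : exists a b : R, exists G1 G2 : R -> R,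
  [/\ forall x : R, is_derive x 1 G1 (expR x * K x),
      forall x : R, is_derive x 1 G2 (expR (- x) * K x) &
      forall x, conv_p K x = (expR (- x) * (a + G1 x) + expR x * (b - G2 x)) / 2].
Proof.
have [G1 [d1 z1 e1]] := primitive_exists (@cE 1).
have [G2 [d2 z2 e2]] := primitive_exists (@cE (-1)).
pose h1 y := (1 + sgn 0 y) / 2 * (expR (- `|y|) * K y).
pose h2 y := (1 - sgn 0 y) / 2 * (expR (- `|y|) * K y).
have ms : measurable_fun setT (sgn (0 : R)) by exact: sgn_measurable.
have i1 : L1 h1.
  apply: (@L1_mulb _ _ _ 1) => //.
    by apply: measurable_funM => //; apply: measurable_funD.
  by move=> y; rewrite /sgn; case: ifP => _; rewrite ger0_norm; lra.
have i2 : L1 h2.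
  apply: (@L1_mulb _ _ _ 1) => //.
    by apply: measurable_funM => //; apply: measurable_funB.
  by move=> y; rewrite /sgn; case: ifP => _; rewrite ger0_norm; lra.
exists (intR h1), (intR h2), G1, G2; split.
- by move=> x; apply: der_eq (d1 x) => //; rewrite mul1r.
- by move=> x; apply: der_eq (d2 x) => //; rewrite mulN1r.
move=> x; have [x0|x0] := leP 0 x.
  pose f y := expR (- x) * (expR (1 * y) * K y) - expR x * (expR (-1 * y) * K y).
  have lf : locint f.
    by apply: locintB; apply: locintZ; apply: locint_cont; exact: cE.
  have if_ : L1 (fun y => \1_(`[0, x]%classic) y * f y) by apply/L1_indic; exact: lf.
  have -> : conv_p K x = intR (fun y => 2^-1 * (expR (- x) * h1 y + expR x * h2 y
      + \1_(`[0, x]%classic) y * f y)).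
    apply: eq_intR => y; rewrite /pker /h1 /h2 /sgn /f indicE mem_setE in_itv/= mul1r mulN1r.
    case: ifPn => y0.
      rewrite leNgt y0/= (ltr0_norm y0) ger0_norm; last by lra.
      rewrite opprK opprB (_ : y - x = - x + y) ?expRD; last by ring.
      by rewrite [false%:R](_ : _ = 0)//; field.
    rewrite -leNgt in y0; rewrite y0 (ger0_norm y0)/=; have [yx|xy] := leP y x.
      rewrite ger0_norm ?subr_ge0// opprB (_ : y - x = - x + y) ?expRD; last by ring.
      by rewrite [true%:R](_ : _ = 1)//; field.
    by rewrite ltr0_norm ?subr_lt0// opprK expRD [false%:R](_ : _ = 0)//; field.
  have iA : L1 (fun y => expR (- x) * h1 y + expR x * h2 y) by apply: L1D; exact: L1Z.
  rewrite intR_Z; last exact: L1D.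
  rewrite intR_D// intR_D ?intR_Z//; [|exact: L1Z|exact: L1Z].
  rewrite int_indic ivB; [|by apply: locintZ; apply: locint_cont; exact: cE..].
  rewrite !ivZ; [|by apply: locint_cont; exact: cE..].
  by rewrite -e1// -e2// z1 z2 !subr0; field.
pose f y := (1 + sgn 0 y) / 2 *
  (expR x * (expR (-1 * y) * K y) - expR (- x) * (expR (1 * y) * K y)).
pose g y := expR x * (expR (-1 * y) * K y) - expR (- x) * (expR (1 * y) * K y).
have lg : locint g.
  by apply: locintB; apply: locintZ; apply: locint_cont; exact: cE.
have lf : locint f.
  apply: (@eq_locint _ (fun y => 1 / 2 * (g y + sgn 0 y * g y))).
    by move=> y; rewrite /f /g; field.
  by apply: locintZ; apply: locintD => //; exact: locint_sgn.
have if_ : L1 (fun y => \1_(`[x, 0]%classic) y * f y) by apply/L1_indic; exact: lf.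
have -> : conv_p K x = intR (fun y => 2^-1 * (expR (- x) * h1 y + expR x * h2 y
    + \1_(`[x, 0]%classic) y * f y)).
  apply: eq_intR => y; rewrite /pker /h1 /h2 /sgn /f indicE mem_setE in_itv/= mul1r mulN1r.
  rewrite /sgn; case: ifPn => y0.
    rewrite (ltW y0) andbT (ltr0_norm y0) opprK; have [xy|yx] := leP x y.
      by rewrite ler0_norm ?subr_le0// opprK expRD [true%:R](_ : _ = 1)//; field.
    rewrite gtr0_norm ?subr_gt0// opprB (_ : y - x = - x + y) ?expRD; last by ring.
    by rewrite [false%:R](_ : _ = 0)//; field.
  rewrite -leNgt in y0; rewrite (ger0_norm y0) ltr0_norm; last by lra.
  by rewrite opprK expRD; field.
have iA : L1 (fun y => expR (- x) * h1 y + expR x * h2 y) by apply: L1D; exact: L1Z.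
rewrite intR_Z; last exact: L1D.
rewrite intR_D// intR_D ?intR_Z//; [|exact: L1Z|exact: L1Z].
rewrite int_indic.
have -> : iv x 0 f = iv x 0 g.
  apply: eq_iv_co => // y /andP[_ y0]; rewrite /f /sgn y0; have -> : (1 + 1) / 2 = 1 :> R by field.
  by rewrite mul1r.
rewrite /g ivB; [|by apply: locintZ; apply: locint_cont; exact: cE..].
rewrite !ivZ; [|by apply: locint_cont; exact: cE..].
by rewrite -e1 ?(ltW x0)// -e2 ?(ltW x0)// z1 z2 !sub0r; field.
Qed.

(** The kernel is the fundamental solution of [1 - d^2/dx^2]. This turns the nonlocal momentum
    equation into an ordinary differential equation. *)
Lemma conv_p_ode : exists S1 : R -> R, (forall x : R, is_derive x 1 (conv_p K) (S1 x)) /\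
  (forall x : R, is_derive x 1 S1 (conv_p K x - K x)).
Proof.
have [a [b [G1 [G2 [d1 d2 E]]]]] := conv_pE.
have em (x : R) : is_derive x 1 (fun y : R => expR (- y)) (- expR (- x)).
  by apply: der_eq (dE (-1) x) => [y|]; rewrite !mulN1r.
have ep (x : R) : is_derive x 1 (fun y : R => expR y) (expR x) by exact: is_derive_expR.
have dA (x : R) : is_derive x 1 (fun y => expR (- y) * (a + G1 y)) (K x - expR (- x) * (a + G1 x)).
  apply: der_eq (derM (em x) (derD (der_cst a x) (d1 x))) => //.
  by rewrite add0r mulrA -expRD addNr expR0; ring.
have dB (x : R) : is_derive x 1 (fun y => expR y * (b - G2 y)) (expR x * (b - G2 x) - K x).
  apply: der_eq (derM (ep x) (derB (der_cst b x) (d2 x))) => //.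
  by rewrite sub0r mulrN mulrA -expRD subrr expR0; ring.
exists (fun x => 1 / 2 * (expR x * (b - G2 x) - expR (- x) * (a + G1 x))); split=> x.
  apply: der_eq (derZ (1 / 2) (derD (dA x) (dB x))) => [y|]; last by ring.
  by rewrite E; field.
by apply: der_eq (derZ (1 / 2) (derB (dB x) (dA x))) => //; rewrite E; field.
Qed.

End ExponentialKernel.

Section Kernel.
Variable R : realType.

(** By symmetry twice the half-line, where the integrand is the density of the exponential law. *)
Lemma L1_exp_norm : L1 (fun y : R => expR (- `|y|)).
Proof.
have ce : continuous (fun y : R => expR (- `|y|)).
  apply: (@cont_comp _ expR (fun x => - `|x|)); last by apply: contN; exact: cont_norm (@cont_id R).
  exact: continuous_expR.
have me : measurable_fun [set: R] (fun y : R => expR (- `|y|)) by exact: continuous_measurable_fun.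
apply/integrableP; split; first exact/measurable_EFinP.
under eq_integral => x _ do rewrite /= ger0_norm ?expR_ge0//.
have e0 (x : R) : 0 <= expR (- `|x|) by exact: expR_ge0.
have es : (fun x : R => expR (- `|x|)) =1 (fun x : R => expR (- `|x|)) \o -%R.
  by move=> x /=; rewrite normrN.
rewrite (ge0_symfun_integralT e0 ce es).
apply: (@le_lt_trans _ _ (2 * 1)%E); last by rewrite mule1 ltry.
apply: lee_pmul => //; first by apply: integral_ge0 => x _; rewrite lee_fin expR_ge0.
rewrite -(@integral_exponential_pdf R 1 ltr01).
apply: (@le_trans _ _ (\int[mu]_(x in [set x : R | (0 <= x)%R]) (exponential_pdf 1 x)%:E)%E).
  rewrite le_eqVlt; apply/orP; left; apply/eqP; apply: eq_integral => x.
  by rewrite inE /= => x0; rewrite exponential_pdfE// mul1r mulN1r ger0_norm.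
apply: ge0_subset_integral => //=.
- by rewrite -set_itvcy; exact: measurable_itv.
- by apply/measurable_EFinP; exact: measurable_exponential_pdf.
- by move=> x _; rewrite lee_fin exponential_pdf_ge0.
Qed.

Lemma L2_exp_norm : L2 (fun y : R => expR (- `|y|)).
Proof.
split; first exact: L1_measurable L1_exp_norm.
apply: (@L1_le _ _ (fun y => expR (- `|y|))); last first.
- move=> y; rewrite ger0_norm ?sqr_ge0// expr2 -[leRHS]mul1r ler_wpM2r ?expR_ge0//.
- exact: L1_exp_norm.
- by apply: measurable_funX; exact: L1_measurable L1_exp_norm.
Qed.

End Kernel.

(** * Test functions travelling with the wave *)

Section TravellingTests.
Variables (R : realType) (c : R).

(** As with [sums_of_products], finite sums are needed for stability: the time derivative of one
    product already consists of two. *)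
Inductive wavelike : (R -> R -> R) -> Prop :=
| wavelike_prod a b : smooth1 a -> smooth1 b -> wavelike (fun t x => a t * b (x - c * t))
| wavelike_add f g : wavelike f -> wavelike g -> wavelike (fun t x => f t x + g t x).

Lemma der_phase_x (a b : R -> R) (t x : R) : smooth1 b ->
  is_derive x 1 (fun y => a t * b (y - c * t)) (a t * derive1 b (x - c * t)).
Proof.
move=> sb; apply: derZ.
apply: der_eq (der_comp (smooth1_der _ sb) (derB (der_id x) (der_cst (c * t) x))) => //.
by rewrite subr0 mulr1.
Qed.

Lemma der_phase_t (a b : R -> R) (t x : R) : smooth1 a -> smooth1 b ->
  is_derive t 1 (fun s => a s * b (x - c * s))
    (derive1 a t * b (x - c * t) + (- c * a t) * derive1 b (x - c * t)).
Proof.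
move=> sa sb.
apply: der_eq (derM (smooth1_der t sa)
  (der_comp (smooth1_der _ sb) (derB (der_cst x t) (derZ c (der_id t))))) => //.
by ring.
Qed.

Lemma px_prod (a b : R -> R) : smooth1 b ->
  px (fun t x => a t * b (x - c * t)) = (fun t x => a t * derive1 b (x - c * t)).
Proof. by move=> sb; apply/funext => t; apply/funext => x; exact: der_derive1 (der_phase_x a t x sb). Qed.

Lemma pt_prod (a b : R -> R) : smooth1 a -> smooth1 b ->
  pt (fun t x => a t * b (x - c * t)) =
  (fun t x => derive1 a t * b (x - c * t) + (- c * a t) * derive1 b (x - c * t)).
Proof. by move=> sa sb; apply/funext => t; apply/funext => x; exact: der_derive1 (der_phase_t t x sa sb). Qed.

Lemma wavelike_derivable f : wavelike f -> forall t x,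
  derivable (fun s => f s x) t 1 /\ derivable (fun y => f t y) x 1.
Proof.
elim=> [a b sa sb|{}f g _ IHf _ IHg] t x.
  by split; [exact: der_derivable (der_phase_t t x sa sb)|exact: der_derivable (der_phase_x a t x sb)].
have [f1 f2] := IHf t x; have [g1 g2] := IHg t x.
split; first exact: der_derivable (derD (derivable_der f1) (derivable_der g1)).
exact: der_derivable (derD (derivable_der f2) (derivable_der g2)).
Qed.

Lemma wavelike_pt f : wavelike f -> wavelike (pt f).
Proof.
elim=> [a b sa sb|{}f g wf IHf wg IHg].
  rewrite pt_prod//.
  have sa' := smooth1_derive1 sa; have sb' := smooth1_derive1 sb.
  have sac := @smooth1Z R a (- c) sa.
  exact (wavelike_add (wavelike_prod sa' sb) (wavelike_prod sac sb')).
have -> : pt (fun t x => f t x + g t x) = (fun t x => pt f t x + pt g t x).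
  apply/funext => t; apply/funext => x; apply: der_derive1.
  have [f1 _] := wavelike_derivable wf t x; have [g1 _] := wavelike_derivable wg t x.
  exact: derD (derivable_der f1) (derivable_der g1).
exact: wavelike_add.
Qed.

Lemma wavelike_px f : wavelike f -> wavelike (px f).
Proof.
elim=> [a b sa sb|{}f g wf IHf wg IHg].
  by rewrite px_prod//; exact (wavelike_prod sa (smooth1_derive1 sb)).
have -> : px (fun t x => f t x + g t x) = (fun t x => px f t x + px g t x).
  apply/funext => t; apply/funext => x; apply: der_derive1.
  have [_ f2] := wavelike_derivable wf t x; have [_ g2] := wavelike_derivable wg t x.
  exact: derD (derivable_der f2) (derivable_der g2).
exact: wavelike_add.
Qed.

Lemma wavelike_continuous f : wavelike f -> continuous (fun p : R * R => f p.1 p.2).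
Proof.
elim=> [a b sa sb|{}f g _ IHf _ IHg] p; last by apply: cvgD; [exact: IHf|exact: IHg].
have ca := smooth1_continuous sa; have cb := smooth1_continuous sb.
apply: (@continuousM R (R * R)%type (fun q => a q.1) (fun q => b (q.2 - c * q.1))).
  by apply: (@continuous_comp _ _ _ fst a); [exact: cvg_fst|exact: ca].
apply: (@continuous_comp _ _ _ (fun q : R * R => q.2 - c * q.1) b); last exact: cb.
apply: (@continuousB R R (R * R)%type snd (fun q => c * q.1)); first exact: cvg_snd.
by apply: (@continuousM R (R * R)%type (fun=> c) fst); [exact: cvg_cst|exact: cvg_fst].
Qed.

Lemma wavelike_smooth2 f : wavelike f -> smooth2 f.
Proof.
move=> wf ds.
have wd : wavelike (dpart ds f).
  by elim: ds => [|[] ds IH] //=; [exact: wavelike_pt|exact: wavelike_px].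
by split; [exact: wavelike_continuous|exact: wavelike_derivable].
Qed.

Lemma wave_test2 (a b : R -> R) (s t : R) : smooth1 a -> 0 < s -> s < t ->
  (forall x, x < s \/ t < x -> a x = 0) -> test1 b ->
  test2 +oo%E (fun t x => a t * b (x - c * t)).
Proof.
move=> sa s0 st a0 [sb [M HM]]; split; first by apply: wavelike_smooth2; exact: wavelike_prod.
exists s, t, (M + `|c| * t); split=> //; first exact: ltry.
move=> r x h.
have [rs|rs] := ltP r s; first by rewrite a0 ?mul0r//; left.
have [rt|rt] := ltP t r; first by rewrite a0 ?mul0r//; right.
case: h => [|[|h]]; [by rewrite ltNge rs|by rewrite ltNge rt|].
rewrite HM ?mulr0//.
have h1 : `|c * r| <= `|c| * t by rewrite normrM ler_wpM2l// ger0_norm//; lra.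
have h2 : `|x| <= `|x - c * r| + `|c * r|.
  by rewrite -{1}(subrK (c * r) x) ler_normD.
by lra.
Qed.

(** The translation puts the support in [[1, 2]], at positive times, as [test2] requires. *)
Definition pulse (t : R) : R := bump (t + -1).

Lemma pulse_test : test1 pulse. Proof. exact: test1_shift (@bump_test R). Qed.

Lemma pulse_out t : t < 1 \/ 2 < t -> pulse t = 0.
Proof. by move=> [h|h]; apply: bump_out; [left|right]; lra. Qed.

Lemma pulse_mass : intR pulse = 1.
Proof.
rewrite /pulse int_shift ?bump_mass//.
exact: L1_measurable (test1_L1 (@bump_test R)).
Qed.

(** The derivative of the pulse has mean [0]. In the moving frame this eliminates time from the weak
    equations and leaves the stationary term [q]. *)
Lemma pulse_average (p q : R) :
  intR (fun t => - (derive1 pulse t * p) + pulse t * q) = q.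
Proof.
have t1 := pulse_test; have i1 := test1_L1 t1; have i2 := test1_L1 (test1_derive1 t1).
have z : intR (derive1 pulse) = 0.
  have := AC_parts (AC_C1 (@der_cst R 1) (@cont_cst R 0)) t1.
  rewrite (@eq_intR _ _ (derive1 pulse)) => [->|x]; last by rewrite mul1r.
  rewrite (@eq_intR _ _ (fun=> 0)) ?intR_0 ?oppr0// => x; by rewrite mul0r.
rewrite (@eq_intR _ _ (fun t => - p * derive1 pulse t + q * pulse t)); last first.
  by move=> t; ring.
rewrite (intR_D (L1Z (- p) i2) (L1Z q i1)) (intR_Z _ i2) (intR_Z _ i1) z pulse_mass.
by ring.
Qed.

End TravellingTests.

(** * Weak identities between continuous functions *)

Section ContinuousWeak.
Variable R : realType.
Implicit Types (f g h : R -> R).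

Lemma iv_zero_cont h : continuous h -> (forall a b, a <= b -> iv a b h = 0) -> forall x, h x = 0.
Proof.
move=> ch H x.
have x1 : x - 1 < x by lra.
rewrite -(der_derive1 (FTC1c ch x1)); apply: der_derive1.
apply: der_eq (der_cst 0 x) => // y.
have [xy|yx] := leP (x - 1) y; first by rewrite H.
rewrite /iv set_itv_ge ?Rintegral_set0//.
by rewrite bnd_simp -ltNge.
Qed.

Lemma ae_eq_cont f g : continuous f -> continuous g ->
  {ae (@lebesgue_measure R), forall x, f x = g x} -> forall x, f x = g x.
Proof.
move=> cf cg fg x; apply/eqP; rewrite -subr_eq0; apply/eqP.
have cfg : continuous (fun x => f x - g x) by apply: contD => //; exact: contN.
apply: (iv_zero_cont cfg) => a b _; rewrite ivB; [|exact: locint_cont..].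
apply/eqP; rewrite subr_eq0; apply/eqP.
by apply: ae_int => //; apply: measurable_funTS; exact: continuous_measurable_fun.
Qed.

Lemma cont_test_const h : continuous h ->
  (forall psi, test1 psi -> intR (fun x => h x * derive1 psi x) = 0) ->
  exists C, forall x, h x = C.
Proof.
move=> ch H; have [C HC] := du_bois_reymond (continuous_measurable_fun ch) (locint_cont ch) H.
by exists C => x; exact: (ae_eq_cont ch (@cont_cst R C) HC).
Qed.

Lemma smooth_weak_deriv f g : smooth1 f -> L2 g -> weak_deriv f g ->
  {ae (@lebesgue_measure R), forall x, g x = derive1 f x}.
Proof.
move=> sf hg wg.
have c1 := smooth1_continuous (smooth1_derive1 sf).
have l1 := locint_cont c1; have lg := L2_locint hg.
have m : measurable_fun [set: R] (fun x => g x - derive1 f x).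
  by apply: measurable_funB; [exact: L2_measurable|exact: continuous_measurable_fun].
have h : {ae (@lebesgue_measure R), forall x, g x - derive1 f x = 0}.
  apply: test_zero_ae => //; first exact: locintB.
  move=> psi tp.
  rewrite (@eq_intR _ _ (fun x => g x * psi x - derive1 f x * psi x)) => [|x]; last by ring.
  rewrite intR_B; [|exact: L1_test..].
  by have := AC_parts (smooth1_AC sf) tp; rewrite (wg _ tp) => /oppr_inj ->; rewrite subrr.
by apply: (ae_imp h) => x /eqP; rewrite subr_eq0 => /eqP.
Qed.

(* Otherwise [q1], up to the bounded primitive of [k * f ^+ 2], would grow linearly. *)
Lemma no_constant_force (q q1 q2 f r : R -> R) (D k : R) :
  (forall x : R, is_derive x 1 q (q1 x)) -> (forall x : R, is_derive x 1 q1 (q2 x)) ->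
  continuous f -> L2 f -> decay q -> decay r ->
  (forall x, q2 x = D + r x + k * f x ^+ 2) -> D <= 0.
Proof.
move=> d1 d2 cf l2 dq dr E; rewrite leNgt; apply/negP => D0.
have i2 := L2_sqr l2; have cf2 := continuous_sqr cf.
have [p [dp p0 ep]] := primitive_exists cf2.
pose N := intR (fun x => f x ^+ 2).
have N0 : 0 <= N by apply: intR_ge0 => x; exact: sqr_ge0.
have pN a b : a <= b -> `|p b - p a| <= N.
  move=> ab; rewrite ep// ger0_norm; last by apply: iv_ge0 => x _; exact: sqr_ge0.
  by apply: iv_le_intR => // x; exact: sqr_ge0.
have D2 : 0 < D / 2 by lra.
have [X X0 HX] := dr _ D2.
have [Y Y0 HY] := dq _ ltr01.
pose X1 := Num.max X Y.
have XX : X <= X1 by rewrite le_max lexx.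
have YX : Y <= X1 by rewrite le_max lexx orbT.
have low x : X1 <= x -> q1 X1 - `|k| * N + D / 2 * (x - X1) <= q1 x.
  move=> x1.
  have : q1 X1 - k * p X1 - D / 2 * X1 <= q1 x - k * p x - D / 2 * x.
    have dH (z : R) : is_derive z 1 (fun z => q1 z - k * p z - D / 2 * z)
        (D + r z + k * f z ^+ 2 - k * f z ^+ 2 - D / 2 * 1).
      by apply: der_eq (derB (derB (d2 z) (derZ k (dp z))) (derZ (D / 2) (der_id z))) => //; rewrite E.
    have dH' (z : R) : is_derive z 1 (fun z => q1 z - k * p z - D / 2 * z) (D / 2 + r z).
      by apply: der_eq (dH z) => //; field.
    have XIN : forall z, X1 <= z <= x -> 0 <= D / 2 + r z.
      move=> z /andP[z1 _]; have : `|r z| < D / 2.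
        by apply: HX; apply: le_trans (ler_norm _); lra.
      by rewrite ltr_norml; lra.
    have cw : {within `[X1, x], continuous (fun z => q1 z - k * p z - D / 2 * z)}.
      by apply: continuous_subspaceT => z; exact: der_continuous (dH' z).
    move: x1; rewrite le_eqVlt => /orP[/eqP->//|x1].
    have [z zi e] := MVT x1 (fun z _ => dH' z) cw.
    rewrite in_itv/= in zi; case/andP: zi => z1 z2.
    rewrite -subr_ge0 e mulr_ge0//; first by apply: XIN; rewrite !ltW.
    by rewrite subr_ge0 ltW.
  have : - (k * (p x - p X1)) <= `|k| * N.
    apply: le_trans (ler_norm _) _; rewrite normrN normrM; apply: ler_wpM2l => //; exact: pN.
  by lra.
pose b := X1 + (`|q1 X1| + `|k| * N + 2) * (2 / D).
have kN : 0 <= `|k| * N by rewrite mulr_ge0.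
have b1 : X1 <= b by rewrite /b lerDl mulr_ge0// ?divr_ge0 ?(ltW D0)//; have := normr_ge0 (q1 X1); lra.
have big x : b <= x -> 2 <= q1 x.
  move=> bx; apply: le_trans (low _ (le_trans b1 bx)).
  have : D / 2 * (b - X1) <= D / 2 * (x - X1) by rewrite ler_wpM2l ?(ltW D2)//; lra.
  have -> : D / 2 * (b - X1) = `|q1 X1| + `|k| * N + 2 by rewrite /b; field; rewrite gt_eqF.
  have := ler_norm (- q1 X1); rewrite normrN; lra.
have bb : b < b + 1 by lra.
have cw : {within `[b, b + 1], continuous q}.
  by apply: continuous_subspaceT => z; exact: der_continuous (d1 z).
have [z zi e] := MVT bb (fun z _ => d1 z) cw.
rewrite in_itv/= in zi; case/andP: zi => z1 z2.
have := big z (ltW z1); have e' : q (b + 1) - q b = q1 z by rewrite e; ring.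
have : `|q b| < 1 by apply: HY; apply: le_trans (ler_norm _); lra.
have : `|q (b + 1)| < 1 by apply: HY; apply: le_trans (ler_norm _); lra.
by rewrite !ltr_norml; lra.
Qed.

End ContinuousWeak.

(** * The differential equations of a smooth solitary wave *)

Section WaveEquations.
Variables (R : realType) (A sigma c : R) (phi etac : R -> R).
Hypothesis SW : solitary_wave A sigma c phi etac.
Hypothesis sphi : smooth1 phi.
Hypothesis seta : smooth1 etac.
Local Notation phi1 := (derive1 phi).

Let cphi : continuous phi. Proof. exact: smooth1_continuous. Qed.
Let ceta : continuous etac. Proof. exact: smooth1_continuous. Qed.
Let cphi1 : continuous phi1. Proof. exact/smooth1_continuous/smooth1_derive1. Qed.
Lemma H1_smooth (f : R -> R) : smooth1 f -> H1 f -> [/\ L2 f, L2 (derive1 f) & decay f].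
Proof.
move=> sf [l2 [g [lg wg]]]; have m1 := continuous_measurable_fun (smooth1_continuous (smooth1_derive1 sf)).
have l1 : L2 (derive1 f) by exact: L2_ae m1 (smooth_weak_deriv sf lg wg) lg.
by split=> //; exact: sobolev_decay (smooth1_AC sf) l2 l1.
Qed.

Let hphi : [/\ L2 phi, L2 phi1 & decay phi].
Proof. by case: SW => -[h _] _ _ _; exact: H1_smooth. Qed.
Let heta : [/\ L2 etac, L2 (derive1 etac) & decay etac].
Proof. by case: SW => -[_ h] _ _ _; exact: H1_smooth. Qed.

Definition source (y : R) : R := - A * phi y + (3 - sigma) / 2 * phi y ^+ 2
  + sigma / 2 * phi1 y ^+ 2 + (1 + etac y) ^+ 2 / 2.

Lemma source_cont : continuous source.
Proof.
apply: contD; [apply: contD; [apply: contD|]|].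
- by apply: contM; [exact: cont_cst|].
- by apply: contM; [exact: cont_cst|exact: contX].
- by apply: contM; [exact: cont_cst|exact: contX].
- apply: contM; last exact: cont_cst.
  by apply: contX; apply: contD; [exact: cont_cst|].
Qed.

Lemma source_L1 : L1 (fun y => expR (- `|y|) * source y).
Proof.
have [p2 p12 _] := hphi; have [e2 _ _] := heta.
have x1 := @L1_exp_norm R; have x2 := @L2_exp_norm R.
have lin : L2 (fun y => - A * phi y + etac y) by apply: L2D => //; exact: L2Z.
have quad : L1 (fun y => (3 - sigma) / 2 * phi y ^+ 2 + sigma / 2 * phi1 y ^+ 2 + 1 / 2 * etac y ^+ 2).
  by apply: L1D; [apply: L1D|]; apply: L1Z; exact: L2_sqr.
apply: (@eq_L1 _ (fun y => (expR (- `|y|) * (- A * phi y + etac y) +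
    expR (- `|y|) * ((3 - sigma) / 2 * phi y ^+ 2 + sigma / 2 * phi1 y ^+ 2 + 1 / 2 * etac y ^+ 2))
    + 1 / 2 * expR (- `|y|))).
  by move=> y; rewrite /source; field.
apply: L1D; last exact: L1Z.
apply: L1D; first exact: L2M.
apply: (@L1_mulb _ _ _ 1) => //; first exact: L1_measurable.
by move=> y; rewrite ger0_norm ?expR_ge0// -(@expR0 R) ler_expR oppr_le0.
Qed.

Lemma conv_source_cont : continuous (conv_p source).
Proof.
have [S1 [d _]] := conv_p_ode source_cont source_L1.
by move=> x; exact: der_continuous (d x).
Qed.

Let L1_ct (f b : R -> R) : continuous f -> test1 b -> L1 (fun x => f x * b x).
Proof. by move=> cf; apply: L1_test; exact: locint_cont. Qed.

Let wave_test b : test1 b -> test2 +oo%E (fun t x => pulse t * b (x - c * t)).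
Proof.
have [sa _] := @pulse_test R; have h1 : (0 : R) < 1 by exact: ltr01.
have h2 : (1 : R) < 2 by lra.
move=> tb; exact (@wave_test2 R c _ b _ _ sa h1 h2 (@pulse_out R) tb).
Qed.

(** On the test function [pulse t * b (x - c t)], translated to the moving frame, the inner integral
    becomes a combination of two fixed integrals with coefficients depending on [t] alone. *)
Lemma mass_flux b : test1 b ->
  intR (fun x => (c * etac x - (1 + etac x) * phi x) * derive1 b x) = 0.
Proof.
move=> tb; have [_ _ _ [ux [_ _ _ H4 _]]] := SW.
have sb : smooth1 b by case: tb.
have sa : smooth1 (@pulse R) by case: (@pulse_test R).
have := H4 _ (wave_test tb); rewrite pt_prod// px_prod// => <-.
set q := intR _; pose p := intR (fun x => etac x * b x).
rewrite -[LHS](pulse_average p q); apply: eq_intR => t.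
have tb' := test1_derive1 tb.
have i1 := L1_ct ceta tb.
have i2 : L1 (fun x => (c * etac x - (1 + etac x) * phi x) * derive1 b x).
  apply: L1_ct => //; apply: contD; last apply: contN; apply: contM => //; first exact: cont_cst.
  by apply: contD => //; exact: cont_cst.
pose G x := - (derive1 (@pulse R) t) * (etac x * b x) +
   pulse t * ((c * etac x - (1 + etac x) * phi x) * derive1 b x).
have iG : L1 G by apply: L1D; exact: L1Z.
rewrite (@eq_intR _ _ (fun x => G (x + - (c * t)))); last by move=> x; rewrite /G; ring.
rewrite int_shift; last exact: L1_measurable.
by rewrite /G intR_D; [rewrite (intR_Z _ i1) (intR_Z _ i2); rewrite /p /q; ring|exact: L1Z..].
Qed.

Lemma momentum_flux b : test1 b ->
  intR (fun x => c * phi x * derive1 b x + sigma * phi x * phi1 x * b x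
                 - conv_p source x * derive1 b x) = 0.
Proof.
move=> tb; have [_ _ _ [ux [H1 _ H3 _ _]]] := SW.
have sb : smooth1 b by case: tb.
have sa : smooth1 (@pulse R) by case: (@pulse_test R).
have := H3 _ (wave_test tb); rewrite pt_prod// px_prod// => <-.
set q := intR _; pose p := intR (fun x => phi x * b x).
rewrite -[LHS](pulse_average p q); apply: eq_intR => t.
have tb' := test1_derive1 tb; have cS := conv_source_cont.
have i1 := L1_ct cphi tb.
have i2 : L1 (fun x => c * phi x * derive1 b x + sigma * phi x * phi1 x * b x
                 - conv_p source x * derive1 b x).
  apply: L1B; last exact: L1_ct.
  by apply: L1D; apply: L1_ct => //; repeat (apply: contM => //); exact: cont_cst.
pose G x := - (derive1 (@pulse R) t) * (phi x * b x) +
   pulse t * (c * phi x * derive1 b x + sigma * phi x * phi1 x * b x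
                 - conv_p source x * derive1 b x).
have iG : L1 G by apply: L1D; exact: L1Z.
have -> : - (derive1 (@pulse R) t * p) + pulse t * q = intR (fun x => G (x + - (c * t))).
  rewrite int_shift; last exact: L1_measurable.
  by rewrite /G intR_D; [rewrite (intR_Z _ i1) (intR_Z _ i2); rewrite /p /q; ring|exact: L1Z..].
(* The slope [ux] is known only for [t >= 0]; at negative times the test function and its
   derivatives vanish. *)
have [t0|t0] := leP 0 t; last first.
  have pz : pulse t = 0 by apply: pulse_out; left; lra.
  have pz' : derive1 (@pulse R) t = 0.
    apply: (@interior_min_derive0 _ (@pulse R) (derive1 (@pulse R)) (t - 1) (t + 1) t).
    - by move=> x; exact: smooth1_der.
    - by apply/andP; split; lra.
    - move=> x /andP[_ x1]; rewrite pz; rewrite pulse_out//; left; lra.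
  by apply: eq_intR => x; rewrite /G pz pz'; ring.
have [l2 [lux [wux _]]] := H1 t (conj t0 (ltry _)).
have sft : smooth1 (fun x => phi (x - c * t)) by exact: smooth1_shift.
(* [ux t] is some weak derivative, equal to the translated [phi1] only almost everywhere; the
   convolution is therefore compared under the integral sign. *)
have aeu : {ae (@lebesgue_measure R), forall x, ux t x = phi1 (x + - (c * t))}.
  apply: (ae_imp (smooth_weak_deriv sft lux wux)) => x ->.
  exact: derive1_shift.
have mS (f : R -> R) : continuous f -> measurable_fun [set: R] (fun x => f (x - c * t)).
  by move=> cf; apply: continuous_measurable_fun; apply: cont_comp => //; apply: contD;
    [exact: cont_id|exact: cont_cst].
have mux := L2_measurable lux.
have convE x : conv_p (fun y => - A * phi (y - c * t) + (3 - sigma) / 2 * phi (y - c * t) ^+ 2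
    + sigma / 2 * ux t y ^+ 2 + (1 + etac (y - c * t)) ^+ 2 / 2) x = conv_p source (x - c * t).
  rewrite /conv_p.
  have iK : measurable_fun [set: R] (fun y => pker (x - c * t - y) * source y).
    apply: continuous_measurable_fun; apply: contM; last exact: source_cont.
    apply: (cont_comp (@pker_cont R)); apply: contD; [exact: cont_cst|apply: contN; exact: cont_id].
  rewrite -(int_shift (- (c * t)) iK); apply: ae_intR.
  - apply: measurable_funM.
      apply: continuous_measurable_fun; apply: (cont_comp (@pker_cont R)).
      by apply: contD; [exact: cont_cst|apply: contN; exact: cont_id].
    apply: measurable_funD; last by apply: measurable_funM => //; apply: measurable_funX;
      apply: measurable_funD => //; exact: mS.
    apply: measurable_funD; last by apply: measurable_funM => //; exact: measurable_funX.
    apply: measurable_funD; apply: measurable_funM => //; first exact: mS.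
    by apply: measurable_funX; exact: mS.
  - exact: (measurable_shift (- (c * t)) iK).
  - apply: (ae_imp aeu) => y ->; rewrite /source.
    by congr (pker _ * _); ring.
have mb : measurable_fun [set: R] (fun x => b (x - c * t)) by apply: mS; exact: smooth1_continuous.
have mb' : measurable_fun [set: R] (fun x => derive1 b (x - c * t)).
  by apply: mS; apply: smooth1_continuous; exact: smooth1_derive1.
apply: ae_intR.
- have -> : (fun x => G (x + - (c * t))) = (fun x => G (x - c * t)) by [].
  exact: measurable_shift (L1_measurable iG).
- apply: measurable_funB.
    apply: measurable_funD.
      apply: measurable_funM; first by apply: measurableT_comp => //; exact: mS.
      by apply: measurable_funD; apply: measurable_funM.
    apply: measurable_funM; last exact: measurable_funM.
    by apply: measurable_funM => //; apply: measurable_funM => //; exact: mS.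
  apply: measurable_funM; last exact: measurable_funM.
  by rewrite (_ : conv_p _ = (fun x => conv_p source (x - c * t))); [exact: mS|apply/funext].
- by apply: (ae_imp aeu) => x ->; rewrite convE /G; ring.
Qed.

Lemma mass_balance x : (c - phi x) * etac x = phi x.
Proof.
have [_ _ dp] := hphi; have [_ _ de] := heta.
pose h x := c * etac x - (1 + etac x) * phi x.
have ch : continuous h.
  apply: contD; last apply: contN; apply: contM => //; first exact: cont_cst.
  by apply: contD => //; exact: cont_cst.
have [C HC] := cont_test_const ch mass_flux.
have dh : decay h.
  have [Cp Cp0 HCp] := continuous_decay_bounded cphi dp.
  have d1 : decay (fun x => (c - phi x) * etac x).
    apply: (decay_le de (C := `|c| + Cp)) => y.
    by rewrite normrM ler_wpM2r// (le_trans (ler_normB _ _))// lerD2l.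
  have d2 : decay (fun x => - phi x).
    by apply: (decay_le dp (C := 1)) => y; rewrite normrN mul1r.
  move=> e e0; have [r r0 Hr] := decayD d1 d2 e0; exists r => // y ry.
  by have := Hr y ry; congr (`|_| < _); rewrite /h; ring.
have C0 := decay_const dh HC.
by have := HC x; rewrite C0 /h; lra.
Qed.

(** The constant is not [0]: the source contains the summand [1 / 2], which a kernel of mass [1]
    reproduces. Its value is fixed in [wave_stationary]. *)
Lemma momentum_balance : exists C, forall x,
  conv_p source x = c * phi x - sigma / 2 * phi x ^+ 2 + C.
Proof.
pose F x := c * phi x - sigma / 2 * phi x ^+ 2 - conv_p source x.
have cS := conv_source_cont.
have cQ : continuous (fun x => c * phi x).
  by apply: contM => //; exact: cont_cst.
have cF : continuous F.
  apply: contD; last exact: contN.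
  apply: contD => //; apply: contN; apply: contM; first exact: cont_cst.
  exact: contX.
have H b : test1 b -> intR (fun x => F x * derive1 b x) = 0.
  move=> tb; rewrite -(momentum_flux tb).
  have tb' := test1_derive1 tb.
  have c2 := continuous_sqr cphi.
  have c3 : continuous (fun x => 2 * phi x * phi1 x).
    by apply: contM => //; apply: contM => //; exact: cont_cst.
  have P := AC_parts (AC_sqr (smooth1_AC sphi)) tb.
  rewrite (@eq_intR _ _ (fun x => (c * phi x * derive1 b x - conv_p source x * derive1 b x)
    - sigma / 2 * (phi x ^+ 2 * derive1 b x))); last by move=> x; rewrite /F; ring.
  have i1 := L1_ct cQ tb'; have i2 := L1_ct cS tb'.
  have i3 := L1_ct c2 tb'; have i4 := L1_ct c3 tb.
  rewrite intR_B; [|exact: L1B|exact: L1Z].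
  rewrite (intR_Z _ i3) P mulrN opprK -(intR_Z _ i4) -intR_D; [|exact: L1B|exact: L1Z].
  by apply: eq_intR => x; field.
have [C HC] := cont_test_const cF H.
by exists (- C) => x; rewrite -(HC x) /F; ring.
Qed.

Lemma wave_stationary :
  stationary A sigma c phi phi1 (derive1 phi1) etac (derive1 etac).
Proof.
have [lp lp1 dp] := hphi; have [_ _ de] := heta.
have d1 (x : R) : is_derive x 1 phi (phi1 x) by exact: smooth1_der.
have d2 (x : R) : is_derive x 1 phi1 (derive1 phi1 x) by exact/smooth1_der/smooth1_derive1.
have d3 (x : R) : is_derive x 1 etac (derive1 etac x) by exact: smooth1_der.
have [C HC] := momentum_balance.
have [S1 [e1 e2]] := conv_p_ode source_cont source_L1.
pose Q x := c * phi x - sigma / 2 * phi x ^+ 2.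
pose Q1 x := (c - sigma * phi x) * phi1 x.
pose Q2 x := (c - sigma * phi x) * derive1 phi1 x - sigma * phi1 x ^+ 2.
have dQ (x : R) : is_derive x 1 Q (Q1 x).
  apply: der_eq (derB (derZ c (d1 x)) (derZ (sigma / 2) (derX 2 (d1 x)))) => //=.
  by rewrite expr1 /Q1; field.
have dQ1 (x : R) : is_derive x 1 Q1 (Q2 x).
  apply: der_eq (derM (derB (der_cst c x) (derZ sigma (d1 x))) (d2 x)) => //=.
  by rewrite /Q2; ring.
have S1E x : S1 x = Q1 x.
  rewrite -(der_derive1 (e1 x)); apply: der_derive1.
  by apply: der_eq (derD (dQ x) (der_cst C x)) => [y|]; rewrite ?HC ?addr0.
have Q2E x : Q2 x = conv_p source x - source x.
  rewrite -(der_derive1 (dQ1 x)); apply: der_derive1.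
  by apply: der_eq (e2 x) => // y; rewrite S1E.
pose r x := ((c + A) * phi x - 3 / 2 * phi x ^+ 2) + (- etac x - etac x ^+ 2 / 2).
have EQ x : Q2 x = (C - 1 / 2) + r x + - (sigma / 2) * phi1 x ^+ 2.
  by rewrite Q2E HC /source /r; field.
have cpoly (a b : R) : continuous (fun s : R => a * s + b * s ^+ 2).
  by apply: contD; apply: contM; [exact: cont_cst|exact: cont_id|exact: cont_cst|apply: contX; exact: cont_id].
have dpoly (a b : R) (U : R -> R) : decay U -> decay (fun x => a * U x + b * U x ^+ 2).
  move=> dU; apply: (decay_comp (F := fun s => a * s + b * s ^+ 2) dU).
    exact: cpoly.
  by rewrite expr0n/= !mulr0 addr0.
have decay_eq (f g : R -> R) : (forall x, f x = g x) -> decay f -> decay g.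
  by move=> fg df e e0; have [q q0 Hq] := df e e0; exists q => // x qx; rewrite -fg Hq.
have dr : decay r.
  apply: decay_eq (decayD (dpoly (c + A) (- (3 / 2)) _ dp) (dpoly (-1) (- (1 / 2)) _ de)) => x.
  by rewrite /r; field.
have dQd : decay Q.
  by apply: decay_eq (dpoly c (- (sigma / 2)) _ dp) => x; rewrite /Q; ring.
(* Applied to [Q] here and to [- Q] below, [no_constant_force] gives both inequalities, hence
   [C = 1 / 2]. *)
have D1 := no_constant_force dQ dQ1 cphi1 lp1 dQd dr EQ.
have decN (f : R -> R) : decay f -> decay (fun x => - f x).
  by move=> df; apply: (decay_le df (C := 1)) => x; rewrite normrN mul1r.
have EQN x : - Q2 x = - (C - 1 / 2) + - r x + sigma / 2 * phi1 x ^+ 2 by rewrite EQ; ring.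
have D2 := no_constant_force (fun x => derN (dQ x)) (fun x => derN (dQ1 x)) cphi1 lp1
  (decN _ dQd) (decN _ dr) EQN.
split=> //.
- by apply: smooth1_continuous; apply: smooth1_derive1; exact: smooth1_derive1.
- exact: mass_balance.
- move=> x; have := EQ x; have -> : C - 1 / 2 = 0 by lra.
  by rewrite /Q2 /r; lra.
- by case: SW.
Qed.

End WaveEquations.

(** * Orbital stability *)

Section PhaseSpace.
Variable R : realType.
Implicit Types (f g v U : R -> R).

Definition state f g v : Prop := [/\ L2 f, L2 g, weak_deriv f g & L2 v].

(** The squared distance of [X] computed with given derivatives, whereas [distX_lt] quantifies over
    them; uniqueness of weak derivatives reconciles the two. *)
Definition gap2 f g v f' g' v' : R :=
  intR (fun x => (f x - f' x) ^+ 2 + (g x - g' x) ^+ 2 + (v x - v' x) ^+ 2).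

Lemma L1_gap2 f g v f' g' v' : L2 f -> L2 g -> L2 v -> L2 f' -> L2 g' -> L2 v' ->
  L1 (fun x => (f x - f' x) ^+ 2 + (g x - g' x) ^+ 2 + (v x - v' x) ^+ 2).
Proof. by move=> *; apply: L1_energy; exact: L2B. Qed.

Lemma state_shift f g v s : state f g v ->
  state (fun x => f (x - s)) (fun x => g (x - s)) (fun x => v (x - s)).
Proof.
move=> [lf lg w lv]; split; [exact: L2_shift lf|exact: L2_shift lg| |exact: L2_shift lv].
exact: weak_deriv_shift.
Qed.

Lemma stateN f g v : state f g v -> state (fun x => - f x) (fun x => - g x) v.
Proof.
move=> [lf lg w lv]; split=> //; [exact: L2N|exact: L2N|].
move=> psi tp; have := weak_derivZ (-1) lf lg w tp.
rewrite (@eq_intR _ _ (fun x => - f x * derive1 psi x)); last by move=> x; ring.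
move=> ->; congr (- _); apply: eq_intR => x; ring.
Qed.

Lemma dist_gap2 f g v f' g' v' e : state f g v -> state f' g' v' ->
  distX_lt (f, v) (f', v') e <-> gap2 f g v f' g' v' < e ^+ 2.
Proof.
move=> [lf lg w lv] [lf' lg' w' lv']; split.
  move=> [h [lh [wh H]]]; apply: le_lt_trans H => /=.
  have ae := weak_deriv_uniq (L2B lg lg') lh (weak_derivB lf lf' lg lg' w w') wh.
  rewrite le_eqVlt; apply/orP; left; apply/eqP; apply: ae_intR.
  - exact: L1_measurable (L1_gap2 lf lg lv lf' lg' lv').
  - exact: L1_measurable (L1_energy (L2B lf lf') lh (L2B lv lv')).
  - by apply: (ae_imp ae) => x ->.
move=> H; exists (fun x => g x - g' x); split; [exact: L2B|split=> //].
exact: weak_derivB.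
Qed.

Lemma gap2C f g v f' g' v' : gap2 f g v f' g' v' = gap2 f' g' v' f g v.
Proof. by apply: eq_intR => x; ring. Qed.

(** [(a + b) ^ 2 <= 2 a ^ 2 + 2 b ^ 2] under the integral stands in for the triangle inequality and
    avoids square roots. *)
Lemma gap2_tri f g v f' g' v' f'' g'' v'' : state f g v -> state f' g' v' ->
  state f'' g'' v'' ->
  gap2 f g v f'' g'' v'' <= 2 * gap2 f g v f' g' v' + 2 * gap2 f' g' v' f'' g'' v''.
Proof.
move=> [lf lg _ lv] [lf' lg' _ lv'] [lf'' lg'' _ lv''].
have i1 := L1_gap2 lf lg lv lf' lg' lv'; have i2 := L1_gap2 lf' lg' lv' lf'' lg'' lv''.
rewrite /gap2 -(intR_Z 2 i1) -(intR_Z 2 i2) -intR_D; [|exact: L1Z|exact: L1Z].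
apply: intR_mono; [exact: L1_gap2|by apply: L1D; exact: L1Z|] => x.
have := sqr_ge0 ((f x - f' x) - (f' x - f'' x)).
have := sqr_ge0 ((g x - g' x) - (g' x - g'' x)).
have := sqr_ge0 ((v x - v' x) - (v' x - v'' x)).
lra.
Qed.

Lemma gap2_shift f g v f' g' v' s : L2 f -> L2 g -> L2 v -> L2 f' -> L2 g' -> L2 v' ->
  gap2 (fun x => f (x + s)) (fun x => g (x + s)) (fun x => v (x + s)) f' g' v' =
  gap2 f g v (fun x => f' (x - s)) (fun x => g' (x - s)) (fun x => v' (x - s)).
Proof.
move=> lf lg lv lf' lg' lv'.
have i1 := L1_gap2 lf lg lv (L2_shift (- s) lf') (L2_shift (- s) lg') (L2_shift (- s) lv').
rewrite /gap2 -[RHS](int_shift s (L1_measurable i1)); apply: eq_intR => x.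
by rewrite !addrK.
Qed.

Lemma Efun_ae f f' g v : L2 f -> L2 f' -> L2 g -> L2 v ->
  {ae (@lebesgue_measure R), forall x, f x = f' x} -> Efun f g v = Efun f' g v.
Proof.
move=> lf lf' lg lv ae; congr (_ / 2); apply: ae_intR.
- exact: L1_measurable (L1_energy lf lg lv).
- exact: L1_measurable (L1_energy lf' lg lv).
- by apply: (ae_imp ae) => x ->.
Qed.

Lemma flux_measurable (A sigma : R) f g v : L2 f -> L2 g -> L2 v ->
  measurable_fun [set: R] (fun x => f x ^+ 3 + sigma * f x * g x ^+ 2 + 2 * f x * v x
                 + f x * v x ^+ 2 - A * f x ^+ 2).
Proof.
move=> /L2_measurable mf /L2_measurable mg /L2_measurable mv.
apply: measurable_funB; last by apply: measurable_funM => //; exact: measurable_funX.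
apply: measurable_funD; last by apply: measurable_funM => //; exact: measurable_funX.
apply: measurable_funD; last by apply: measurable_funM => //; exact: measurable_funM.
apply: measurable_funD; first exact: measurable_funX.
by apply: measurable_funM; [exact: measurable_funM|exact: measurable_funX].
Qed.

Lemma Ffun_ae A sigma f f' g v : L2 f -> L2 f' -> L2 g -> L2 v ->
  {ae (@lebesgue_measure R), forall x, f x = f' x} ->
  Ffun A sigma f g v = Ffun A sigma f' g v.
Proof.
move=> lf lf' lg lv ae; congr (_ / 2); apply: ae_intR.
- exact: flux_measurable.
- exact: flux_measurable.
- by apply: (ae_imp ae) => x ->.
Qed.

Lemma Efun_shift f g v s : L2 f -> L2 g -> L2 v ->
  Efun (fun x => f (x + s)) (fun x => g (x + s)) (fun x => v (x + s)) = Efun f g v.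
Proof.
move=> lf lg lv; congr (_ / 2).
exact: (int_shift s (L1_measurable (L1_energy lf lg lv))).
Qed.

Lemma Ffun_shift A sigma f g v s : L2 f -> L2 g -> L2 v ->
  Ffun A sigma (fun x => f (x + s)) (fun x => g (x + s)) (fun x => v (x + s))
  = Ffun A sigma f g v.
Proof.
move=> lf lg lv; congr (_ / 2).
exact: (int_shift s (flux_measurable A sigma lf lg lv)).
Qed.

Lemma gap2_ae f f' g v h k w : L2 f -> L2 f' -> L2 g -> L2 v -> L2 h -> L2 k -> L2 w ->
  {ae (@lebesgue_measure R), forall x, f x = f' x} -> gap2 f g v h k w = gap2 f' g v h k w.
Proof.
move=> lf lf' lg lv lh lk lw ae; apply: ae_intR.
- exact: L1_measurable (L1_gap2 lf lg lv lh lk lw).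
- exact: L1_measurable (L1_gap2 lf' lg lv lh lk lw).
- by apply: (ae_imp ae) => x ->.
Qed.

Lemma AC_rep f g v : state f g v ->
  exists U, [/\ AC U g, L2 U & {ae (@lebesgue_measure R), forall x, f x = U x}].
Proof.
move=> [lf lg w lv]; have [U aU ae] := weak_deriv_AC lf lg w.
exists U; split=> //; apply: L2_ae ae lf.
by apply: continuous_measurable_fun; exact: AC_continuous aU.
Qed.

Lemma gap2_sup U g v h k w x : AC U g -> L2 U -> L2 g -> L2 v ->
  AC h k -> L2 h -> L2 k -> L2 w -> (U x - h x) ^+ 2 <= 2 * gap2 U g v h k w.
Proof.
move=> aU lU lg lv ah lh lk lw.
have a := AC_B aU ah; have l1 := L2B lU lh; have l2 := L2B lg lk.
apply: le_trans (sobolev_sup x a l1 l2) _.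
rewrite ler_pM2l//; apply: intR_mono; [|exact: L1_gap2|by move=> y; rewrite lerDl sqr_ge0].
by apply: L1D; exact: L2_sqr.
Qed.

End PhaseSpace.

(** Bookkeeping for the seven terms of [a] in [flux_diff], with [10 = 3 + 3 + 1 + 2 + 1]. *)
Lemma norm_comb (R : realFieldType) (T Ts Ta x1 x2 x3 x4 x5 x6 x7 : R) :
  `|x1| <= T -> `|x2| <= T -> `|x3| <= T -> `|x4| <= Ts -> `|x5| <= T -> `|x6| <= T ->
  `|x7| <= Ta ->
  `|3 * x1 + 3 * x2 + x3 + x4 + 2 * x5 + x6 - x7| <= 10 * T + Ts + Ta.
Proof.
rewrite !ler_norml.
move=> /andP[? ?] /andP[? ?] /andP[? ?] /andP[? ?] /andP[? ?] /andP[? ?] /andP[? ?].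
by apply/andP; split; lra.
Qed.

(** * Continuity of the conserved functionals at the wave *)

Section Continuity.
Variables (R : realType) (A sigma : R).

(** [X] measures the wave and [Y] the perturbation. In each cubic term some factor is bounded, by
    [B] or by [|D| <= 1], so the difference is dominated by quadratic expressions, which are
    integrable. *)
Lemma flux_diff (B p q r D e n X Y : R) : `|D| <= 1 -> 0 <= B ->
  X = `|p| + `|q| + `|r| -> Y = `|D| + `|e| + `|n| -> X <= B ->
  `|((p + D) ^+ 3 + sigma * (p + D) * (q + e) ^+ 2 + 2 * (p + D) * (r + n)
      + (p + D) * (r + n) ^+ 2 - A * (p + D) ^+ 2)
    - (p ^+ 3 + sigma * p * q ^+ 2 + 2 * p * r + p * r ^+ 2 - A * p ^+ 2)|
  <= (10 * (B + 1) * (1 + `|sigma| + `|A|)) * (Y * (X + Y)).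
Proof.
move=> D1 B0 EX EY XB.
pose a := 3 * p * p + 3 * p * D + D * D + sigma * q * q + 2 * r + r * r - A * (2 * p + D).
pose b := sigma * (p + D) * (2 * q + e).
pose d := 2 * (p + D) + (p + D) * (2 * r + n).
have -> : ((p + D) ^+ 3 + sigma * (p + D) * (q + e) ^+ 2 + 2 * (p + D) * (r + n)
      + (p + D) * (r + n) ^+ 2 - A * (p + D) ^+ 2)
    - (p ^+ 3 + sigma * p * q ^+ 2 + 2 * p * r + p * r ^+ 2 - A * p ^+ 2)
   = D * a + e * b + n * d by rewrite /a /b /d; ring.
set K := 10 * (B + 1) * (1 + `|sigma| + `|A|).
pose T := (B + 1) * (X + Y); pose S := `|sigma| * T; pose V := `|A| * T.
have KE : K * (X + Y) = 10 * T + 10 * S + 10 * V by rewrite /K /S /V /T; ring.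
have P0 := normr_ge0 p; have Q0 := normr_ge0 q; have R0 := normr_ge0 r.
have d0 := normr_ge0 D; have e0 := normr_ge0 e; have n0 := normr_ge0 n.
have [X0 [pX [qX rX]]] : 0 <= X /\ `|p| <= X /\ `|q| <= X /\ `|r| <= X.
  by rewrite EX; move: P0 Q0 R0; clear -A; lra.
have [Y0 [DY [eY nY]]] : 0 <= Y /\ `|D| <= Y /\ `|e| <= Y /\ `|n| <= Y.
  by rewrite EY; move: d0 e0 n0; clear -A; lra.
have XY0 : 0 <= X + Y by rewrite addr_ge0.
have B1 : 0 <= B + 1 by rewrite addr_ge0.
have T0 : 0 <= T by exact: mulr_ge0.
have S0 : 0 <= S by exact: mulr_ge0.
have V0 : 0 <= V by exact: mulr_ge0.
have XYT : X + Y <= T by rewrite /T ler_peMl// lerDr.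
have pD : `|p + D| <= B + 1.
  by apply: le_trans (ler_normD _ _) _; apply: lerD => //; exact: le_trans XB.
have pD' : `|p + D| <= X + Y by apply: le_trans (ler_normD _ _) _; exact: lerD.
have two (x y : R) : `|x| <= X -> `|y| <= Y -> `|2 * x + y| <= 2 * (X + Y).
  move=> hx hy; apply: le_trans (ler_normD _ _) _; rewrite normrM ger0_norm//.
  by move: hx hy X0 Y0; clear -A; lra.
have mm (u w : R) : `|u| <= B + 1 -> `|w| <= X + Y -> `|u * w| <= T.
  by move=> hu hw; rewrite normrM; apply: ler_pM.
have xB (x : R) : `|x| <= X -> `|x| <= B + 1.
  by move=> h; apply: le_trans h _; apply: le_trans XB _; rewrite lerDl.
have DB : `|D| <= B + 1 by apply: le_trans D1 _; rewrite lerDr.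
have xXY (x : R) : `|x| <= X -> `|x| <= X + Y by move=> h; apply: le_trans h _; rewrite lerDl.
have yXY (x : R) : `|x| <= Y -> `|x| <= X + Y by move=> h; apply: le_trans h _; rewrite lerDr.
have h1 : `|a| <= K * (X + Y).
  have t1 : `|p * p| <= T by apply: mm; [exact: xB|exact: xXY].
  have t2 : `|p * D| <= T by apply: mm; [exact: xB|exact: yXY].
  have t3 : `|D * D| <= T by apply: mm; [exact: DB|exact: yXY].
  have t4 : `|q * q| <= T by apply: mm; [exact: xB|exact: xXY].
  have t5 : `|r * r| <= T by apply: mm; [exact: xB|exact: xXY].
  have t6 : `|sigma * (q * q)| <= S by rewrite normrM ler_wpM2l.
  have t7 : `|A * (2 * p + D)| <= 2 * V.
    rewrite normrM /V mulrCA ler_wpM2l//; apply: le_trans (two _ _ pX DY) _.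
    by rewrite ler_pM2l.
  have t9 : `|r| <= T by apply: le_trans XYT; exact: xXY.
  have -> : a = 3 * (p * p) + 3 * (p * D) + D * D + sigma * (q * q) + 2 * r + r * r
    - A * (2 * p + D) by rewrite /a; ring.
  apply: le_trans (norm_comb t1 t2 t3 t6 t9 t5 t7) _; rewrite KE.
  by move: T0 S0 V0; clear -A; lra.
have h2 : `|b| <= K * (X + Y).
  rewrite /b !normrM KE; apply: (@le_trans _ _ (`|sigma| * (B + 1) * (2 * (X + Y)))).
    by apply: ler_pM; [exact: mulr_ge0| |exact: ler_wpM2l|exact: two].
  have -> : `|sigma| * (B + 1) * (2 * (X + Y)) = 2 * S by rewrite /S /T; ring.
  by move: T0 S0 V0; clear -A; lra.
have h3 : `|d| <= K * (X + Y).
  have t2 : `|(p + D) * (2 * r + n)| <= (B + 1) * (2 * (X + Y)).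
    by rewrite normrM; apply: ler_pM => //; exact: two.
  have -> : K * (X + Y) = 2 * T + (B + 1) * (2 * (X + Y)) + (6 * T + 10 * S + 10 * V).
    by rewrite KE /T; ring.
  apply: le_trans (ler_normD _ _) _; rewrite [X in X + _]normrM ger0_norm//.
  apply: ler_wpDr; first by move: T0 S0 V0; clear -A; lra.
  by apply: lerD => //; rewrite ler_pM2l//; exact: le_trans XYT.
have k1 : `|D * a| <= `|D| * (K * (X + Y)) by rewrite normrM; exact: ler_wpM2l.
have k2 : `|e * b| <= `|e| * (K * (X + Y)) by rewrite normrM; exact: ler_wpM2l.
have k3 : `|n * d| <= `|n| * (K * (X + Y)) by rewrite normrM; exact: ler_wpM2l.
have -> : K * (Y * (X + Y)) =
    `|D| * (K * (X + Y)) + `|e| * (K * (X + Y)) + `|n| * (K * (X + Y)).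
  by rewrite {1}EY; ring.
exact: le_trans (ler_normD _ _) (lerD (le_trans (ler_normD _ _) (lerD k1 k2)) k3).
Qed.

Lemma energy_diff (p q r D e n : R) :
  `|((p + D) ^+ 2 + (q + e) ^+ 2 + (r + n) ^+ 2) - (p ^+ 2 + q ^+ 2 + r ^+ 2)| <=
  2 * ((`|D| + `|e| + `|n|) * ((`|p| + `|q| + `|r|) + (`|D| + `|e| + `|n|))).
Proof.
have -> : ((p + D) ^+ 2 + (q + e) ^+ 2 + (r + n) ^+ 2) - (p ^+ 2 + q ^+ 2 + r ^+ 2)
  = D * (2 * p + D) + e * (2 * q + e) + n * (2 * r + n) by ring.
have H (x y Z : R) : `|x| + `|y| <= Z -> `|y * (2 * x + y)| <= `|y| * (2 * Z).
  move=> h; rewrite normrM ler_wpM2l//; apply: le_trans (ler_normD _ _) _.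
  by rewrite normrM ger0_norm//; have := normr_ge0 y; lra.
set Z := `|p| + `|q| + `|r| + _.
have -> : 2 * ((`|D| + `|e| + `|n|) * Z) = `|D| * (2 * Z) + `|e| * (2 * Z) + `|n| * (2 * Z) by ring.
apply: le_trans (ler_normD _ _) _.
have P0 := normr_ge0 p; have Q0 := normr_ge0 q; have R0 := normr_ge0 r.
have d0 := normr_ge0 D; have e0 := normr_ge0 e; have n0 := normr_ge0 n.
by apply: lerD; first (apply: le_trans (ler_normD _ _) _; apply: lerD); apply: H;
  rewrite /Z; move: P0 Q0 R0 d0 e0 n0; clear -A; lra.
Qed.

(** The parameter [lam] weights the mixed product [X Y]: the wave part [w], whose integral is fixed,
    can be given a small factor before [q] is made small. *)
Lemma young_split (X Y w q lam : R) : 0 < lam -> X ^+ 2 <= 3 * w -> Y ^+ 2 <= 3 * q ->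
  Y * (X + Y) <= 3 * (lam * w + (1 + lam^-1) * q).
Proof.
move=> l0 hX hY; have lV : 0 < lam^-1 by rewrite invr_gt0.
have h1 : lam * X ^+ 2 <= lam * (3 * w) by rewrite ler_pM2l.
have h2 : (1 + lam^-1) * Y ^+ 2 <= (1 + lam^-1) * (3 * q) by rewrite ler_pM2l// addr_gt0.
have h3 : 2 * (X * Y) <= lam * X ^+ 2 + lam^-1 * Y ^+ 2.
  rewrite -subr_ge0.
  have -> : lam * X ^+ 2 + lam^-1 * Y ^+ 2 - 2 * (X * Y) = lam * (X - lam^-1 * Y) ^+ 2.
    by field; rewrite gt_eqF.
  by rewrite mulr_ge0 ?sqr_ge0// ltW.
have : 0 <= lam * X ^+ 2 + lam^-1 * Y ^+ 2.
  by rewrite addr_ge0// mulr_ge0 ?sqr_ge0// ltW.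
by move: h1 h2 h3; rewrite !mulrDl !mul1r; have := sqr_ge0 Y; lra.
Qed.

Lemma sum_sqr_le (a b d : R) : (`|a| + `|b| + `|d|) ^+ 2 <= 3 * (a ^+ 2 + b ^+ 2 + d ^+ 2).
Proof.
rewrite -[in leRHS](real_normK (num_real a)) -[in leRHS](real_normK (num_real b))
  -[in leRHS](real_normK (num_real d)).
have := sqr_ge0 (`|a| - `|b|); have := sqr_ge0 (`|a| - `|d|); have := sqr_ge0 (`|b| - `|d|).
lra.
Qed.

Lemma functional_close (C E0 eps : R) : 0 < C -> 0 <= E0 -> 0 < eps ->
  exists2 d, 0 < d & forall (i1 i2 w q : R -> R), L1 i1 -> L1 i2 -> L1 w -> L1 q ->
  intR w <= E0 -> intR q < d ^+ 2 -> 
  (forall lam x, 0 < lam -> `|i1 x - i2 x| <= C * (lam * w x + (1 + lam^-1) * q x)) ->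
  `|intR i1 - intR i2| < eps.
Proof.
move=> C0 E00 eps0.
(* [lam] is fixed first, so that the wave part contributes at most [eps / 2]; the size of the
   perturbation is then chosen against [1 + lam^-1]. *)
pose lam := eps / (2 * C * (E0 + 1)).
have CE : 0 < 2 * C * (E0 + 1) by rewrite mulr_gt0 ?mulr_gt0// ltr_wpDl.
have l0 : 0 < lam by rewrite divr_gt0.
have m0 : 0 < C * (1 + lam^-1) by rewrite mulr_gt0// addr_gt0// invr_gt0.
pose z := eps / (2 * (C * (1 + lam^-1))).
have z0 : 0 < z by rewrite divr_gt0// mulr_gt0.
exists (Num.sqrt z); first by rewrite sqrtr_gt0.
move=> i1 i2 w q h1 h2 hw hq wE qd H; rewrite sqr_sqrtr ?(ltW z0)// in qd.
rewrite -intR_B//; apply: le_lt_trans (intR_le_norm (L1B h1 h2)) _.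
apply: (@le_lt_trans _ _ (intR (fun x => C * lam * w x + C * (1 + lam^-1) * q x))).
  apply: intR_mono; [by apply: L1_norm; exact: L1B|by apply: L1D; exact: L1Z|] => x.
  by apply: le_trans (H lam x l0) _; rewrite le_eqVlt; apply/orP; left; apply/eqP; ring.
rewrite intR_D; [|exact: L1Z|exact: L1Z]; rewrite (intR_Z _ hw) (intR_Z _ hq).
have a1 : C * lam * intR w <= eps / 2.
  apply: (@le_trans _ _ (C * lam * (E0 + 1))).
    have Cl : 0 < C * lam by rewrite mulr_gt0.
    by rewrite (ler_pM2l Cl) (le_trans wE)// lerDl.
  by rewrite le_eqVlt; apply/orP; left; apply/eqP; rewrite /lam; field; rewrite !gt_eqF// ltr_wpDl.
have a2 : C * (1 + lam^-1) * intR q < eps / 2.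
  apply: (@lt_le_trans _ _ (C * (1 + lam^-1) * z)); first by rewrite ltr_pM2l.
  by rewrite le_eqVlt; apply/orP; left; apply/eqP; rewrite /z; field; rewrite !gt_eqF// ?addr_gt0.
by move: a1 a2; clear -A; lra.
Qed.

End Continuity.

(** * Trapping near the orbit of a wave with positive speed *)

Section OrbitalTrap.
Variables (R : realType) (A sigma c : R) (phi phi1 phi2 eta : R -> R) (m0 : R).
Hypothesis sigma1 : sigma <= 1.
Hypothesis P : profile A sigma c phi phi1 phi2 eta m0.
Local Notation crit := (crit A).
Local Notation Mc := (c - crit).
Local Notation E0 := (Efun phi phi1 eta).
Local Notation F0 := (Ffun A sigma phi phi1 eta).

Let lphi : L2 phi. Proof. exact: pr_L2 P. Qed.
Let lphi1 : L2 phi1. Proof. exact: phi1_L2 P. Qed.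
Let leta : L2 eta. Proof. exact: eta_L2 P. Qed.
Let aphi : AC phi phi1. Proof. exact: phi_AC P. Qed.

Lemma conserved_close (eps : R) : 0 < eps -> exists2 d, 0 < d & forall f g v s,
  state f g v ->
  gap2 f g v (fun x => phi (x - s)) (fun x => phi1 (x - s)) (fun x => eta (x - s)) < d ^+ 2 ->
  `|Efun f g v - E0| < eps /\ `|Ffun A sigma f g v - F0| < eps.
Proof.
move=> ep.
have cphi := AC_continuous aphi.
have cphi1 : continuous phi1 by exact: phi1_cont P.
have ceta : continuous eta by exact: eta_cont P.
have [B1 B10 HB1] := continuous_decay_bounded cphi (phi_decay P).
have [B2 B20 HB2] := continuous_decay_bounded cphi1 (phi1_decay P).
pose B3 := crit^-1 * B1.
have HB3 x : `|eta x| <= B3.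
  apply: le_trans (eta_le P x) _.
  by rewrite ler_wpM2l// invr_ge0 ltW// crit_gt0.
have B30 : 0 <= B3 by rewrite mulr_ge0 ?invr_ge0// ltW// crit_gt0.
pose B := B1 + B2 + B3.
have B0 : 0 <= B by rewrite !addr_ge0// ltW.
pose C := 3 * (10 * (B + 1) * (1 + `|sigma| + `|A|)) + 6.
have C10 : 0 <= 10 * (B + 1) * (1 + `|sigma| + `|A|).
  have s0 := normr_ge0 sigma; have a0 := normr_ge0 A.
  by apply: mulr_ge0; [apply: mulr_ge0|]; lra.
have C0 : 0 < C by rewrite /C; lra.
have iw := L1_energy lphi lphi1 leta.
have [d0 d00 H0] := functional_close C0 (intR_ge0 (fun x =>
  addr_ge0 (addr_ge0 (sqr_ge0 (phi x)) (sqr_ge0 (phi1 x))) (sqr_ge0 (eta x)))) ep.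
(* By the Sobolev inequality a distance below [1 / 2] bounds [|U' - phi|] by [1], as [flux_diff]
   requires. *)
pose d := Num.min d0 (1 / 2).
have dp : 0 < d by rewrite lt_min d00 divr_gt0.
have dd0 : d <= d0 by rewrite ge_min lexx.
have d1 : d <= 1 / 2 by rewrite ge_min lexx orbT.
exists d => // f g v s st gp.
have [lf lg w lv] := st; have [U [aU lU ae]] := AC_rep st.
pose U' x := U (x + s); pose g' x := g (x + s); pose v' x := v (x + s).
have lU' : L2 U' by exact: L2_shift.
have lg' : L2 g' by exact: L2_shift.
have lv' : L2 v' by exact: L2_shift.
have aU' : AC U' g' by exact: AC_shift.
rewrite (gap2_ae lf lU lg lv (L2_shift (- s) lphi) (L2_shift (- s) lphi1)
  (L2_shift (- s) leta) ae) -gap2_shift// -/U' -/g' -/v' in gp.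
rewrite (Efun_ae lf lU lg lv ae) (Ffun_ae A sigma lf lU lg lv ae).
rewrite -(Efun_shift s lU lg lv) -(Ffun_shift A sigma s lU lg lv) -/U' -/g' -/v'.
have iq := L1_gap2 lU' lg' lv' lphi lphi1 leta.
have sup x : `|U' x - phi x| <= 1.
  have := gap2_sup x aU' lU' lg' lv' aphi lphi lphi1 leta => h.
  rewrite -(@ler_pXn2r _ 2)// ?nnegrE// real_normK ?num_real// expr1n.
  apply: le_trans h _.
  have : d ^+ 2 <= (1 / 2) ^+ 2 by rewrite ler_pXn2r// ?nnegrE; lra.
  by move: gp; lra.
have qd : gap2 U' g' v' phi phi1 eta < d0 ^+ 2.
  by apply: lt_le_trans gp _; rewrite ler_pXn2r// nnegrE ltW.
have [UM UM0 HU] := continuous_decay_bounded (AC_continuous aU') (sobolev_decay aU' lU' lg').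
have iE := L1_energy lU' lg' lv'.
have iF := L1_flux A sigma HU lU' lg' lv'.
have iF0 := L1_flux A sigma HB1 lphi lphi1 leta.
have split2 x : (U' x = phi x + (U' x - phi x)) * (g' x = phi1 x + (g' x - phi1 x))
  * (v' x = eta x + (v' x - eta x)).
  by do !split; ring.
have yx x lam : 0 < lam -> (`|U' x - phi x| + `|g' x - phi1 x| + `|v' x - eta x|) *
    ((`|phi x| + `|phi1 x| + `|eta x|) + (`|U' x - phi x| + `|g' x - phi1 x| + `|v' x - eta x|))
    <= 3 * (lam * (phi x ^+ 2 + phi1 x ^+ 2 + eta x ^+ 2) + (1 + lam^-1) *
     ((U' x - phi x) ^+ 2 + (g' x - phi1 x) ^+ 2 + (v' x - eta x) ^+ 2)).
  by move=> l0; apply: young_split => //; exact: sum_sqr_le.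
have rhs0 x lam : 0 < lam -> 0 <= lam * (phi x ^+ 2 + phi1 x ^+ 2 + eta x ^+ 2) + (1 + lam^-1) *
     ((U' x - phi x) ^+ 2 + (g' x - phi1 x) ^+ 2 + (v' x - eta x) ^+ 2).
  move=> l0; have lV : 0 < lam^-1 by rewrite invr_gt0.
  by rewrite addr_ge0// mulr_ge0// ?addr_ge0 ?sqr_ge0// ltW.
have half (a b : R) : `|a - b| < eps -> `|a / 2 - b / 2| < eps.
  rewrite -mulrBl normrM (ger0_norm (_ : 0 <= 2^-1))// => h.
  by have := normr_ge0 (a - b); lra.
split; apply: half.
- apply: (H0 _ _ _ _ iE iw iw iq _ qd) => // lam x l0.
  have := energy_diff (phi x) (phi1 x) (eta x) (U' x - phi x) (g' x - phi1 x) (v' x - eta x).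
  rewrite -!split2 => h; apply: le_trans h _.
  have := yx x lam l0; have := rhs0 x lam l0; move: (_ * (phi x ^+ 2 + _ + _) + _) => z z0 h.
  apply: (@le_trans _ _ (2 * (3 * z))); first by rewrite ler_pM2l.
  by rewrite mulrA ler_wpM2r// /C; move: C10; clear -P sigma1 lphi lphi1 leta aphi; lra.
apply: (H0 _ _ _ _ iF iF0 iw iq _ qd) => // lam x l0.
have XB : `|phi x| + `|phi1 x| + `|eta x| <= B by rewrite !lerD.
have := flux_diff A sigma (sup x) B0 erefl erefl XB (q := phi1 x) (r := eta x)
  (e := g' x - phi1 x) (n := v' x - eta x).
rewrite -!split2 => h; apply: le_trans h _.
have := yx x lam l0; have := rhs0 x lam l0; move: (_ * (phi x ^+ 2 + _ + _) + _) => z z0 h.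
apply: le_trans (ler_wpM2l C10 h) _.
by rewrite mulrA ler_wpM2r// /C; move: C10; clear -P sigma1 lphi lphi1 leta aphi; lra.
Qed.

(** Within [r0] of the orbit the Sobolev inequality gives a uniform distance below [2 r0], so the
    perturbation has a positive maximum at a level within [eps0] of the crest. The translation that
    brings this maximum to [m0] is the one for which [core] applies. *)
Lemma orbital : exists2 r0, 0 < r0 & forall eps, 0 < eps -> exists2 del, 0 < del &
  forall f g v s, state f g v ->
  gap2 f g v (fun x => phi (x - s)) (fun x => phi1 (x - s)) (fun x => eta (x - s)) < r0 ^+ 2 ->
  `|Efun f g v - E0| < del -> `|Ffun A sigma f g v - F0| < del ->
  exists s', gap2 f g v (fun x => phi (x - s')) (fun x => phi1 (x - s'))
    (fun x => eta (x - s')) < eps ^+ 2.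
Proof.
have cc := pr_c P; have c1 := crit_gt0 A.
have [eps0 e00 Hcore] := core sigma1 P.
pose r0 := Num.min eps0 Mc / 2.
have m00 : 0 < Num.min eps0 Mc by rewrite lt_min e00 subr_gt0.
have r00 : 0 < r0 by rewrite divr_gt0.
have r2 : 2 * r0 = Num.min eps0 Mc by rewrite /r0; field.
have re : 2 * r0 <= eps0 by rewrite r2 ge_min lexx.
have rM : 2 * r0 <= Mc by rewrite r2 ge_min lexx orbT.
exists r0 => // eps ep; have [del del0 Hdel] := Hcore _ ep.
exists del => // f g v s st gp dE dF.
have [lf lg w lv] := st; have [U [aU lU ae]] := AC_rep st.
have aphis : AC (fun x => phi (x - s)) (fun x => phi1 (x - s)) by exact: AC_shift.
have lps := L2_shift (- s) lphi; have lp1s := L2_shift (- s) lphi1; have les := L2_shift (- s) leta.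
rewrite (gap2_ae lf lU lg lv lps lp1s les ae) in gp.
rewrite (Efun_ae lf lU lg lv ae) in dE; rewrite (Ffun_ae A sigma lf lU lg lv ae) in dF.
have sup x : `|U x - phi (x - s)| < 2 * r0.
  have h := gap2_sup x aU lU lg lv aphis lps lp1s les.
  have r20 : 0 <= 2 * r0 by rewrite mulr_ge0// ltW.
  rewrite -(@ltr_pXn2r _ 2)// ?nnegrE// real_normK ?num_real//.
  apply: le_lt_trans h _; rewrite exprMn.
  by have := exprn_gt0 2 r00; move: gp; lra.
have top : phi (m0 + s - s) = Mc by rewrite addrK (pr_top P).
have Upos : 0 < U (m0 + s).
  by have := sup (m0 + s); rewrite top ltr_norml => /andP[]; lra.
have [x0 Hx0] := decay_max (AC_continuous aU) (sobolev_decay aU lU lg) Upos.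
pose t := x0 - m0.
have xt : m0 + t = x0 by rewrite /t; ring.
exists t; rewrite (gap2_ae lf lU lg lv (L2_shift (- t) lphi) (L2_shift (- t) lphi1)
  (L2_shift (- t) leta) ae) -gap2_shift//.
apply: Hdel; [exact: AC_shift|exact: L2_shift|exact: L2_shift|exact: L2_shift| | | | |].
- move=> x; have := sup (x + t); rewrite ltr_norml => /andP[h _].
  by have := pr_pos P (x + t - s); lra.
- by move=> x; rewrite xt.
- rewrite xt; have h1 := sup x0; have h2 := sup (m0 + s); have h3 := Hx0 (m0 + s).
  have h4 := pr_le P (x0 - s); rewrite top in h2.
  move: h1 h2; rewrite ler_norml !ltr_norml => /andP[? ?] /andP[? ?].
  by apply/andP; split; lra.
- by rewrite Efun_shift.
- by rewrite Ffun_shift.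
Qed.

End OrbitalTrap.

(** * The continuity argument in time *)

Section Bootstrap.
Variables (R : realType) (A sigma : R).
Implicit Types (phi psi eta f g v : R -> R).

Definition wave_gap phi psi eta f g v (s : R) : R :=
  gap2 f g v (fun x => phi (x - s)) (fun x => psi (x - s)) (fun x => eta (x - s)).

(** [r0] is chosen before [eps]: the gap between the two is what a continuous motion cannot jump.
    Speed and crest are absent from the formulation, so that both directions of propagation fit. *)
Definition orbital_trap (A sigma : R) phi psi eta : Prop :=
  exists2 r0, 0 < r0 & forall eps, 0 < eps -> exists2 d, 0 < d &
  forall f0 g0 v0 s0 f g v s, state f0 g0 v0 -> state f g v ->
    wave_gap phi psi eta f0 g0 v0 s0 < d ^+ 2 ->
    Efun f g v = Efun f0 g0 v0 -> Ffun A sigma f g v = Ffun A sigma f0 g0 v0 ->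
    wave_gap phi psi eta f g v s < r0 ^+ 2 ->
    exists s', wave_gap phi psi eta f g v s' < eps ^+ 2.

Lemma profile_trap (c m0 : R) (phi psi psi' eta : R -> R) : sigma <= 1 ->
  profile A sigma c phi psi psi' eta m0 -> orbital_trap A sigma phi psi eta.
Proof.
move=> sigma1 P; have [r0 r00 H] := orbital sigma1 P.
exists r0 => // eps ep; have [del del0 Hdel] := H _ ep.
have [d d0 Hd] := conserved_close P del0.
exists d => // f0 g0 v0 s0 f g v s st0 st g0' eE eF gr.
have [hE hF] := Hd _ _ _ _ st0 g0'.
by apply: (Hdel f g v s st gr); rewrite ?eE ?eF.
Qed.

Lemma wave_gapN phi psi eta f g v s :
  wave_gap (fun x => - phi x) (fun x => - psi x) eta (fun x => - f x) (fun x => - g x) v s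
  = wave_gap phi psi eta f g v s.
Proof. by apply: eq_intR => x; ring. Qed.

Lemma L1_flux_state f g v : state f g v ->
  L1 (fun x => f x ^+ 3 + sigma * f x * g x ^+ 2 + 2 * f x * v x
                 + f x * v x ^+ 2 - A * f x ^+ 2).
Proof.
move=> st; have [lf lg w lv] := st; have [U [aU lU ae]] := AC_rep st.
have [M M0 HM] := continuous_decay_bounded (AC_continuous aU) (sobolev_decay aU lU lg).
apply: ae_L1 (L1_flux A sigma HM lU lg lv); first exact: flux_measurable.
by apply: (ae_imp ae) => x ->.
Qed.

Lemma orbital_trapN phi psi eta :
  orbital_trap (- A) sigma (fun x => - phi x) (fun x => - psi x) eta ->
  orbital_trap A sigma phi psi eta.
Proof.
move=> [r0 r00 H]; exists r0 => // eps ep; have [d d0 Hd] := H _ ep.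
exists d => // f0 g0 v0 s0 f g v s st0 st g0' eE eF gr.
have EN h k w : Efun (fun x : R => - h x) (fun x => - k x) w = Efun h k w.
  by congr (_ / 2); apply: eq_intR => x; ring.
have FN h k w : state h k w -> Ffun (- A) sigma (fun x : R => - h x) (fun x => - k x) w =
    - Ffun A sigma h k w.
  move=> sh; rewrite /Ffun -mulNr -intR_N; last exact: L1_flux_state sh.
  by congr (_ / 2); apply: eq_intR => x; ring.
have [s' Hs'] : exists s', wave_gap (fun x => - phi x) (fun x => - psi x) eta
    (fun x => - f x) (fun x => - g x) v s' < eps ^+ 2; last first.
  by exists s'; rewrite -wave_gapN.
apply: (Hd _ _ _ s0 _ _ _ s (stateN st0) (stateN st)); rewrite ?wave_gapN ?EN//.
by rewrite !FN// eF.
Qed.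

Lemma trap_stable phi psi eta : state phi psi eta ->
  orbital_trap A sigma phi psi eta -> stable A sigma phi eta.
Proof.
move=> W [r0 r00 H] e e0.
(* By [gap2_tri], two distances below [rho] give a squared distance below [4 rho ^ 2 <= r0 ^ 2], so
   a state near a trapped one is again subject to the trap. *)
pose rho := Num.min e (r0 / 2).
have rho0 : 0 < rho by rewrite lt_min e0 divr_gt0.
have rhoe : rho <= e by rewrite ge_min lexx.
have rhor : rho <= r0 / 2 by rewrite ge_min lexx orbT.
have [d d0 Hd] := H _ rho0.
pose del := Num.min d rho.
have del0 : 0 < del by rewrite lt_min d0.
have deld : del <= d by rewrite ge_min lexx.
have delr : del <= rho by rewrite ge_min lexx orbT.
exists del => // T u v T0 [_ [s0 D0]] [ux [H1 H2 _ _ H5]] t ht.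
have st x : in_time T x -> state (u x) (ux x) (v x) by move=> /H1[? [? [? ?]]].
have WS s := state_shift s W.
have in0 : in_time T 0 by split.
have g0 : wave_gap phi psi eta (u 0) (ux 0) (v 0) s0 < del ^+ 2.
  by apply/(dist_gap2 _ (st _ in0) (WS s0)).
have g0d : wave_gap phi psi eta (u 0) (ux 0) (v 0) s0 < d ^+ 2.
  by apply: lt_le_trans g0 _; rewrite ler_pXn2r// nnegrE ltW.
pose Pr x := exists s, wave_gap phi psi eta (u x) (ux x) (v x) s < rho ^+ 2.
(* Used for both conditions of [real_induction]: from a time to slightly later ones, and from
   slightly earlier times to their limit. *)
have step x y : in_time T x -> in_time T y ->
    gap2 (u x) (ux x) (v x) (u y) (ux y) (v y) < rho ^+ 2 -> Pr y -> Pr x.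
  move=> hx hy hxy [s hs]; have [eE eF] := H5 x hx.
  apply: (Hd _ _ _ s0 _ _ _ s (st _ in0) (st _ hx) g0d eE eF).
  apply: le_lt_trans (gap2_tri (st _ hx) (st _ hy) (WS s)) _.
  have : rho ^+ 2 <= (r0 / 2) ^+ 2.
    by rewrite ler_pXn2r// nnegrE ?(ltW rho0)// divr_ge0// ltW.
  by rewrite exprMn; move: hs hxy; rewrite /wave_gap; lra.
have near x : in_time T x -> exists2 k, 0 < k & forall y, in_time T y -> `|y - x| < k ->
    gap2 (u y) (ux y) (v y) (u x) (ux x) (v x) < rho ^+ 2.
  move=> hx; have [k k0 Hk] := H2 x hx rho rho0; exists k => // y hy yx.
  by apply/(dist_gap2 _ (st _ hy) (st _ hx)); exact: Hk.
have [t0 tT] := ht.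
have inT x : 0 <= x <= t -> in_time T x.
  by move=> /andP[x0 xt]; split=> //; apply: le_lt_trans tT; rewrite lee_fin.
have [s hs] : Pr t.
  apply: (@real_induction R 0 t Pr t0).
  - by exists s0; apply: lt_le_trans g0 _; rewrite ler_pXn2r// nnegrE ltW.
  - move=> x /andP[x0 xt] px; have hx : in_time T x by apply: inT; rewrite x0 ltW.
    have [k k0 Hk] := near x hx; exists k => // y /andP[xy yk] yt.
    have hy : in_time T y by apply: inT; rewrite yt andbT (le_trans x0)// ltW.
    by apply: (step _ _ hy hx (Hk y hy _) px); rewrite ltr_norml; apply/andP; split; lra.
  - move=> x /andP[x0 xt] px; have hx : in_time T x by apply: inT; rewrite xt ltW.
    have [k k0 Hk] := near x hx.
    pose y := Num.max 0 (x - k / 2).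
    have yx : y < x by rewrite gt_max x0/=; lra.
    have y0 : 0 <= y by rewrite le_max lexx.
    have yk : x - k / 2 <= y by rewrite le_max lexx orbT.
    have hy : in_time T y by apply: inT; rewrite y0 (le_trans (ltW yx)).
    apply: (step _ _ hx hy _ (px _ _)); last by rewrite y0.
    by rewrite gap2C; apply: (Hk y hy); rewrite ltr_norml; apply/andP; split; lra.
have [lu lux wu lv] := st t ht.
split; first by split=> //; split=> //; exists (ux t).
exists s; apply/(dist_gap2 _ (st _ ht) (WS s)).
by apply: lt_le_trans hs _; rewrite ler_pXn2r// nnegrE ltW.
Qed.

End Bootstrap.

Theorem theorem3p2 (R : realType) (A sigma c : R) (phi etac : R -> R) :
  0 < A -> sigma <= 1 ->
  solitary_wave A sigma c phi etac -> smooth1 phi -> smooth1 etac ->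
  stable A sigma phi etac.
Proof.
move=> _ sigma1 SW sphi seta; have S := wave_stationary SW sphi seta.
have lphi := st_L2 S; have lphi1 := st_L21 S.
have leta : L2 etac by case: SW => -[_ []].
have st : state phi (derive1 phi) etac.
  by split=> //; exact: AC_weak_deriv (smooth1_AC sphi).
apply: (trap_stable st).
have [c0|c0|c0] := ltgtP c 0; last by move: (speed_neq0 S); rewrite c0 eqxx.
- have cN : 0 < - c by rewrite oppr_gt0.
  have [m0 P] := stationary_profile sigma1 (stationaryN S) cN.
  exact: orbital_trapN (profile_trap sigma1 P).
- have [m0 P] := stationary_profile sigma1 S c0.
  exact: profile_trap sigma1 P.
Qed.
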